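(* Let $G$ be a smooth (affine) algebraic group over a field $K$ and let $X$ be a (quasi-projective) left $G$-variety over $K$. Then the descent equivariant Zariski tangent category $((\mathbf{Sch}_{/X})_G,\mathbb T)$, i.e. the category of pseudocones of the pseudofunctor $\mathcal S:\mathbf{Sf}(G)^{\mathrm{op}}\to\mathbf{Cat}$, $\Gamma\mapsto\mathbf{Sch}_{/{}_\Gamma X}$, $f\mapsto\overline f^*$, equipped with the pseudolimit structure $\mathbb T$ induced by the Zariski tangent structures on the categories $\mathbf{Sch}_{/{}_\Gamma X}$, is a tangent category.
   Context: Tangent categories. A tangent structure $\mathbb T=(T,p,0,+,\ell,c)$ on a category $\mathscr D$ consists of a functor $T:\mathscr D\to\mathscr D$ and natural transformations $p:T\Rightarrow\mathrm{id}$, $0:\mathrm{id}\Rightarrow T$, $+:T_2\Rightarrow T$, $\ell:T\Rightarrow T^2$, $c:T^2\Rightarrow T^2$ such that: (1) for every object $A$ and $n\in\mathbb N$ the $n$-fold pullback power $T_nA$ of $p_A:TA\to A$ exists and is preserved by all $T^m$; (2) $(p_A,+_A,0_A)$ is a commutative monoid in $\mathscr D_{/A}$; (3) $T(p_A)\ell_A=0_Ap_A$, $\ell_A\circ{+_A}=T(+_A)\circ\langle\ell_A\pi_1,\ell_A\pi_2\rangle$, $\ell_A0_A=T(0_A)0_A$; (4) $p_{TA}c_A=T(p_A)$, $c_A\circ T(+_A)={+_{TA}}\circ\langle c_AT(\pi_1),c_AT(\pi_2)\rangle$, $c_AT(0_A)=0_{TA}$; (5) $c_Ac_A=\mathrm{id}$,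 $c_A\ell_A=\ell_A$, $T(\ell_A)\ell_A=\ell_{TA}\ell_A$, $c_{TA}T(c_A)c_{TA}=T(c_A)c_{TA}T(c_A)$, $c_{TA}T(c_A)\ell_{TA}=T(\ell_A)c_A$; (6) $T(+_A)\circ\langle\ell_A\pi_1,0_{TA}\pi_2\rangle:T_2A\to T^2A$ is an equalizer of $T(p_A)$ and $0_A\,p_A\,p_{TA}:T^2A\rightrightarrows TA$. Zariski tangent structure on $\mathbf{Sch}_{/S}$ (a known tangent structure): tangent functor $Z\mapsto T_{Z/S}=\underline{\mathrm{Spec}}_Z(\mathrm{Sym}(\Omega^1_{Z/S}))$, structure maps glued from affine pieces $S=\mathrm{Spec}A$, $Z=\mathrm{Spec}B$, where $\mathrm{Sym}_B(\Omega^1_{B/A})$ is generated by $b,\mathrm db$ and the ring of $T^2_{B/A}$ by $b,\mathrm db,\delta b,\delta\mathrm db$: $p$ dual to $b\mapsto b$; $0$ to $b\mapsto b,\mathrm db\mapsto0$; $+$ to $b\mapsto b\otimes1,\mathrm db\mapsto\mathrm db\otimes1+1\otimes\mathrm db$; $\ell$ to $b\mapsto b,\mathrm db\mapsto0,\delta b\mapsto0,\delta\mathrm db\mapsto\mathrm db$; $c$ to $b\mapsto b,\mathrm db\leftrightarrow\delta b,\delta\mathrm db\mapsto\delta\mathrm db$. For $g:V\to W$, $g^*Z=Z\times_WV$, and ${}_gT:g^*T_{Z/W}\to T_{g^*Z/V}$ is the canonical isomorphism (affine-locally dual to $b\otimes a\mapsto b\otimes a$, $\mathrm d(b\otimes a)\mapsto\mathrm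 db\otimes a$). Equivariant setting. $K$-varieties are assumed quasi-projective. $\mathbf{Sf}(G)$: objects are smooth free $G$-varieties $\Gamma$ of pure dimension (left $G$-varieties with a geometric quotient $\Gamma\to G\backslash\Gamma$ that is a smooth, étale locally trivial principal fibration with fibre $G$); morphisms are smooth $G$-equivariant maps of constant fibre dimension. ${}_\Gamma X=G\backslash(\Gamma\times X)$ (this quotient variety exists), and $f:\Gamma\to\Gamma'$ induces a unique smooth $\overline f:{}_\Gamma X\to{}_{\Gamma'}X$ compatible with $f\times\mathrm{id}_X$ and the quotient maps. Pseudocone category: objects of $\mathbf{PC}(\mathcal S)$ are families ${}_\Gamma A\in\mathbf{Sch}_{/{}_\Gamma X}$ with isomorphisms $\tau_f:\overline f^*({}_{\Gamma'}A)\to{}_\Gamma A$ for $f:\Gamma\to\Gamma'$ satisfying the cocycle condition $\tau_{g f}\circ\phi_{f,g}=\tau_f\circ\overline f^*(\tau_g)$ ($\phi$ the canonical isomorphisms $\overline f^*\overline g^*\cong(\overline{gf})^*$); morphisms are families of morphisms compatible with the $\tau_f$. The pseudolimit structure $\mathbb T$: the tangent functor sends $A$ to the family $T_{{}_\Gamma A/{}_\Gamma X}$ with transition isomorphisms $T(\tau_f)\circ({}_{\overline f}T)_{{}_{\Gamma'}A}$; the transformations $p,0,+,\ell,c$ are componentwise those of the Zariski tangent structures. *)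

(* Defs.v *)
From HB Require Import structures.
From mathcomp Require Import all_boot all_order all_algebra.
From mathcomp Require Import boolp.

Set Implicit Arguments.
Unset Strict Implicit.
Unset Printing Implicit Defensive.
Import GRing.Theory.
Local Open Scope ring_scope.
Local Open Scope quotient_scope.

Declare Scope cat_scope.
Delimit Scope cat_scope with cat.
Local Open Scope cat_scope.

Record category := Category {
  ob :> Type;
  hom : ob -> ob -> Type;
  idc : forall A, hom A A;
  compc : forall A B C, hom B C -> hom A B -> hom A C;
  compcA : forall A B C D (h : hom C D) (g : hom B C) (f : hom A B),
    compc h (compc g f) = compc (compc h g) f;
  comp1c : forall A B (f : hom A B), compc (idc B) f = f;
  compc1 : forall A B (f : hom A B), compc f (idc A) = f }.

Arguments idc {c} A.
Arguments compc {c A B C} g f.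
Notation "g ∘ f" := (compc g f) (at level 40, left associativity) : cat_scope.

Definition is_iso (C : category) (A B : C) (f : hom A B) : Prop :=
  exists g : hom B A, g ∘ f = idc A /\ f ∘ g = idc B.

Record functor (C D : category) := Functor {
  fob :> C -> D;
  fmap : forall A B : C, hom A B -> hom (fob A) (fob B);
  fmap1 : forall A, fmap (idc A) = idc (fob A);
  fmapM : forall A B E (g : hom B E) (f : hom A B),
    fmap (g ∘ f) = fmap g ∘ fmap f }.

Arguments fmap {C D} f0 {A B} f1.

Fixpoint iterhom (C : category) (T : functor C C) m (A B : C) (f : hom A B) :
    hom (iter m T A) (iter m T B) :=
  match m with
  | 0 => f
  | m'.+1 => fmap T (iterhom T m' f)
  end.

Section Limits.
Variable C : category.

Definition is_pullback (X Y Z P : C) (f : hom X Z) (g : hom Y Z)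
    (p1 : hom P X) (p2 : hom P Y) : Prop :=
  f ∘ p1 = g ∘ p2 /\
  forall (W : C) (u : hom W X) (v : hom W Y), f ∘ u = g ∘ v ->
    exists! h : hom W P, p1 ∘ h = u /\ p2 ∘ h = v.

(* [base : P -> A] is the structural map to the base, so that for n = 0 the
   pullback power is A itself. *)
Definition is_power n (B A P : C) (p : hom B A)
    (base : hom P A) (proj : 'I_n -> hom P B) : Prop :=
  (forall i, p ∘ proj i = base) /\
  forall (W : C) (x : hom W A) (u : 'I_n -> hom W B), (forall i, p ∘ u i = x) ->
    exists! h : hom W P, base ∘ h = x /\ forall i, proj i ∘ h = u i.

Definition is_equalizer (E X Y : C) (f g : hom X Y) (e : hom E X) : Prop :=
  f ∘ e = g ∘ e /\
  forall (W : C) (u : hom W X), f ∘ u = g ∘ u -> exists! h : hom W E, e ∘ h = u.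

Record pullback (X Y Z : C) (f : hom X Z) (g : hom Y Z) := Pullback {
  pbo :> C;
  pb1 : hom pbo X;
  pb2 : hom pbo Y;
  pbE : f ∘ pb1 = g ∘ pb2;
  pblift : forall (W : C) (u : hom W X) (v : hom W Y),
    f ∘ u = g ∘ v -> hom W pbo;
  pblift1 : forall W u v e, pb1 ∘ @pblift W u v e = u;
  pblift2 : forall W u v e, pb2 ∘ @pblift W u v e = v;
  pb_ext : forall (W : C) (h k : hom W pbo),
    pb1 ∘ h = pb1 ∘ k -> pb2 ∘ h = pb2 ∘ k -> h = k }.

Definition cleavage :=
  forall (X Y Z : C) (f : hom X Z) (g : hom Y Z), pullback f g.

End Limits.

Arguments pb1 {C X Y Z f g} p.
Arguments pb2 {C X Y Z f g} p.
Arguments pblift {C X Y Z f g} p {W} u v e.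

(* Pairings into T (T2 A) are expressed by an existential over the (unique)
   morphism with the prescribed projections. *)
Record tangent_on (D : category) (T : functor D D) := TangentOn {
  tp : forall A, hom (T A) A;
  tp_nat : forall A B (f : hom A B), tp B ∘ fmap T f = f ∘ tp A;
  tz : forall A, hom A (T A);
  tz_nat : forall A B (f : hom A B), fmap T f ∘ tz A = tz B ∘ f;
  t_powers : forall (A : D) (n : nat),
    exists (P : D) (base : hom P A) (proj : 'I_n -> hom P (T A)),
      forall m, is_power (iterhom T m (tp A)) (iterhom T m base)
                         (fun i => iterhom T m (proj i));
  t2 : forall A, pullback (tp A) (tp A);
  tadd : forall A, hom (t2 A) (T A);
  tadd_nat : forall A B (f : hom A B), exists h : hom (t2 A) (t2 B),
    [/\ pb1 (t2 B) ∘ h = fmap T f ∘ pb1 (t2 A),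
        pb2 (t2 B) ∘ h = fmap T f ∘ pb2 (t2 A)
      & fmap T f ∘ tadd A = tadd B ∘ h];
  tl : forall A, hom (T A) (T (T A));
  tl_nat : forall A B (f : hom A B),
    fmap T (fmap T f) ∘ tl A = tl B ∘ fmap T f;
  tc : forall A, hom (T (T A)) (T (T A));
  tc_nat : forall A B (f : hom A B),
    fmap T (fmap T f) ∘ tc A = tc B ∘ fmap T (fmap T f);

  (* commutative monoid over A, on generalized elements *)
  tp_add : forall A, tp A ∘ tadd A = tp A ∘ pb1 (t2 A);
  tp_z : forall A, tp A ∘ tz A = idc A;
  taddA : forall A (W : D) (u v w : hom W (T A))
    (euv : tp A ∘ u = tp A ∘ v) (evw : tp A ∘ v = tp A ∘ w)
    (e1 : tp A ∘ u = tp A ∘ (tadd A ∘ pblift (t2 A) v w evw))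
    (e2 : tp A ∘ (tadd A ∘ pblift (t2 A) u v euv) = tp A ∘ w),
    tadd A ∘ pblift (t2 A) u (tadd A ∘ pblift (t2 A) v w evw) e1 =
    tadd A ∘ pblift (t2 A) (tadd A ∘ pblift (t2 A) u v euv) w e2;
  taddC : forall A (W : D) (u v : hom W (T A))
    (euv : tp A ∘ u = tp A ∘ v) (evu : tp A ∘ v = tp A ∘ u),
    tadd A ∘ pblift (t2 A) u v euv = tadd A ∘ pblift (t2 A) v u evu;
  tadd0 : forall A (W : D) (u : hom W (T A))
    (e : tp A ∘ u = tp A ∘ (tz A ∘ (tp A ∘ u))),
    tadd A ∘ pblift (t2 A) u (tz A ∘ (tp A ∘ u)) e = u;

  tl_p : forall A, fmap T (tp A) ∘ tl A = tz A ∘ tp A;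
  tl_add : forall A, exists h : hom (t2 A) (T (t2 A)),
    [/\ fmap T (pb1 (t2 A)) ∘ h = tl A ∘ pb1 (t2 A),
        fmap T (pb2 (t2 A)) ∘ h = tl A ∘ pb2 (t2 A)
      & tl A ∘ tadd A = fmap T (tadd A) ∘ h];
  tl_z : forall A, tl A ∘ tz A = fmap T (tz A) ∘ tz A;

  tc_p : forall A, tp (T A) ∘ tc A = fmap T (tp A);
  tc_add : forall A, exists h : hom (T (t2 A)) (t2 (T A)),
    [/\ pb1 (t2 (T A)) ∘ h = tc A ∘ fmap T (pb1 (t2 A)),
        pb2 (t2 (T A)) ∘ h = tc A ∘ fmap T (pb2 (t2 A))
      & tc A ∘ fmap T (tadd A) = tadd (T A) ∘ h];
  tc_z : forall A, tc A ∘ fmap T (tz A) = tz (T A);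

  tcc : forall A, tc A ∘ tc A = idc (T (T A));
  tc_l : forall A, tc A ∘ tl A = tl A;
  tl_l : forall A, fmap T (tl A) ∘ tl A = tl (T A) ∘ tl A;
  tc_hex : forall A, tc (T A) ∘ fmap T (tc A) ∘ tc (T A) =
                     fmap T (tc A) ∘ tc (T A) ∘ fmap T (tc A);
  tc_lc : forall A, tc (T A) ∘ fmap T (tc A) ∘ tl (T A) = fmap T (tl A) ∘ tc A;

  t_universal : forall A, exists h : hom (t2 A) (T (t2 A)),
    [/\ fmap T (pb1 (t2 A)) ∘ h = tl A ∘ pb1 (t2 A),
        fmap T (pb2 (t2 A)) ∘ h = tz (T A) ∘ pb2 (t2 A)
      & is_equalizer (fmap T (tp A)) (tz A ∘ tp A ∘ tp (T A))
          (fmap T (tadd A) ∘ h)] }.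

Notation ring := comPzRingType.

Definition rid (A : ring) : {rmorphism A -> A} := idfun.
Definition rcomp (A B C : ring) (g : {rmorphism B -> C}) (f : {rmorphism A -> B}) :
  {rmorphism A -> C} := g \o f.

Lemma rmorph_ext (A B : ring) (f g : {rmorphism A -> B}) : f =1 g -> f = g.
Proof.
move: f g => [f cf] [g cg] /= /funext efg; move: cf cg; rewrite efg => cf cg.
by congr GRing.RMorphism.Pack; case: cf cg => [[a1] [b1]] [[a2] [b2]];
  rewrite (Prop_irrelevance a1 a2) (Prop_irrelevance b1 b2).
Qed.

(* Omega_{B/A} for phi : A -> B: the B-module on generators d b, modulo
   additivity, the Leibniz rule and d (phi a) = 0. *)
Section Kaehler.
Variables (A B : ring) (phi : {rmorphism A -> B}).

Inductive om_term : Type :=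
  | OmD of B
  | OmZero
  | OmAdd of om_term & om_term
  | OmOpp of om_term
  | OmScale of B & om_term.

Inductive om_rel : om_term -> om_term -> Prop :=
  | om_refl x : om_rel x x
  | om_sym x y : om_rel x y -> om_rel y x
  | om_trans y x z : om_rel x y -> om_rel y z -> om_rel x z
  | om_addl x x' y : om_rel x x' -> om_rel (OmAdd x y) (OmAdd x' y)
  | om_opp x x' : om_rel x x' -> om_rel (OmOpp x) (OmOpp x')
  | om_scale b x x' : om_rel x x' -> om_rel (OmScale b x) (OmScale b x')
  | om_addA x y z : om_rel (OmAdd x (OmAdd y z)) (OmAdd (OmAdd x y) z)
  | om_addC x y : om_rel (OmAdd x y) (OmAdd y x)
  | om_add0 x : om_rel (OmAdd OmZero x) x
  | om_addN x : om_rel (OmAdd (OmOpp x) x) OmZero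
  | om_scaleA a b x : om_rel (OmScale a (OmScale b x)) (OmScale (a * b) x)
  | om_scale1 x : om_rel (OmScale 1 x) x
  | om_scaleDr b x y :
      om_rel (OmScale b (OmAdd x y)) (OmAdd (OmScale b x) (OmScale b y))
  | om_scaleDl a b x :
      om_rel (OmScale (a + b) x) (OmAdd (OmScale a x) (OmScale b x))
  | om_dD a b : om_rel (OmD (a + b)) (OmAdd (OmD a) (OmD b))
  | om_dM a b :
      om_rel (OmD (a * b)) (OmAdd (OmScale a (OmD b)) (OmScale b (OmD a)))
  | om_dC a : om_rel (OmD (phi a)) OmZero.

HB.instance Definition _ := gen_eqMixin om_term.
HB.instance Definition _ := gen_choiceMixin om_term.

Definition om_relb (x y : om_term) : bool := `[< om_rel x y >].

Lemma om_relb_refl : reflexive om_relb.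
Proof. by move=> x; apply/asboolP/om_refl. Qed.
Lemma om_relb_sym : symmetric om_relb.
Proof. by move=> x y; apply/asboolP/asboolP => /om_sym. Qed.
Lemma om_relb_trans : transitive om_relb.
Proof. by move=> y x z /asboolP h /asboolP h'; apply/asboolP; exact: om_trans h h'. Qed.

Canonical om_equiv := EquivRel om_relb om_relb_refl om_relb_sym om_relb_trans.

Definition Omega := {eq_quot om_equiv}.
HB.instance Definition _ := Choice.on Omega.

Definition om_pi (x : om_term) : Omega := \pi_Omega x.

Lemma om_piP x y : om_rel x y -> om_pi x = om_pi y.
Proof. by move=> h; apply/eqmodP/asboolP. Qed.

Lemma om_piK x : om_rel (repr (om_pi x)) x.
Proof.
have /eqmodP /asboolP // : repr (om_pi x) = x %[mod Omega].
by rewrite reprK.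
Qed.

Lemma om_ind (P : Omega -> Prop) : (forall x, P (om_pi x)) -> forall q, P q.
Proof. by move=> h q; rewrite -(reprK q); apply: h. Qed.

Definition om0 : Omega := om_pi OmZero.
Definition om_add_q (p q : Omega) : Omega := om_pi (OmAdd (repr p) (repr q)).
Definition om_opp_q (p : Omega) : Omega := om_pi (OmOpp (repr p)).
Definition om_scale_q (b : B) (p : Omega) : Omega := om_pi (OmScale b (repr p)).

Lemma om_addE x y : om_add_q (om_pi x) (om_pi y) = om_pi (OmAdd x y).
Proof.
apply: om_piP; apply: (om_trans (om_addl _ (om_piK x))).
apply: (om_trans (om_addC _ _)); apply: (om_trans (om_addl _ (om_piK y))).
exact: om_addC.
Qed.
Lemma om_oppE x : om_opp_q (om_pi x) = om_pi (OmOpp x).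
Proof. by apply: om_piP; apply: om_opp; exact: om_piK. Qed.
Lemma om_scaleE b x : om_scale_q b (om_pi x) = om_pi (OmScale b x).
Proof. by apply: om_piP; apply: om_scale; exact: om_piK. Qed.

Let omE := (om_addE, om_oppE, om_scaleE).

Lemma om_q_addA : associative om_add_q.
Proof. by elim/om_ind=> x; elim/om_ind=> y; elim/om_ind=> z; rewrite !omE; apply: om_piP; exact: om_addA. Qed.
Lemma om_q_addC : commutative om_add_q.
Proof. by elim/om_ind=> x; elim/om_ind=> y; rewrite !omE; apply: om_piP; exact: om_addC. Qed.
Lemma om_q_add0 : left_id om0 om_add_q.
Proof. by elim/om_ind=> x; rewrite !omE; apply: om_piP; exact: om_add0. Qed.
Lemma om_q_addN : left_inverse om0 om_opp_q om_add_q.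
Proof. by elim/om_ind=> x; rewrite !omE; apply: om_piP; exact: om_addN. Qed.

HB.instance Definition _ :=
  GRing.isZmodule.Build Omega om_q_addA om_q_addC om_q_add0 om_q_addN.

Lemma om_q_scaleA a b (p : Omega) :
  om_scale_q a (om_scale_q b p) = om_scale_q (a * b) p.
Proof. by elim/om_ind: p => x; rewrite !omE; apply: om_piP; exact: om_scaleA. Qed.
Lemma om_q_scale1 : left_id 1 om_scale_q.
Proof. by elim/om_ind=> x; rewrite !omE; apply: om_piP; exact: om_scale1. Qed.
Lemma om_q_scaleDr : right_distributive om_scale_q +%R.
Proof.
move=> b; elim/om_ind=> x; elim/om_ind=> y; rewrite /GRing.add /= !omE.
by apply: om_piP; exact: om_scaleDr.
Qed.
Lemma om_q_scaleDl (p : Omega) : {morph om_scale_q^~ p : a b / a + b}.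
Proof.
move=> a b; elim/om_ind: p => x; rewrite {2}/GRing.add /= !omE.
by apply: om_piP; exact: om_scaleDl.
Qed.

HB.instance Definition _ := GRing.Zmodule_isLmodule.Build B Omega
  om_q_scaleA om_q_scale1 om_q_scaleDr om_q_scaleDl.

Definition dOmega (b : B) : Omega := om_pi (OmD b).

End Kaehler.

(* The symmetric algebra of a B-module M: the commutative ring on generators
   b in B and m in M, modulo the ring structure of B and B-linearity in m. *)
Section SymmetricAlgebra.
Variables (B : ring) (M : lmodType B).

Inductive sy_term : Type :=
  | SyCst of B
  | SyGen of M
  | SyAdd of sy_term & sy_term
  | SyOpp of sy_term
  | SyMul of sy_term & sy_term.

Inductive sy_rel : sy_term -> sy_term -> Prop :=
  | sy_refl x : sy_rel x x
  | sy_sym x y : sy_rel x y -> sy_rel y x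
  | sy_trans y x z : sy_rel x y -> sy_rel y z -> sy_rel x z
  | sy_addl x x' y : sy_rel x x' -> sy_rel (SyAdd x y) (SyAdd x' y)
  | sy_opp x x' : sy_rel x x' -> sy_rel (SyOpp x) (SyOpp x')
  | sy_mull x x' y : sy_rel x x' -> sy_rel (SyMul x y) (SyMul x' y)
  | sy_addA x y z : sy_rel (SyAdd x (SyAdd y z)) (SyAdd (SyAdd x y) z)
  | sy_addC x y : sy_rel (SyAdd x y) (SyAdd y x)
  | sy_add0 x : sy_rel (SyAdd (SyCst 0) x) x
  | sy_addN x : sy_rel (SyAdd (SyOpp x) x) (SyCst 0)
  | sy_mulA x y z : sy_rel (SyMul x (SyMul y z)) (SyMul (SyMul x y) z)
  | sy_mulC x y : sy_rel (SyMul x y) (SyMul y x)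
  | sy_mul1 x : sy_rel (SyMul (SyCst 1) x) x
  | sy_mulDl x y z :
      sy_rel (SyMul (SyAdd x y) z) (SyAdd (SyMul x z) (SyMul y z))
  | sy_cstD a b : sy_rel (SyCst (a + b)) (SyAdd (SyCst a) (SyCst b))
  | sy_cstM a b : sy_rel (SyCst (a * b)) (SyMul (SyCst a) (SyCst b))
  | sy_genD m n : sy_rel (SyGen (m + n)) (SyAdd (SyGen m) (SyGen n))
  | sy_genZ b m : sy_rel (SyGen (b *: m)) (SyMul (SyCst b) (SyGen m)).

HB.instance Definition _ := gen_eqMixin sy_term.
HB.instance Definition _ := gen_choiceMixin sy_term.

Definition sy_relb (x y : sy_term) : bool := `[< sy_rel x y >].

Lemma sy_relb_refl : reflexive sy_relb.
Proof. by move=> x; apply/asboolP/sy_refl. Qed.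
Lemma sy_relb_sym : symmetric sy_relb.
Proof. by move=> x y; apply/asboolP/asboolP => /sy_sym. Qed.
Lemma sy_relb_trans : transitive sy_relb.
Proof. by move=> y x z /asboolP h /asboolP h'; apply/asboolP; exact: sy_trans h h'. Qed.

Canonical sy_equiv := EquivRel sy_relb sy_relb_refl sy_relb_sym sy_relb_trans.

Definition Sym := {eq_quot sy_equiv}.
HB.instance Definition _ := Choice.on Sym.

Definition sy_pi (x : sy_term) : Sym := \pi_Sym x.

Lemma sy_piP x y : sy_rel x y -> sy_pi x = sy_pi y.
Proof. by move=> h; apply/eqmodP/asboolP. Qed.

Lemma sy_piK x : sy_rel (repr (sy_pi x)) x.
Proof.
have /eqmodP /asboolP // : repr (sy_pi x) = x %[mod Sym].
by rewrite reprK.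
Qed.

Lemma sy_ind (P : Sym -> Prop) : (forall x, P (sy_pi x)) -> forall q, P q.
Proof. by move=> h q; rewrite -(reprK q); apply: h. Qed.

Definition sy0 : Sym := sy_pi (SyCst 0).
Definition sy1 : Sym := sy_pi (SyCst 1).
Definition sy_add_q (p q : Sym) : Sym := sy_pi (SyAdd (repr p) (repr q)).
Definition sy_opp_q (p : Sym) : Sym := sy_pi (SyOpp (repr p)).
Definition sy_mul_q (p q : Sym) : Sym := sy_pi (SyMul (repr p) (repr q)).

Lemma sy_addE x y : sy_add_q (sy_pi x) (sy_pi y) = sy_pi (SyAdd x y).
Proof.
apply: sy_piP; apply: (sy_trans (sy_addl _ (sy_piK x))).
apply: (sy_trans (sy_addC _ _)); apply: (sy_trans (sy_addl _ (sy_piK y))).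
exact: sy_addC.
Qed.
Lemma sy_oppE x : sy_opp_q (sy_pi x) = sy_pi (SyOpp x).
Proof. by apply: sy_piP; apply: sy_opp; exact: sy_piK. Qed.
Lemma sy_mulE x y : sy_mul_q (sy_pi x) (sy_pi y) = sy_pi (SyMul x y).
Proof.
apply: sy_piP; apply: (sy_trans (sy_mull _ (sy_piK x))).
apply: (sy_trans (sy_mulC _ _)); apply: (sy_trans (sy_mull _ (sy_piK y))).
exact: sy_mulC.
Qed.

Let syE := (sy_addE, sy_oppE, sy_mulE).

Lemma sy_q_addA : associative sy_add_q.
Proof. by elim/sy_ind=> x; elim/sy_ind=> y; elim/sy_ind=> z; rewrite !syE; apply: sy_piP; exact: sy_addA. Qed.
Lemma sy_q_addC : commutative sy_add_q.
Proof. by elim/sy_ind=> x; elim/sy_ind=> y; rewrite !syE; apply: sy_piP; exact: sy_addC. Qed.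
Lemma sy_q_add0 : left_id sy0 sy_add_q.
Proof. by elim/sy_ind=> x; rewrite !syE; apply: sy_piP; exact: sy_add0. Qed.
Lemma sy_q_addN : left_inverse sy0 sy_opp_q sy_add_q.
Proof. by elim/sy_ind=> x; rewrite !syE; apply: sy_piP; exact: sy_addN. Qed.

HB.instance Definition _ :=
  GRing.isZmodule.Build Sym sy_q_addA sy_q_addC sy_q_add0 sy_q_addN.

Lemma sy_q_mulA : associative sy_mul_q.
Proof. by elim/sy_ind=> x; elim/sy_ind=> y; elim/sy_ind=> z; rewrite !syE; apply: sy_piP; exact: sy_mulA. Qed.
Lemma sy_q_mulC : commutative sy_mul_q.
Proof. by elim/sy_ind=> x; elim/sy_ind=> y; rewrite !syE; apply: sy_piP; exact: sy_mulC. Qed.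
Lemma sy_q_mul1 : left_id sy1 sy_mul_q.
Proof. by elim/sy_ind=> x; rewrite !syE; apply: sy_piP; exact: sy_mul1. Qed.
Lemma sy_q_mulDl : left_distributive sy_mul_q +%R.
Proof.
elim/sy_ind=> x; elim/sy_ind=> y; elim/sy_ind=> z; rewrite /GRing.add /= !syE.
by apply: sy_piP; exact: sy_mulDl.
Qed.

HB.instance Definition _ := GRing.Zmodule_isComPzRing.Build Sym
  sy_q_mulA sy_q_mulC sy_q_mul1 sy_q_mulDl.

Definition sy_cst_fun (b : B) : Sym := sy_pi (SyCst b).

Lemma sy_cst_is_zmod : zmod_morphism sy_cst_fun.
Proof.
suff hD a b : sy_cst_fun (a + b) = sy_cst_fun a + sy_cst_fun b.
  by move=> a b; apply: (addIr (sy_cst_fun b)); rewrite -hD !subrK.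
by rewrite /GRing.add /= !syE; apply: sy_piP; exact: sy_cstD.
Qed.
Lemma sy_cst_is_monoid : monoid_morphism sy_cst_fun.
Proof.
by split=> // a b; rewrite {2}/GRing.mul /= !syE; apply: sy_piP; exact: sy_cstM.
Qed.

HB.instance Definition _ :=
  GRing.isZmodMorphism.Build B Sym sy_cst_fun sy_cst_is_zmod.
HB.instance Definition _ :=
  GRing.isMonoidMorphism.Build B Sym sy_cst_fun sy_cst_is_monoid.

Definition sy_cst : {rmorphism B -> Sym} := sy_cst_fun.
Definition sy_gen (m : M) : Sym := sy_pi (SyGen m).

End SymmetricAlgebra.

Definition SymOmega (A B : ring) (phi : {rmorphism A -> B}) : ring :=
  Sym (Omega phi).

(* b and db in Sym_B (Omega_{B/A}) *)
Definition sb (A B : ring) (phi : {rmorphism A -> B}) : {rmorphism B -> SymOmega phi} :=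
  sy_cst (Omega phi).
Definition sd (A B : ring) (phi : {rmorphism A -> B}) (b : B) : SymOmega phi :=
  sy_gen (dOmega phi b).

(* Functors of points: schemes are defined as in Demazure-Gabriel, Groupes
   algebriques, I.1, as Zariski sheaves on commutative rings with an affine
   open cover. *)

Record zfunctor := ZFunctor {
  zpt :> ring -> Type;
  zmap : forall R R' : ring, {rmorphism R -> R'} -> zpt R -> zpt R';
  zmap1 : forall R x, zmap (rid R) x = x;
  zmapM : forall (R R' R'' : ring) (g : {rmorphism R' -> R''}) (f : {rmorphism R -> R'}) x,
    zmap (rcomp g f) x = zmap g (zmap f x) }.

Arguments zmap z {R R'} f x.

Record mor (X Y : zfunctor) := Mor {
  mapp :> forall R : ring, X R -> Y R;
  mnat : forall (R R' : ring) (f : {rmorphism R -> R'}) x,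
    mapp (zmap X f x) = zmap Y f (mapp x) }.

Arguments mapp {X Y} m R x.

Lemma mor_ext (X Y : zfunctor) (f g : mor X Y) :
  (forall R (x : X R), f R x = g R x) -> f = g.
Proof.
case: f g => [f hf] [g hg] /= e.
have {}e : f = g by apply: functional_extensionality_dep => R; apply/funext/e.
by move: hf hg; rewrite e => hf hg; rewrite (Prop_irrelevance hf hg).
Qed.

Definition mid (X : zfunctor) : mor X X :=
  @Mor X X (fun R x => x) (fun R R' f x => erefl).

Definition mcomp (X Y Z : zfunctor) (g : mor Y Z) (f : mor X Y) : mor X Z.
Proof.
by exists (fun R x => g R (f R x)) => R R' h x; rewrite !mnat.
Defined.

Definition Spec (A : ring) : zfunctor.
Proof.
exists (fun R : ring => {rmorphism A -> R})
       (fun (R R' : ring) (h : {rmorphism R -> R'}) x => rcomp h x).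
- by move=> R x; apply: rmorph_ext.
- by move=> R R' R'' g f x; apply: rmorph_ext.
Defined.

Definition Spec_map (A B : ring) (phi : {rmorphism A -> B}) : mor (Spec B) (Spec A).
Proof.
by exists (fun R (x : Spec B R) => rcomp x phi : Spec A R) => R R' h x; apply: rmorph_ext.
Defined.

(* the morphism Spec A -> X attached to an A-valued point of X *)
Definition point_mor (X : zfunctor) (A : ring) (x : X A) : mor (Spec A) X.
Proof.
by exists (fun R (h : Spec A R) => zmap X h x) => R R' f h; rewrite -zmapM.
Defined.

Definition affine_line : zfunctor.
Proof.
by exists (fun R : ring => R : Type)
          (fun (R R' : ring) (h : {rmorphism R -> R'}) (x : R) => h x).
Defined.

Section FibreProducts.

Lemma sig_eq (T : Type) (P : T -> Prop) (x y : {t : T | P t}) :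
  sval x = sval y -> x = y.
Proof.
by case: x y => [x hx] [y hy] /= e; case: y / e hy => hy; rewrite (Prop_irrelevance hx hy).
Qed.

Definition subfunctor (X : zfunctor) (U : forall R : ring, X R -> Prop)
  (US : forall (R R' : ring) (f : {rmorphism R -> R'}) x, U R x -> U R' (zmap X f x)) :
  zfunctor.
Proof.
exists (fun R => {x : X R | U R x})
       (fun (R R' : ring) f x => exist _ (zmap X f (sval x)) (US _ _ f _ (svalP x))).
- by move=> R x; apply: sig_eq; rewrite /= zmap1.
- by move=> *; apply: sig_eq; rewrite /= zmapM.
Defined.

Definition zprod (X Y : zfunctor) : zfunctor.
Proof.
exists (fun R => X R * Y R)%type
       (fun (R R' : ring) f x => (zmap X f x.1, zmap Y f x.2)).
- by move=> R [x y] /=; rewrite !zmap1.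
- by move=> R R' R'' g f [x y] /=; rewrite !zmapM.
Defined.

Definition zpair (X Y Z : zfunctor) (f : mor Z X) (g : mor Z Y) : mor Z (zprod X Y).
Proof. by exists (fun R z => (f R z, g R z)) => R R' h z /=; rewrite !mnat. Defined.

Variables (X Y Z : zfunctor) (f : mor X Z) (g : mor Y Z).

Definition fprod : zfunctor.
Proof.
apply: (@subfunctor (zprod X Y) (fun R xy => f R xy.1 = g R xy.2)).
by move=> R R' h [x y] /= e; rewrite !mnat e.
Defined.

Definition fpair R (x : X R) (y : Y R) (e : f R x = g R y) : fprod R := exist _ (x, y) e.

Definition fst_mor : mor fprod X.
Proof. by exists (fun R (z : fprod R) => (sval z).1). Defined.

Definition snd_mor : mor fprod Y.
Proof. by exists (fun R (z : fprod R) => (sval z).2). Defined.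

End FibreProducts.

Arguments fpair {X Y Z f g R} x y e.
Arguments fst_mor {X Y Z} f g.
Arguments snd_mor {X Y Z} f g.

Definition generates1 (R : ring) (P : R -> Prop) : Prop :=
  exists s : seq (R * R),
    (forall c, c \in s -> P c.2) /\ \sum_(c <- s) c.1 * c.2 = 1.

Definition image_of (R R' : ring) (f : {rmorphism R -> R'}) (P : R -> Prop) : R' -> Prop :=
  fun r' => exists2 r, P r & r' = f r.

(* U is open if, for x in X(R), the condition "f(x) in U(R')" on f : R -> R' is
   the complement of V(P) in Spec R, for some P contained in R. *)
Definition is_open (X : zfunctor) (U : forall R : ring, X R -> Prop) : Prop :=
  forall (R : ring) (x : X R), exists P : R -> Prop,
    forall (R' : ring) (f : {rmorphism R -> R'}),
      U R' (zmap X f x) <-> generates1 (image_of f P).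

Definition monic (X Y : zfunctor) (f : mor X Y) : Prop :=
  forall R (x y : X R), f R x = f R y -> x = y.

Definition open_immersion (X Y : zfunctor) (f : mor X Y) : Prop :=
  monic f /\ is_open (fun R y => exists x, f R x = y).

(* closed immersion into an open subfunctor U *)
Definition immersion (X Y : zfunctor) (f : mor X Y) : Prop :=
  monic f /\ exists U : forall R : ring, Y R -> Prop,
    [/\ is_open U, forall R (x : X R), U R (f R x)
      & forall R (y : Y R), U R y -> exists P : R -> Prop,
          forall (R' : ring) (h : {rmorphism R -> R'}),
            (exists x, f R' x = zmap Y h y) <-> (forall r, P r -> h r = 0)].

(* R' = R[1/f] *)
Definition is_localization (R R' : ring) (l : {rmorphism R -> R'}) (f : R) : Prop :=
  [/\ exists y, l f * y = 1,
      forall r', exists r n, l r = r' * l f ^+ n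
    & forall r, l r = 0 -> exists n, f ^+ n * r = 0].

Definition zariski_sheaf (X : zfunctor) : Prop :=
  forall (R : ring) n (f : 'I_n -> R), generates1 (fun r => exists i, r = f i) ->
  forall (L : 'I_n -> ring) (l : forall i, {rmorphism R -> L i})
    (LL : 'I_n -> 'I_n -> ring) (ll : forall i j, {rmorphism R -> LL i j})
    (a : forall i j, {rmorphism L i -> LL i j})
    (b : forall i j, {rmorphism L j -> LL i j}),
    (forall i, is_localization (l i) (f i)) ->
    (forall i j, is_localization (ll i j) (f i * f j)) ->
    (forall i j, rcomp (a i j) (l i) = ll i j) ->
    (forall i j, rcomp (b i j) (l j) = ll i j) ->
  forall x : forall i, X (L i),
    (forall i j, zmap X (a i j) (x i) = zmap X (b i j) (x j)) ->
    exists! y : X R, forall i, zmap X (l i) y = x i.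

Definition is_scheme (X : zfunctor) : Prop :=
  zariski_sheaf X /\
  exists (I : Type) (A : I -> ring) (u : forall i, mor (Spec (A i)) X),
    (forall i, open_immersion (u i)) /\
    forall (k : fieldType) (x : X k), exists i y, u i k y = x.

Record scheme := Scheme { szf :> zfunctor; schemeP : is_scheme szf }.

Definition sch : category.
Proof.
exists scheme (fun X Y => mor X Y) (fun X => mid X) (fun X Y Z g f => mcomp g f);
  by move=> *; apply: mor_ext.
Defined.

(* Affine charts of f : X -> Y: an affine open Spec B of X lying over an affine
   open Spec A of Y. *)
Record chart (X Y : zfunctor) (f : mor X Y) := Chart {
  cA : ring;
  cB : ring;
  cphi : {rmorphism cA -> cB};
  ci : mor (Spec cB) X;
  cj : mor (Spec cA) Y;
  ci_open : open_immersion ci;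
  cj_open : open_immersion cj;
  cE : mcomp f ci = mcomp cj (Spec_map cphi) }.

Inductive pterm (A : ring) (n : nat) : Type :=
  | PVar of 'I_n
  | PCst of A
  | PAdd of pterm A n & pterm A n
  | PMul of pterm A n & pterm A n.

Fixpoint peval (A R : ring) n (psi : {rmorphism A -> R}) (x : 'I_n -> R)
    (t : pterm A n) : R :=
  match t with
  | PVar i => x i
  | PCst a => psi a
  | PAdd t1 t2 => peval psi x t1 + peval psi x t2
  | PMul t1 t2 => peval psi x t1 * peval psi x t2
  end.

Definition finite_type (A B : ring) (phi : {rmorphism A -> B}) : Prop :=
  exists n (g : 'I_n -> B), forall b, exists t : pterm A n, peval phi g t = b.

(* B = A[x_1, ..., x_n] / (e_1, ..., e_m), by its universal property *)
Definition finite_presentation (A B : ring) (phi : {rmorphism A -> B}) : Prop :=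
  exists n m (e : 'I_m -> pterm A n) (g : 'I_n -> B),
    (forall j, peval phi g (e j) = 0) /\
    forall (R : ring) (psi : {rmorphism A -> R}) (x : 'I_n -> R),
      (forall j, peval psi x (e j) = 0) ->
      exists! chi : {rmorphism B -> R},
        rcomp chi phi = psi /\ forall i, chi (g i) = x i.

Definition locally_fin_pres (X Y : zfunctor) (f : mor X Y) : Prop :=
  forall (k : fieldType) (x : X k), exists c : chart f,
    (exists y, ci c k y = x) /\ finite_presentation (cphi c).

Definition square_zero (R R0 : ring) (rho : {rmorphism R -> R0}) : Prop :=
  (forall r0, exists r, rho r = r0) /\
  forall x y, rho x = 0 -> rho y = 0 -> x * y = 0.

(* EGA IV 17.1.1, on square-zero extensions *)
Definition formally_smooth (X Y : zfunctor) (f : mor X Y) : Prop :=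
  forall (R R0 : ring) (rho : {rmorphism R -> R0}), square_zero rho ->
  forall (x0 : X R0) (y : Y R), f R0 x0 = zmap Y rho y ->
  exists x : X R, zmap X rho x = x0 /\ f R x = y.

Definition formally_etale (X Y : zfunctor) (f : mor X Y) : Prop :=
  forall (R R0 : ring) (rho : {rmorphism R -> R0}), square_zero rho ->
  forall (x0 : X R0) (y : Y R), f R0 x0 = zmap Y rho y ->
  exists! x : X R, zmap X rho x = x0 /\ f R x = y.

Definition smooth (X Y : zfunctor) (f : mor X Y) : Prop :=
  formally_smooth f /\ locally_fin_pres f.

Definition etale (X Y : zfunctor) (f : mor X Y) : Prop :=
  formally_etale f /\ locally_fin_pres f.

Definition surjective_mor (X Y : zfunctor) (f : mor X Y) : Prop :=
  forall (k : fieldType) (y : Y k), exists (k' : fieldType)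
    (e : {rmorphism k -> k'}) (x : X k'), f k' x = zmap Y e y.

Definition prime_ideal (B : ring) (p : B -> Prop) : Prop :=
  [/\ p 0, forall x y, p x -> p y -> p (x + y), forall a x, p x -> p (a * x),
      ~ p 1 & forall x y, p (x * y) -> p x \/ p y].

(* p 0 < p 1 < ... < p n *)
Definition prime_chain (B : ring) n (p : nat -> B -> Prop) : Prop :=
  (forall i, (i <= n)%N -> prime_ideal (p i)) /\
  (forall i, (i < n)%N -> (forall x, p i x -> p i.+1 x) /\
                          (exists x, p i.+1 x /\ ~ p i x)).

Definition minimal_prime (B : ring) (p : B -> Prop) : Prop :=
  prime_ideal p /\
  forall q, prime_ideal q -> (forall x, q x -> p x) -> forall x, p x -> q x.

Definition has_dim (X : zfunctor) (d : nat) : Prop :=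
  let chain n := exists (B : ring) (i : mor (Spec B) X) p,
    open_immersion i /\ @prime_chain B n p in
  chain d /\ ~ chain d.+1.

(* Every irreducible component of every affine open has Krull dimension d;
   for schemes locally of finite type over a field this is equivalent to all
   irreducible components having dimension d. *)
Definition pure_dim (X : zfunctor) (d : nat) : Prop :=
  forall (B : ring) (i : mor (Spec B) X), open_immersion i ->
  forall q, minimal_prime q ->
  let chain n := exists p, @prime_chain B n p /\ forall x, p 0 x <-> q x in
  chain d /\ ~ chain d.+1.

Definition nonempty (X : zfunctor) : Prop :=
  exists (k : fieldType) (x : X k), True.

(* all nonempty fibres have the same dimension *)
Definition const_fibre_dim (X Y : zfunctor) (f : mor X Y) : Prop :=
  exists d, forall (k : fieldType) (y : Y k),
    nonempty (fprod f (point_mor y)) -> has_dim (fprod f (point_mor y)) d.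

Definition affine_space (n : nat) : zfunctor.
Proof.
by exists (fun R : ring => 'I_n -> R)
          (fun (R R' : ring) (f : {rmorphism R -> R'}) v i => f (v i)).
Defined.

Definition unimodular n (R : ring) (v : affine_space n R) : Prop :=
  generates1 (fun r => exists i, r = v i).

Lemma unimodular_map n (R R' : ring) (f : {rmorphism R -> R'}) (v : affine_space n R) :
  unimodular v -> unimodular (zmap (affine_space n) f v).
Proof.
move=> [s [hs s1]]; exists [seq (f c.1, f c.2) | c <- s]; split.
  by move=> _ /mapP[c /hs [i ->] ->]; exists i.
rewrite big_map /= -(rmorph1 f) -s1 rmorph_sum.
by apply: eq_bigr => c _; rewrite rmorphM.
Qed.

(* A^{n+1} minus the origin *)
Definition punctured (n : nat) : zfunctor := subfunctor (@unimodular_map n.+1).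

(* P = P^n: the quotient of punctured affine space by the scalars, for the
   Zariski topology. *)
Definition is_proj_space n (P : zfunctor) (pi : mor (punctured n) P) : Prop :=
  [/\ zariski_sheaf P,
      forall R (v w : punctured n R), pi R v = pi R w <->
        exists c : R, (exists c', c * c' = 1) /\ forall i, sval w i = c * sval v i
    & forall R (t : P R), exists m (f : 'I_m -> R),
        generates1 (fun r => exists i, r = f i) /\
        forall i, exists (L : ring) (l : {rmorphism R -> L}) (v : punctured n L),
          is_localization l (f i) /\ pi L v = zmap P l t].

(* an immersion of X into P^n_K over K *)
Definition quasi_projective (K : fieldType) (X : zfunctor) (s : mor X (Spec K)) : Prop :=
  exists n P (pi : mor (punctured n) P) (e : mor X P),
    is_proj_space pi /\ immersion (zpair e s).

(* No irreducibility or reducedness is imposed. *)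
Record variety (K : fieldType) := Variety {
  vsch :> scheme;
  vstr : mor vsch (Spec K);
  vqp : quasi_projective vstr }.

Arguments vstr {K} v.

Record algGroup (K : fieldType) := AlgGroup {
  galg : ring;
  gphi : {rmorphism K -> galg};
  gfin : finite_type gphi;
  gzf :> zfunctor := Spec galg;
  gstr : mor gzf (Spec K) := Spec_map gphi;
  gmul : mor (fprod gstr gstr) gzf;
  gone : mor (Spec K) gzf;
  ginv : mor gzf gzf;
  gmul_str : forall R (xy : fprod gstr gstr R), gstr R (gmul R xy) = gstr R (sval xy).1;
  gone_str : forall R (s : Spec K R), gstr R (gone R s) = s;
  ginv_str : forall R (x : gzf R), gstr R (ginv R x) = gstr R x;
  gmulA : forall R (x y z : gzf R) (exy : gstr R x = gstr R y) (eyz : gstr R y = gstr R z)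
    (e1 : gstr R x = gstr R (gmul R (fpair y z eyz)))
    (e2 : gstr R (gmul R (fpair x y exy)) = gstr R z),
    gmul R (fpair x (gmul R (fpair y z eyz)) e1) =
    gmul R (fpair (gmul R (fpair x y exy)) z e2);
  gmul1 : forall R (x : gzf R) (e : gstr R (gone R (gstr R x)) = gstr R x),
    gmul R (fpair (gone R (gstr R x)) x e) = x;
  gmulV : forall R (x : gzf R) (e : gstr R (ginv R x) = gstr R x),
    gmul R (fpair (ginv R x) x e) = gone R (gstr R x) }.

Arguments gstr {K} a.
Arguments gmul {K} a.
Arguments gone {K} a.

Section Actions.
Variables (K : fieldType) (G : algGroup K).

Definition is_action (X : zfunctor) (s : mor X (Spec K))
    (act : mor (fprod (gstr G) s) X) : Prop :=
  [/\ forall R gx, s R (act R gx) = s R (sval gx).2,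
      forall R (x : X R) (e : gstr G R (gone G R (s R x)) = s R x),
        act R (fpair (gone G R (s R x)) x e) = x
    & forall R (g h : G R) (x : X R) (egh : gstr G R g = gstr G R h)
        (ehx : gstr G R h = s R x)
        (e1 : gstr G R g = s R (act R (fpair h x ehx)))
        (e2 : gstr G R (gmul G R (fpair g h egh)) = s R x),
        act R (fpair g (act R (fpair h x ehx)) e1) =
        act R (fpair (gmul G R (fpair g h egh)) x e2)].

Record gvariety := GVariety {
  gvar :> variety K;
  gact : mor (fprod (gstr G) (vstr gvar)) gvar;
  gactP : is_action gact }.

Definition equivariant (X Y : zfunctor) (s : mor X (Spec K)) (t : mor Y (Spec K))
    (ax : mor (fprod (gstr G) s) X) (ay : mor (fprod (gstr G) t) Y) (f : mor X Y) : Prop :=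
  (forall R x, t R (f R x) = s R x) /\
  forall R (g : G R) (x : X R) (e : gstr G R g = s R x) (e' : gstr G R g = t R (f R x)),
    f R (ax R (fpair g x e)) = ay R (fpair g (f R x) e').

(* points of the topological space |X|, up to field extension *)
Definition point_set (X : zfunctor) (W : forall k : fieldType, X k -> Prop) : Prop :=
  forall (k k' : fieldType) (e : {rmorphism k -> k'}) (x : X k),
    W k x <-> W k' (zmap X e x).

Definition open_point_set (X : zfunctor) (W : forall k : fieldType, X k -> Prop) : Prop :=
  exists2 U : (forall R : ring, X R -> Prop), is_open U &
    forall (k : fieldType) (x : X k), W k x <-> U k x.

(* a regular function on the part of X lying in U *)
Record fun_on (X : zfunctor) (U : forall R : ring, X R -> Prop) := FunOn {
  fon :> forall (R : ring) (x : X R), U R x -> R;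
  fon_nat : forall (R R' : ring) (h : {rmorphism R -> R'}) (x : X R) u u',
    @fon R' (zmap X h x) u' = h (@fon R x u) }.

(* Mumford, GIT, Definition 0.6 *)
Definition geometric_quotient (X : zfunctor) (s : mor X (Spec K))
    (act : mor (fprod (gstr G) s) X) (Q : zfunctor) (t : mor Q (Spec K))
    (q : mor X Q) : Prop :=
  (forall R x, t R (q R x) = s R x) /\
  [/\ forall R gx, q R (act R gx) = q R (sval gx).2,
      surjective_mor q /\
      (forall (k : fieldType) (x y : X k), q k x = q k y ->
        exists (k' : fieldType) (e : {rmorphism k -> k'}) (g : G k')
          (eg : gstr G k' g = s k' (zmap X e x)),
          act k' (fpair g (zmap X e x) eg) = zmap X e y),
      forall W, @point_set Q W ->
        @open_point_set X (fun k x => W k (q k x)) -> open_point_set W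
    & forall U : (forall R : ring, Q R -> Prop), is_open U ->
      forall h : @fun_on X (fun R x => U R (q R x)),
        (forall R gx u u', h R (act R gx) u = h R (sval gx).2 u') ->
        exists! h' : fun_on U, forall R x u, h R x u = h' R (q R x) u].

(* X -> Q becomes the trivial G-bundle G x V -> V over an etale cover V -> Q. *)
Definition etale_locally_trivial (X : zfunctor) (s : mor X (Spec K))
    (act : mor (fprod (gstr G) s) X) (Q : zfunctor) (t : mor Q (Spec K))
    (q : mor X Q) : Prop :=
  exists (V : scheme) (v : mor V Q) (theta : mor (fprod (gstr G) (mcomp t v)) (fprod q v)),
    [/\ etale v /\ surjective_mor v,
        forall R, bijective (theta R),
        forall R gx, (sval (theta R gx)).2 = (sval gx).2
      & forall R (g h : G R) (x : V R) (egh : gstr G R g = gstr G R h)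
          (ehx : gstr G R h = mcomp t v R x)
          (e1 : gstr G R (gmul G R (fpair g h egh)) = mcomp t v R x)
          (e2 : gstr G R g = s R (sval (theta R (fpair h x ehx))).1),
          (sval (theta R (fpair (gmul G R (fpair g h egh)) x e1))).1 =
          act R (fpair g (sval (theta R (fpair h x ehx))).1 e2)].

Definition free_gvariety (Gam : gvariety) : Prop :=
  exists (Q : variety K) (q : mor Gam Q),
    [/\ geometric_quotient (gact Gam) (vstr Q) q, smooth q
      & etale_locally_trivial (gact Gam) (vstr Q) q].

Record sf_ob := SfOb {
  sf_var :> gvariety;
  sf_smooth : smooth (vstr sf_var);
  sf_pure : exists d, pure_dim sf_var d;
  sf_free : free_gvariety sf_var }.

Record sf_hom (Gam Gam' : sf_ob) := SfHom {
  sf_mor :> mor Gam Gam';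
  sf_equiv : equivariant (gact Gam) (gact Gam') sf_mor;
  sf_hom_smooth : smooth sf_mor;
  sf_hom_dim : const_fibre_dim sf_mor }.

Variable X : gvariety.

Definition prod_str (Gam : gvariety) : mor (fprod (vstr Gam) (vstr X)) (Spec K) :=
  mcomp (vstr Gam) (fst_mor (vstr Gam) (vstr X)).

Section Diagonal.
Variables (Gam : gvariety) (R : ring) (z : fprod (gstr G) (prod_str Gam) R).

Lemma diag_proof1 : gstr G R (sval z).1 = vstr Gam R (sval (sval z).2).1.
Proof. exact: svalP z. Qed.

Lemma diag_proof2 : gstr G R (sval z).1 = vstr X R (sval (sval z).2).2.
Proof. by rewrite diag_proof1 (svalP (sval z).2). Qed.

Lemma diag_proof3 :
  vstr Gam R (gact Gam R (fpair _ _ diag_proof1)) =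
  vstr X R (gact X R (fpair _ _ diag_proof2)).
Proof.
case: (gactP Gam) (gactP X) => -> _ _ [-> _ _] /=.
by rewrite -diag_proof1 -diag_proof2.
Qed.

End Diagonal.

Definition diag_act (Gam : gvariety) :
  mor (fprod (gstr G) (prod_str Gam)) (fprod (vstr Gam) (vstr X)).
Proof.
exists (fun R z => fpair _ _ (diag_proof3 z)) => R R' h z; apply: sig_eq => /=.
by congr (_, _); rewrite -mnat; congr (mapp _ _ _); apply: sig_eq.
Defined.

Section ProductMap.
Variables (Gam Gam' : gvariety) (f : mor Gam Gam').
Variable fK : forall R x, vstr Gam' R (f R x) = vstr Gam R x.

Lemma prod_map_proof R (z : fprod (vstr Gam) (vstr X) R) :
  vstr Gam' R (f R (sval z).1) = vstr X R (sval z).2.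
Proof. by rewrite fK (svalP z). Qed.

Definition prod_map : mor (fprod (vstr Gam) (vstr X)) (fprod (vstr Gam') (vstr X)).
Proof.
exists (fun R z => fpair _ _ (prod_map_proof z)) => R R' h z; apply: sig_eq => /=.
by rewrite mnat.
Defined.

End ProductMap.

(* The quotients G\(Gam x X) and the maps induced between them.  A geometric
   quotient is unique up to a unique isomorphism, so that it is harmless to let
   it be any scheme over K here. *)
Record quotient_system := QuotientSystem {
  qs_sch : sf_ob -> scheme;
  qs_str : forall Gam, mor (qs_sch Gam) (Spec K);
  qs_map : forall Gam : sf_ob, mor (fprod (vstr Gam) (vstr X)) (qs_sch Gam);
  qs_geom : forall Gam : sf_ob,
    geometric_quotient (diag_act Gam) (qs_str Gam) (qs_map Gam);
  qs_bar : forall Gam Gam' : sf_ob, sf_hom Gam Gam' -> mor (qs_sch Gam) (qs_sch Gam');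
  qs_bar_smooth : forall Gam Gam' (f : sf_hom Gam Gam'), smooth (qs_bar f);
  qs_barE : forall Gam Gam' (f : sf_hom Gam Gam'),
    mcomp (qs_bar f) (qs_map Gam) =
    mcomp (qs_map Gam') (prod_map (sf_equiv f).1);
  qs_bar_uniq : forall Gam Gam' (f : sf_hom Gam Gam') (h : mor (qs_sch Gam) (qs_sch Gam')),
    mcomp h (qs_map Gam) = mcomp (qs_map Gam') (prod_map (sf_equiv f).1) ->
    h = qs_bar f }.

End Actions.

Section Slices.
Variable C : category.

Record slice_ob (S : C) := SliceOb { sl_ob :> C; sl_map : hom sl_ob S }.

Record slice_hom (S : C) (X Y : slice_ob S) := SliceHom {
  sl_mor :> hom X Y;
  sl_morE : sl_map Y ∘ sl_mor = sl_map X }.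

Lemma slice_hom_ext (S : C) (X Y : slice_ob S) (f g : slice_hom X Y) :
  sl_mor f = sl_mor g -> f = g.
Proof.
case: f g => [f hf] [g hg] /= e; move: hf hg; rewrite e => hf hg.
by rewrite (Prop_irrelevance hf hg).
Qed.

Lemma sl_comp_proof (S : C) (X Y Z : slice_ob S) (g : slice_hom Y Z) (f : slice_hom X Y) :
  sl_map Z ∘ (sl_mor g ∘ sl_mor f) = sl_map X.
Proof. by rewrite compcA !sl_morE. Qed.

Definition slice (S : C) : category.
Proof.
unshelve refine (@Category (slice_ob S) (@slice_hom S)
  (fun X => @SliceHom S X X (idc _) (compc1 _))
  (fun X Y Z g f => SliceHom (sl_comp_proof g f)) _ _ _).
- by move=> *; apply: slice_hom_ext; rewrite /= compcA.
- by move=> *; apply: slice_hom_ext; rewrite /= comp1c.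
- by move=> *; apply: slice_hom_ext; rewrite /= compc1.
Defined.

Variable pb : cleavage C.

(* g^* Z = Z x_W V *)
Definition bch (V W : C) (g : hom V W) (Z : slice W) : slice V :=
  SliceOb (pb2 (pb (sl_map Z) g)).

Definition bch_fst (V W : C) (g : hom V W) (Z : slice W) : hom (sl_ob (bch g Z)) (sl_ob Z) :=
  pb1 (pb (sl_map Z) g).

Lemma bch_hom_proof (V W : C) (g : hom V W) (Z Z' : slice W) (h : hom Z Z') :
  sl_map Z' ∘ (sl_mor h ∘ bch_fst g Z) = g ∘ sl_map (bch g Z).
Proof. by rewrite compcA sl_morE; exact: pbE. Qed.

Definition bch_hom (V W : C) (g : hom V W) (Z Z' : slice W) (h : hom Z Z') :
    hom (bch g Z) (bch g Z') :=
  @SliceHom V (bch g Z) (bch g Z')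
    (pblift (pb (sl_map Z') g) _ _ (bch_hom_proof g h)) (pblift2 _ _).

Lemma bch_comp_proof (U V W : C) (f : hom U V) (g : hom V W) (h : hom U W)
    (e : h = g ∘ f) (Z : slice W) :
  sl_map Z ∘ (bch_fst g Z ∘ bch_fst f (bch g Z)) = h ∘ sl_map (bch f (bch g Z)).
Proof.
rewrite e -[RHS]compcA -[f ∘ _](pbE (pb (sl_map (bch g Z)) f)) !compcA.
by congr (_ ∘ _); exact: pbE.
Qed.

(* the canonical isomorphism f^* g^* Z -> h^* Z, for h = g f *)
Definition bch_comp (U V W : C) (f : hom U V) (g : hom V W) (h : hom U W)
    (e : h = g ∘ f) (Z : slice W) : hom (bch f (bch g Z)) (bch h Z) :=
  @SliceHom U (bch f (bch g Z)) (bch h Z)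
    (pblift (pb (sl_map Z) h) _ _ (bch_comp_proof e Z)) (pblift2 _ _).

(* A functor i |-> S_i from an index category to C.  The index category enters
   through its objects, its morphisms and the relation "h = g f". *)
Record base_system := BaseSystem {
  bI : Type;
  bH : bI -> bI -> Type;
  bcomp : forall i j k, bH i j -> bH j k -> bH i k -> Prop;
  bS : bI -> C;
  bs : forall i j, bH i j -> hom (bS i) (bS j);
  bsM : forall i j k (f : bH i j) (g : bH j k) (h : bH i k),
    bcomp f g h -> bs h = bs g ∘ bs f }.

Variable D : base_system.

Record precone := Precone {
  pca : forall i : bI D, slice (bS i);
  pct : forall (i j : bI D) (f : bH i j), hom (bch (bs f) (pca j)) (pca i) }.

Definition is_pseudocone (A : precone) : Prop :=
  (forall (i j : bI D) (f : bH i j), is_iso (pct A f)) /\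
  (forall (i j k : bI D) (f : bH i j) (g : bH j k) (h : bH i k) (e : bcomp f g h),
     pct A h ∘ bch_comp (bsM e) (pca A k) = pct A f ∘ bch_hom (bs f) (pct A g)).

Record pseudocone := Pseudocone {
  pc_pre :> precone;
  pcP : is_pseudocone pc_pre }.

Definition pc_compat (A B : precone) (h : forall i, hom (pca A i) (pca B i)) : Prop :=
  forall (i j : bI D) (f : bH i j),
    h i ∘ pct A f = pct B f ∘ bch_hom (bs f) (h j).

Record pc_hom (A B : pseudocone) := PcHom {
  pch :> forall i : bI D, hom (pca A i) (pca B i);
  pchP : pc_compat pch }.

Lemma pc_hom_ext (A B : pseudocone) (f g : pc_hom A B) : (forall i, f i = g i) -> f = g.
Proof.
case: f g => [f hf] [g hg] /= e.
have {}e : f = g by exact: functional_extensionality_dep.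
by move: hf hg; rewrite e => hf hg; rewrite (Prop_irrelevance hf hg).
Qed.

Lemma bch_homE (V W : C) (g : hom V W) (Z Z' : slice W) (h : hom Z Z') :
  bch_fst g Z' ∘ sl_mor (bch_hom g h) = sl_mor h ∘ bch_fst g Z.
Proof. exact: pblift1. Qed.

Lemma bch_ext (V W : C) (g : hom V W) (Y : slice V) (Z : slice W) (h k : hom Y (bch g Z)) :
  bch_fst g Z ∘ sl_mor h = bch_fst g Z ∘ sl_mor k -> h = k.
Proof.
move=> e; apply: slice_hom_ext; apply: pb_ext e _.
exact: etrans (sl_morE h) (esym (sl_morE k)).
Qed.

Lemma bch_hom1 (V W : C) (g : hom V W) (Z : slice W) : bch_hom g (idc Z) = idc (bch g Z).
Proof. by apply: bch_ext; rewrite bch_homE /= comp1c compc1. Qed.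

Lemma bch_homM (V W : C) (g : hom V W) (X Y Z : slice W) (k : hom Y Z) (h : hom X Y) :
  bch_hom g (k ∘ h) = bch_hom g k ∘ bch_hom g h.
Proof.
apply: bch_ext; rewrite bch_homE [sl_mor (_ ∘ bch_hom g h)]/=.
by rewrite compcA bch_homE -!compcA bch_homE.
Qed.

(* the category of pseudocones of i |-> C/S_i, f |-> (bs f)^* *)
Definition PC : category.
Proof.
unshelve refine (@Category pseudocone pc_hom
  (fun A => @PcHom A A (fun i => idc _) _)
  (fun A B E g f => @PcHom A E (fun i => g i ∘ f i) _) _ _ _).
- by move=> i j f; rewrite comp1c bch_hom1 compc1.
- by move=> i j h; rewrite -compcA pchP compcA pchP -compcA bch_homM.
- by move=> *; apply: pc_hom_ext => i; exact: compcA.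
- by move=> *; apply: pc_hom_ext => i; exact: comp1c.
- by move=> *; apply: pc_hom_ext => i; exact: compc1.
Defined.

(* The pseudolimit structure of tangent structures on the slices along
   distributive morphisms gT : g^* T -> T g^*. *)
Section Pseudolimit.
Variable T : forall i : bI D, functor (slice (bS i)) (slice (bS i)).
Variable tt : forall i, tangent_on (T i).
Variable gT : forall (i j : bI D) (f : bH i j) (Z : slice (bS j)),
  hom (bch (bs f) (T j Z)) (T i (bch (bs f) Z)).

Definition pl_ob (A : precone) : precone :=
  @Precone (fun i => T i (pca A i))
           (fun i j f => fmap (T i) (pct A f) ∘ gT f (pca A j)).

Definition pl_functor_wd : Prop :=
  (forall A : PC, is_pseudocone (pl_ob (pc_pre A))) /\
  (forall (A B : PC) (h : hom A B),
     @pc_compat (pl_ob (pc_pre A)) (pl_ob (pc_pre B)) (fun i => fmap (T i) (pch h i))).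

Definition pl_functor (wd : pl_functor_wd) : functor PC PC.
Proof.
unshelve refine (@Functor PC PC (fun A => Pseudocone (wd.1 A))
  (fun A B h => @PcHom (Pseudocone (wd.1 A)) (Pseudocone (wd.1 B))
     (fun i => fmap (T i) (pch h i)) (wd.2 A B h)) _ _).
- by move=> A; apply: pc_hom_ext => i; exact: fmap1.
- by move=> A B E g f; apply: pc_hom_ext => i; exact: fmapM.
Defined.

Definition is_pl_structure (wd : pl_functor_wd) (TT : tangent_on (pl_functor wd)) : Prop :=
  forall (A : PC) (i : bI D),
  [/\ pch (tp TT A) i = tp (tt i) (pca (pc_pre A) i),
      pch (tz TT A) i = tz (tt i) (pca (pc_pre A) i),
      (* [h] compares the i-th component of T2 A with T2 of the component *)
      exists h : hom (pca (pc_pre (pbo (t2 TT A))) i) (pbo (t2 (tt i) (pca (pc_pre A) i))),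
        [/\ pb1 (t2 (tt i) (pca (pc_pre A) i)) ∘ h = pch (pb1 (t2 TT A)) i,
            pb2 (t2 (tt i) (pca (pc_pre A) i)) ∘ h = pch (pb2 (t2 TT A)) i
          & pch (tadd TT A) i = tadd (tt i) (pca (pc_pre A) i) ∘ h],
      pch (tl TT A) i = tl (tt i) (pca (pc_pre A) i)
    & pch (tc TT A) i = tc (tt i) (pca (pc_pre A) i)].

End Pseudolimit.
End Slices.

Notation Sch_over S := (@slice sch S).

Definition szfun (S : scheme) (Z : Sch_over S) : zfunctor :=
  (sl_ob Z : scheme).
Definition sstr (S : scheme) (Z : Sch_over S) : mor (szfun Z) S := sl_map Z.
Definition smor (S : scheme) (Z Z' : Sch_over S) (h : hom Z Z') :
  mor (szfun Z) (szfun Z') := sl_mor h.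

Section Zariski.
Variable S : scheme.
Variable T : functor (Sch_over S) (Sch_over S).
Variable t : tangent_on T.

(* T Z = Spec_Z (Sym Omega_{Z/S}): over an affine chart Spec B of Z above
   Spec A in S, T Z restricts to Spec (Sym_B Omega_{B/A}). *)
Record tangent_charts := TangentCharts {
  tk : forall (Z : Sch_over S) (c : chart (sstr Z)),
    mor (Spec (SymOmega (cphi c))) (szfun (T Z));
  tk_p : forall Z (c : chart (sstr Z)),
    mcomp (smor (tp t Z)) (tk c) = mcomp (ci c) (Spec_map (sb (cphi c)));
  tk_cart : forall Z (c : chart (sstr Z)) (R : ring) (x : szfun (T Z) R)
    (y : Spec (cB c) R), smor (tp t Z) R x = ci c R y ->
    exists! u : Spec (SymOmega (cphi c)) R,
      tk c R u = x /\ Spec_map (sb (cphi c)) R u = y }.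

Variable k : tangent_charts.

Lemma tk_open Z (c : chart (sstr Z)) : open_immersion (tk k c).
Proof.
have e R u : smor (tp t Z) R (tk k c R u) = ci c R (Spec_map (sb (cphi c)) R u).
  by have := congr1 (fun m => mapp m R u) (tk_p k c).
split=> [R u v euv|R x].
  have [ci_inj _] := ci_open c.
  have euv' : Spec_map (sb (cphi c)) R u = Spec_map (sb (cphi c)) R v.
    by apply: ci_inj; rewrite -!e euv.
  have [w [_ wU]] := tk_cart k (e R v).
  by rewrite -(wU u) // -(wU v).
have [_ /(_ R (smor (tp t Z) R x))[P hP]] := ci_open c.
exists P => R' f; rewrite -hP; split=> [[u hu]|[y hy]].
  by exists (Spec_map (sb (cphi c)) R' u); rewrite -e hu mnat.
have [|u [[hu _] _]] := @tk_cart k Z c R' (zmap (szfun (T Z)) f x) y.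
  by rewrite mnat hy.
by exists u.
Qed.

Lemma tchart_proof Z (c : chart (sstr Z)) :
  mcomp (sstr (T Z)) (tk k c) =
  mcomp (cj c) (Spec_map (rcomp (sb (cphi c)) (cphi c))).
Proof.
have h : mcomp (sstr Z) (smor (tp t Z)) = sstr (T Z) := sl_morE (tp t Z).
have a1 (W X Y V : zfunctor) (f : mor X Y) (g : mor Y V) (l : mor W X) :
    mcomp (mcomp g f) l = mcomp g (mcomp f l) by apply: mor_ext.
rewrite -h a1 tk_p -a1 cE a1; congr mcomp.
by apply: mor_ext => R x; apply: rmorph_ext.
Qed.

Definition tchart Z (c : chart (sstr Z)) : chart (sstr (T Z)) :=
  Chart (tk_open c) (cj_open c) (tchart_proof c).

(* The structure maps on charts.  With vb = sb (cphi c), vd = sd (cphi c) the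
   generators of the ring of T are b = vb b, db = vd b; those of the ring of
   T^2 are b = wb (vb b), db = wb (vd b), (delta b) = wd (vb b) and
   (delta db) = wd (vd b).  The addition is described on R-valued points (u, v)
   of Spec (Sym_B Omega) x_{Spec B} Spec (Sym_B Omega), that is on pairs of
   morphisms into R. *)
Definition zariski_axioms : Prop :=
  [/\ forall (Z Z' : Sch_over S) (h : hom Z Z') (c : chart (sstr Z)) (c' : chart (sstr Z'))
        (alpha : {rmorphism cA c' -> cA c}) (beta : {rmorphism cB c' -> cB c}),
        rcomp beta (cphi c') = rcomp (cphi c) alpha ->
        mcomp (smor h) (ci c) = mcomp (ci c') (Spec_map beta) ->
        cj c = mcomp (cj c') (Spec_map alpha) ->
        exists lam : {rmorphism SymOmega (cphi c') -> SymOmega (cphi c)},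
          [/\ forall b, lam (sb (cphi c') b) = sb (cphi c) (beta b),
              forall b, lam (sd (cphi c') b) = sd (cphi c) (beta b)
            & mcomp (smor (fmap T h)) (tk k c) = mcomp (tk k c') (Spec_map lam)],
      forall (Z : Sch_over S) (c : chart (sstr Z)),
        let vb := sb (cphi c) in let vd := sd (cphi c) in
        exists lam : {rmorphism SymOmega (cphi c) -> cB c},
          [/\ forall b, lam (vb b) = b, forall b, lam (vd b) = 0
            & mcomp (smor (tz t Z)) (ci c) = mcomp (tk k c) (Spec_map lam)],
      forall (Z : Sch_over S) (c : chart (sstr Z)) (R : ring) (x : szfun (pbo (t2 t Z)) R)
        (u v : Spec (SymOmega (cphi c)) R),
        let vb := sb (cphi c) in let vd := sd (cphi c) in
        smor (pb1 (t2 t Z)) R x = tk k c R u ->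
        smor (pb2 (t2 t Z)) R x = tk k c R v ->
        exists w : Spec (SymOmega (cphi c)) R,
          [/\ forall b, w (vb b) = u (vb b) /\ w (vb b) = v (vb b),
              forall b, w (vd b) = u (vd b) + v (vd b)
            & smor (tadd t Z) R x = tk k c R w],
      forall (Z : Sch_over S) (c : chart (sstr Z)),
        let vb := sb (cphi c) in let vd := sd (cphi c) in
        let wb := sb (cphi (tchart c)) in let wd := sd (cphi (tchart c)) in
        exists lam : {rmorphism SymOmega (cphi (tchart c)) -> SymOmega (cphi c)},
          [/\ (forall b, lam (wb (vb b)) = vb b) /\ (forall b, lam (wb (vd b)) = 0),
              forall b, lam (wd (vb b)) = 0, forall b, lam (wd (vd b)) = vd b
            & mcomp (smor (tl t Z)) (tk k c) = mcomp (tk k (tchart c)) (Spec_map lam)]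
    & forall (Z : Sch_over S) (c : chart (sstr Z)),
        let vb := sb (cphi c) in let vd := sd (cphi c) in
        let wb := sb (cphi (tchart c)) in let wd := sd (cphi (tchart c)) in
        exists lam : {rmorphism SymOmega (cphi (tchart c)) -> SymOmega (cphi (tchart c))},
          [/\ (forall b, lam (wb (vb b)) = wb (vb b)) /\
              (forall b, lam (wb (vd b)) = wd (vb b)),
              forall b, lam (wd (vb b)) = wb (vd b),
              forall b, lam (wd (vd b)) = wd (vd b)
            & mcomp (smor (tc t Z)) (tk k (tchart c)) =
              mcomp (tk k (tchart c)) (Spec_map lam)]].

End Zariski.

Record zariski_tangent (S : scheme) := ZariskiTangent {
  zT : functor (Sch_over S) (Sch_over S);
  zt : tangent_on zT;
  zk : tangent_charts zt;
  zP : zariski_axioms zk }.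

(* The canonical isomorphism g^* T_{Z/W} -> T_{g^*Z/V}.  Let Spec B' be a chart
   of g^*Z over Spec A' in V, lying over a chart Spec B of Z over Spec A in W.
   An R-valued point of g^* T_{Z/W} over Spec B' is a pair (u, w0) of morphisms
   Sym_B Omega_{B/A} -> R and B' -> R that agree on B; its image is the
   w : Sym_{B'} Omega_{B'/A'} -> R below.  For B' = B (x)_A A' this is the map
   dual to b (x) a |-> b (x) a, d (b (x) a) |-> db (x) a. *)
Record base_change_iso (pb : cleavage sch) (V W : scheme) (g : mor V W)
    (zV : zariski_tangent V) (zW : zariski_tangent W) (Z : Sch_over W) :=
  BaseChangeIso {
  gT :> hom (@bch sch pb V W g (zT zW Z))
            (zT zV (@bch sch pb V W g Z));
  gT_iso : is_iso gT;
  gT_chart : forall (c : chart (sstr Z))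
    (c' : chart (sstr (@bch sch pb V W g Z)))
    (alpha : {rmorphism cA c -> cA c'}) (beta : {rmorphism cB c -> cB c'}),
    rcomp beta (cphi c) = rcomp (cphi c') alpha ->
    mcomp (@bch_fst sch pb V W g Z) (ci c') = mcomp (ci c) (Spec_map beta) ->
    mcomp g (cj c') = mcomp (cj c) (Spec_map alpha) ->
    forall (R : ring)
      (x : szfun (@bch sch pb V W g (zT zW Z)) R)
      (u : Spec (SymOmega (cphi c)) R) (w0 : Spec (cB c') R),
      mapp (@bch_fst sch pb V W g (zT zW Z)) R x = tk (zk zW) c R u ->
      sstr (@bch sch pb V W g (zT zW Z)) R x =
        cj c' R (Spec_map (cphi c') R w0) ->
      (forall b, w0 (beta b) = u (sb (cphi c) b)) ->
      exists w : Spec (SymOmega (cphi c')) R,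
        [/\ forall b', w (sb (cphi c') b') = w0 b',
            forall b a', w (sd (cphi c') (beta b * cphi c' a')) =
                         u (sd (cphi c) b) * w0 (cphi c' a')
          & smor gT R x = tk (zk zV) c' R w] }.

Section Descent.
Variables (K : fieldType) (G : algGroup K) (X : gvariety G) (Q : quotient_system X).

(* [h] is the composite g f in Sf(G); as Sf(G) is closed under composition, [h]
   exists and is unique. *)
Definition sf_comp (Gam1 Gam2 Gam3 : sf_ob G) (f : sf_hom Gam1 Gam2)
    (g : sf_hom Gam2 Gam3) (h : sf_hom Gam1 Gam3) : Prop :=
  (h : mor Gam1 Gam3) = mcomp g f.

Lemma qs_barM (Gam1 Gam2 Gam3 : sf_ob G) (f : sf_hom Gam1 Gam2)
    (g : sf_hom Gam2 Gam3) (h : sf_hom Gam1 Gam3) :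
  sf_comp f g h -> qs_bar Q h = mcomp (qs_bar Q g) (qs_bar Q f).
Proof.
move=> e; apply/esym/qs_bar_uniq; apply: mor_ext => R x /=.
have ef := congr1 (fun m => mapp m R x) (qs_barE Q f); rewrite /= in ef.
rewrite ef.
have eg := congr1 (fun m => mapp m R (prod_map X (sf_equiv f).1 R x)) (qs_barE Q g).
rewrite /= in eg; rewrite eg; congr (mapp _ _ _); apply: sig_eq => /=.
have eh := congr1 (fun m => mapp m R (sval x).1) e.
by rewrite /= in eh; rewrite eh.
Qed.

Definition sf_system : base_system sch :=
  @BaseSystem sch (sf_ob G) (@sf_hom K G) sf_comp (qs_sch Q)
    (fun Gam Gam' f => qs_bar Q f) qs_barM.

End Descent.

(* Main.v *)
From HB Require Import structures.
From mathcomp Require Import all_boot all_order all_algebra.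
From mathcomp Require Import boolp classical_sets.
From mathcomp.algebra_tactics Require Import ring.
Require Import Defs.

(** A tangent structure on pseudocones is computed componentwise, as soon as the
    comparison isomorphisms [g^* T Z -> T g^* Z] are natural, satisfy the cocycle
    condition and commute with [p, 0, +, l, c]: base change preserves the pullback
    powers of [p], so that the componentwise powers carry unique transition
    isomorphisms, and everything else is checked on components.

    The compatibilities of the comparison isomorphisms are checked locally.  A
    morphism to a Zariski sheaf is determined near the field-valued points, and
    near such a point [g^* Z] has a chart [Spec (B (x)_A A')] over charts [A -> B]
    of [Z] and [A'] of [V].  There a point of [T] or [T^2] is a ring morphism out of
    an iterated [Sym Omega], determined by its values on the generators
    [b (x) a], [d (b (x) a)], ..., on which both sides are given explicitly. *)

Set Implicit Arguments.
Unset Strict Implicit.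
Unset Printing Implicit Defensive.
Local Open Scope cat_scope.

(** * Powers and isomorphisms in a category *)

(** Apart from being isomorphisms, the comparison morphisms are known only through [gT_chart]: they
    are given one object [Z] at a time, without naturality or coherence, and on differentials their
    values are prescribed only at products [beta b * cphi c' a']. Hence charts are needed whose ring
    is generated by such products, and tensor products provide them. For T^2 the intermediate object
    g^* T Z needs a chart of its own, since T of the comparison can be evaluated only once the
    comparison is written as a ring morphism between charts. Field-valued points carry the locality
    arguments because [is_scheme] states its covering condition on them, and because, maximal ideals
    being available, a set of ring elements generates the unit ideal as soon as no morphism to a
    field kills it. On the categorical side, the pairings into T (T2 A) exist only componentwise at
    first. Preservation of T2 by T determines them by their projections, and this makes them
    compatible with the transition isomorphisms. *)

Lemma iso_comp (E : category) (X Y Z : E) (g : hom Y Z) (f : hom X Y) :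
  is_iso g -> is_iso f -> is_iso (g ∘ f).
Proof.
move=> [g' [gl gr]] [f' [fl fr]]; exists (f' ∘ g'); split.
  by rewrite -compcA (compcA g') gl comp1c.
by rewrite -compcA (compcA f) fr comp1c.
Qed.

Lemma iso_fmap (E F : category) (T : functor E F) (X Y : E) (f : hom X Y) :
  is_iso f -> is_iso (fmap T f).
Proof. by move=> [g [l r]]; exists (fmap T g); rewrite -!fmapM l r !fmap1. Qed.

(* Convertible to [is_power] for [I := 'I_n]; [bool] serves as index type for [t2]. *)
Definition is_pow (E : category) (I : Type) (B A P : E) (p : hom B A)
    (base : hom P A) (proj : I -> hom P B) : Prop :=
  (forall i, p ∘ proj i = base) /\
  forall (W : E) (x : hom W A) (u : I -> hom W B), (forall i, p ∘ u i = x) ->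
    exists! h : hom W P, base ∘ h = x /\ forall i, proj i ∘ h = u i.

Section Powers.
Variables (E : category) (I : Type).

Lemma pow_ext (B A P : E) (p : hom B A) (base : hom P A) (proj : I -> hom P B) :
  is_pow p base proj -> forall (W : E) (h k : hom W P),
  base ∘ h = base ∘ k -> (forall i, proj i ∘ h = proj i ∘ k) -> h = k.
Proof.
move=> [pE pU] W h k eb ep; have [|x [_ xU]] := pU W (base ∘ k) (fun i => proj i ∘ k).
  by move=> i; rewrite compcA pE.
by rewrite -(xU h) // -(xU k).
Qed.

(** The inverses of [a] and [b] commute with [p'] and [p] as well, so the universal property of [P]
    turns them into a map back. *)
Lemma pow_iso (B A P B' A' P' : E) (p : hom B A) (base : hom P A) (proj : I -> hom P B)
    (p' : hom B' A') (base' : hom P' A') (proj' : I -> hom P' B')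
    (a : hom A A') (b : hom B B') (h : hom P P') :
  is_pow p base proj -> is_pow p' base' proj' -> is_iso a -> is_iso b ->
  p' ∘ b = a ∘ p -> base' ∘ h = a ∘ base -> (forall i, proj' i ∘ h = b ∘ proj i) -> is_iso h.
Proof.
move=> powP powP' [a' [a'l a'r]] [b' [b'l b'r]] ep eb epr.
have ep' : p ∘ b' = a' ∘ p'.
  by rewrite -[p]comp1c -a'l -(compcA a') -ep -!compcA b'r compc1.
have [|k [[kb kp] _]] := powP.2 P' (a' ∘ base') (fun i => b' ∘ proj' i).
  by move=> i; rewrite compcA ep' -compcA powP'.1.
exists k; split.
  apply: (pow_ext powP) => [|i].
    by rewrite compcA kb -compcA eb compcA a'l comp1c compc1.
  by rewrite compcA kp -compcA epr compcA b'l comp1c compc1.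
apply: (pow_ext powP') => [|i].
  by rewrite compcA eb -compcA kb compcA a'r comp1c compc1.
by rewrite compcA epr -compcA kp compcA b'r comp1c compc1.
Qed.

(** The whole diagram is bundled, objects included. For a variable [m], the component at [i] of an
    [m]-fold iterate in pseudocones and the [m]-fold iterate of the component are not convertible,
    so an equation between their morphisms alone would be ill-typed. *)
Record diag := Diag {
  dA : E; dB : E; dP : E;
  dp : hom dB dA; dbase : hom dP dA; dproj : I -> hom dP dB }.

Definition diag_pow (d : diag) : Prop := is_pow (dp d) (dbase d) (dproj d).

Definition diag_map (F : functor E E) (d : diag) : diag :=
  Diag (fmap F (dp d)) (fmap F (dbase d)) (fun i => fmap F (dproj d i)).

Lemma diag_iter (F : functor E E) m (d : diag) : iter m (diag_map F) d =
  Diag (iterhom F m (dp d)) (iterhom F m (dbase d)) (fun i => iterhom F m (dproj d i)).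
Proof. by elim: m => [|m /= ->] //; case: d. Qed.

End Powers.

Lemma pullback_pow (E : category) (X Y : E) (f : hom X Y) (P : pullback f f) :
  is_pow f (f ∘ pb1 P) (fun b : bool => if b then pb1 P else pb2 P).
Proof.
split=> [[]|W x u e] //; first by rewrite pbE.
have e' : f ∘ u true = f ∘ u false by rewrite !e.
exists (pblift P _ _ e'); split.
  by split=> [|[]]; rewrite -?compcA ?pblift1 ?pblift2.
move=> h [_ hp]; apply: pb_ext.
  by rewrite pblift1 -(hp true).
by rewrite pblift2 -(hp false).
Qed.

(** [t_powers] speaks of some power indexed by ['I_2], while [t2] is chosen independently. The two
    are isomorphic, and T of the isomorphism transports the universal property. *)
Lemma tangent_t2_pow (E : category) (T : functor E E) (t : tangent_on T) (A : E) :
  is_pow (fmap T (tp t A)) (fmap T (tp t A ∘ pb1 (t2 t A)))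
    (fun b : bool => fmap T (if b then pb1 (t2 t A) else pb2 (t2 t A))).
Proof.
have [P [base [proj powP]]] := t_powers t A 2.
have pow0 := powP 0; have pow1 := powP 1; rewrite /is_power /= in pow0 pow1.
have pow2 := pullback_pow (t2 t A).
pose n (b : bool) : 'I_2 := if b then ord0 else ord_max.
pose q (b : bool) := if b then pb1 (t2 t A) else pb2 (t2 t A).
pose q' (i : 'I_2) := q (i == ord0).
have nq b : q' (n b) = q b by case: b.
have [|h [[hb hp] _]] := pow0.2 _ (tp t A ∘ pb1 (t2 t A)) q'.
  by move=> i; exact: (pow2.1 (i == ord0)).
have [|k [[kb kp] _]] := pow2.2 _ base (fun b => proj (n b)).
  by move=> b; rewrite pow0.1.
have hk : h ∘ k = idc _.
  apply: (pow_ext pow0) => [|i]; rewrite compcA ?hb ?hp compc1 // /q' kp.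
  by congr proj; case: i => -[|[|//]] hi; apply: val_inj.
have kh : k ∘ h = idc _.
  apply: (pow_ext pow2) => [|b]; rewrite compcA ?kb ?kp compc1 //.
  by rewrite hp nq.
split=> [b|W x u e]; first by rewrite -fmapM pow2.1.
have [|y [[yb yp] yU]] := pow1.2 W x (fun i => u (i == ord0)) => //.
have nb b : (n b == ord0) = b by case: b.
exists (fmap T k ∘ y); split=> [|y' [yb' yp']].
  split=> [|b]; rewrite compcA -fmapM ?kb //.
  by rewrite kp yp nb.
have -> : y = fmap T h ∘ y'.
  apply: yU; split=> [|i]; rewrite compcA -fmapM ?hb // hp.
  exact: yp'.
by rewrite compcA -fmapM kh fmap1 comp1c.
Qed.

(** * Base change of slices *)

Lemma sl_morM (C : category) (S : C) (X Y Z : slice S) (g : hom Y Z) (f : hom X Y) :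
  sl_mor (g ∘ f) = sl_mor g ∘ sl_mor f.
Proof. by []. Qed.

Section BaseChange.
Variables (C : category) (pb : cleavage C).

(** The left adjoint of base change along [g]; [bch_tr] and [bch_untr] are the two directions of the
    adjunction. *)
Definition post (V W : C) (g : hom V W) (Y : slice V) : slice W :=
  @SliceOb C W (sl_ob Y) (g ∘ sl_map Y).

Section Transpose.
Variables (V W : C) (g : hom V W).

Lemma bch_tr_proof (Y : slice V) (Z : slice W) (h : hom Y (bch pb g Z)) :
  sl_map Z ∘ (bch_fst pb g Z ∘ sl_mor h) = sl_map (post g Y).
Proof. by rewrite compcA [sl_map Z ∘ _]pbE -compcA [_ ∘ sl_mor h]sl_morE. Qed.

Definition bch_tr Y Z (h : hom Y (bch pb g Z)) : hom (post g Y) Z :=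
  @SliceHom C W (post g Y) Z _ (bch_tr_proof h).

Lemma bch_untr (Y : slice V) (Z : slice W) (h : hom (post g Y) Z) :
  exists k : hom Y (bch pb g Z), bch_fst pb g Z ∘ sl_mor k = sl_mor h.
Proof.
have e : sl_map Z ∘ sl_mor h = g ∘ sl_map Y by rewrite sl_morE.
pose k := pblift (pb (sl_map Z) g) _ _ e.
have ek : sl_map (bch pb g Z) ∘ k = sl_map Y by exact: pblift2.
by exists (@SliceHom C V Y (bch pb g Z) k ek); exact: pblift1.
Qed.

(** Base change is a right adjoint: a cone over the base-changed diagram transposes to a cone over
    the original one, and its mediating morphism transposes back. *)
Lemma bch_pow (I : Type) (B A P : slice W) (p : hom B A) (base : hom P A)
    (proj : I -> hom P B) : is_pow p base proj ->
  is_pow (bch_hom pb g p) (bch_hom pb g base) (fun i => bch_hom pb g (proj i)).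
Proof.
move=> powP; split=> [i|Y x u e]; first by rewrite -bch_homM powP.1.
have [|h [[hb hp] hU]] := powP.2 (post g Y) (bch_tr x) (fun i => bch_tr (u i)).
  move=> i; apply: slice_hom_ext; rewrite /= -(e i) [in RHS]/=.
  by rewrite !compcA bch_homE.
have [k kE] := bch_untr h; exists k; split.
  split=> [|i]; apply: bch_ext; rewrite [sl_mor (_ ∘ k)]/= compcA bch_homE -compcA kE.
    exact: (congr1 (fun m => sl_mor m) hb).
  exact: (congr1 (fun m => sl_mor m) (hp i)).
move=> k' [kb' kp']; apply: bch_ext; rewrite kE.
suff -> : h = bch_tr k' by [].
apply: hU; split=> [|i]; apply: slice_hom_ext; rewrite /= compcA -bch_homE -compcA.
  by rewrite -kb'.
by rewrite -kp'.
Qed.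

End Transpose.

Lemma bch_compE (U V W : C) (f : hom U V) (g : hom V W) (h : hom U W) (e : h = g ∘ f)
    (Z : slice W) :
  bch_fst pb h Z ∘ sl_mor (bch_comp pb e Z) = bch_fst pb g Z ∘ bch_fst pb f (bch pb g Z).
Proof. exact: pblift1. Qed.

Lemma bch_comp_nat (U V W : C) (f : hom U V) (g : hom V W) (h : hom U W) (e : h = g ∘ f)
    (Z Z' : slice W) (k : hom Z Z') :
  bch_comp pb e Z' ∘ bch_hom pb f (bch_hom pb g k) = bch_hom pb h k ∘ bch_comp pb e Z.
Proof.
apply: bch_ext; rewrite !sl_morM.
rewrite [LHS]compcA bch_compE -[LHS]compcA bch_homE [LHS]compcA bch_homE.
by rewrite [RHS]compcA bch_homE -[RHS]compcA bch_compE compcA.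
Qed.

End BaseChange.

(** * Limits of pseudocones *)

Local Arguments compc : simpl never.

Section PseudoconeLimits.
Variables (C : category) (pb : cleavage C) (D : base_system C).
Local Notation PC := (@PC C pb D).
Local Notation "A @ i" := (pca (pc_pre A) i) (at level 20).
Local Notation "h $ i" := (pch h i) (at level 20).
Local Notation bch f Z := (@bch C pb _ _ (bs f) Z).
Local Notation bhom f h := (@bch_hom C pb _ _ (bs f) _ _ h).
Local Notation tau A f := (pct (pc_pre A) f).

Lemma tau_iso (A : PC) i j (f : bH i j) : is_iso (tau A f).
Proof. exact: (pcP A).1. Qed.

Lemma tauM (A : PC) i j k (f : bH i j) (g : bH j k) (h : bH i k) (e : bcomp f g h) :
  tau A h ∘ bch_comp pb (bsM e) (A @ k) = tau A f ∘ bhom f (tau A g).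
Proof. exact: (pcP A).2. Qed.

Lemma pchE (A B : PC) (h : hom A B) i j (f : bH i j) :
  h $ i ∘ tau A f = tau B f ∘ bhom f (h $ j).
Proof. exact: pchP. Qed.

Lemma pch_compE (X Y Z : PC) (h : hom Y Z) (k : hom X Y) i : (h ∘ k) $ i = h $ i ∘ k $ i.
Proof. by []. Qed.

(** The morphisms [q k] already commute with the transitions, so compatibility of [h] may be tested
    after composing with them once they are jointly monic in each component. *)
Lemma compat_reflect (X Y : PC) (I : Type) (Z : I -> PC) (q : forall k, hom Y (Z k))
    (h : forall i, hom (X @ i) (Y @ i)) :
  (forall i W (a b : hom W (Y @ i)), (forall k, q k $ i ∘ a = q k $ i ∘ b) -> a = b) ->
  (forall k, @pc_compat C pb D (pc_pre X) (pc_pre (Z k)) (fun i => q k $ i ∘ h i)) ->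
  @pc_compat C pb D (pc_pre X) (pc_pre Y) h.
Proof.
move=> qm hc i j f; apply: qm => k.
by rewrite compcA hc bch_homM !compcA pchE.
Qed.

(** The mediating morphisms found in each component are compatible because both sides of the
    compatibility square end in a power and have the same composites with [base] and [proj]. *)
Lemma pc_pow (I : Type) (A B P : PC) (p : hom B A) (base : hom P A) (proj : I -> hom P B) :
  (forall i, is_pow (p $ i) (base $ i) (fun k => proj k $ i)) -> is_pow p base proj.
Proof.
move=> powP; split=> [k|W x u e]; first by apply: pc_hom_ext => i; exact: (powP i).1.
have ei i k : p $ i ∘ u k $ i = x $ i by rewrite -pch_compE e.
pose h i := cid ((powP i).2 _ _ _ (ei i)).
pose h' i := sval (h i).
have hb i : base $ i ∘ h' i = x $ i by have [] := (svalP (h i)).1.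
have hp i k : proj k $ i ∘ h' i = u k $ i by have [_] := (svalP (h i)).1; apply.
have hc : @pc_compat C pb D (pc_pre W) (pc_pre P) h'.
  move=> i j f; apply: (pow_ext (powP i)) => [|k].
    by rewrite compcA hb pchE compcA pchE -compcA -bch_homM hb.
  by rewrite compcA hp pchE compcA pchE -compcA -bch_homM hp.
exists (@PcHom C pb D W P h' hc); split.
  by split=> [|k]; apply: pc_hom_ext => i; [exact: hb|exact: hp].
move=> k [kb kp]; apply: pc_hom_ext => i; apply: (pow_ext (powP i)) => [|l].
  by rewrite [LHS]hb -kb.
by rewrite [LHS]hp -kp.
Qed.

Lemma pc_equalizer (E X Y : PC) (f g : hom X Y) (e : hom E X) :
  (forall i, is_equalizer (f $ i) (g $ i) (e $ i)) -> is_equalizer f g e.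
Proof.
move=> eqE; split=> [|W u fu]; first by apply: pc_hom_ext => i; exact: (eqE i).1.
have mono i Z (a b : hom Z (E @ i)) : e $ i ∘ a = e $ i ∘ b -> a = b.
  move=> eab; have [|x [_ xU]] := (eqE i).2 Z (e $ i ∘ b); first by rewrite !compcA (eqE i).1.
  by rewrite -(xU a) // -(xU b).
have fui i : f $ i ∘ u $ i = g $ i ∘ u $ i by rewrite -pch_compE fu.
pose h i := cid ((eqE i).2 _ _ (fui i)).
pose h' i := sval (h i).
have he i : e $ i ∘ h' i = u $ i by exact: (svalP (h i)).1.
have hc : @pc_compat C pb D (pc_pre W) (pc_pre E) h'.
  by move=> i j k; apply: mono; rewrite compcA he pchE compcA pchE -compcA -bch_homM he.
exists (@PcHom C pb D W E h' hc); split; first by apply: pc_hom_ext => i; exact: he.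
by move=> k ke; apply: pc_hom_ext => i; apply: mono; rewrite [LHS]he -ke.
Qed.

(* Pulling back preserves powers, so componentwise powers have unique
   transition isomorphisms. *)
Section PowerPseudocone.
Variables (I : Type) (A B : PC) (p : hom B A).
Variables (P : forall i, slice (bS (b := D) i)) (base : forall i, hom (P i) (A @ i)).
Variable proj : forall i, I -> hom (P i) (B @ i).
Hypothesis powP : forall i, is_pow (p $ i) (base i) (proj i).

Lemma pow_tau_exists i j (f : bH i j) : exists t : hom (bch f (P j)) (P i),
  base i ∘ t = tau A f ∘ bhom f (base j) /\
  forall k, proj i k ∘ t = tau B f ∘ bhom f (proj j k).
Proof.
have [|t [ht _]] := (powP i).2 (bch f (P j)) (tau A f ∘ bhom f (base j))
    (fun k => tau B f ∘ bhom f (proj j k)); last by exists t.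
by move=> k; rewrite compcA pchE -compcA -bch_homM (powP j).1.
Qed.

Definition pow_tau i j (f : bH i j) := sval (cid (pow_tau_exists f)).

Lemma pow_tau_base i j (f : bH i j) : base i ∘ pow_tau f = tau A f ∘ bhom f (base j).
Proof. exact: (svalP (cid (pow_tau_exists f))).1. Qed.

Lemma pow_tau_proj i j (f : bH i j) k : proj i k ∘ pow_tau f = tau B f ∘ bhom f (proj j k).
Proof. exact: (svalP (cid (pow_tau_exists f))).2. Qed.

Definition pow_precone : precone pb D := @Precone C pb D P pow_tau.

Lemma pow_pseudocone : is_pseudocone pow_precone.
Proof.
split=> [i j f|i j k f g h e] /=.
  apply: (pow_iso (bch_pow pb (bs f) (powP j)) (powP i) (tau_iso A f) (tau_iso B f)).
  - exact: pchE.
  - exact: pow_tau_base.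
  - exact: pow_tau_proj.
(* Both sides of the cocycle condition end in a power, so it is inherited from the cocycle
   conditions of [A] and [B]. *)
apply: (pow_ext (powP i)) => [|l].
  rewrite !compcA !pow_tau_base -!compcA -bch_comp_nat -bch_homM pow_tau_base bch_homM.
  by rewrite !compcA tauM.
rewrite !compcA !pow_tau_proj -!compcA -bch_comp_nat -bch_homM pow_tau_proj bch_homM.
by rewrite !compcA tauM.
Qed.

Definition pow_pc : PC := Pseudocone pow_pseudocone.
Definition pow_base : hom pow_pc A := @PcHom C pb D pow_pc A base pow_tau_base.
Definition pow_proj (k : I) : hom pow_pc B :=
  @PcHom C pb D pow_pc B (fun i => proj i k) (fun i j f => pow_tau_proj f k).

End PowerPseudocone.

(** * The pseudolimit tangent structure *)

Section Tangent.
Variable T : forall i : bI D, functor (slice (bS i)) (slice (bS i)).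
Variable tt : forall i, tangent_on (T i).
Variable gT : forall (i j : bI D) (f : bH i j) (Z : slice (bS j)),
  hom (bch f (T j Z)) (T i (bch f Z)).
Hypothesis gT_iso : forall i j (f : bH i j) Z, is_iso (gT f Z).
Hypothesis gT_nat : forall i j (f : bH i j) Z Z' (h : hom Z Z'),
  fmap (T i) (bhom f h) ∘ gT f Z = gT f Z' ∘ bhom f (fmap (T j) h).
Hypothesis gT_comp : forall i j k (f : bH i j) (g : bH j k) (h : bH i k) (e : bcomp f g h) Z,
  gT h Z ∘ bch_comp pb (bsM e) (T k Z) =
  fmap (T i) (bch_comp pb (bsM e) Z) ∘ gT f (bch g Z) ∘ bhom f (gT g Z).
Hypothesis gT_p : forall i j (f : bH i j) Z,
  tp (tt i) (bch f Z) ∘ gT f Z = bhom f (tp (tt j) Z).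
Hypothesis gT_z : forall i j (f : bH i j) Z,
  gT f Z ∘ bhom f (tz (tt j) Z) = tz (tt i) (bch f Z).
(** Such an [h] is unique by [pb_ext]: it is the canonical comparison between the base change of T2
    and T2 of the base change. *)
Hypothesis gT_add : forall i j (f : bH i j) Z
    (h : hom (bch f (t2 (tt j) Z)) (t2 (tt i) (bch f Z))),
  pb1 (t2 (tt i) (bch f Z)) ∘ h = gT f Z ∘ bhom f (pb1 (t2 (tt j) Z)) ->
  pb2 (t2 (tt i) (bch f Z)) ∘ h = gT f Z ∘ bhom f (pb2 (t2 (tt j) Z)) ->
  gT f Z ∘ bhom f (tadd (tt j) Z) = tadd (tt i) (bch f Z) ∘ h.
Hypothesis gT_l : forall i j (f : bH i j) Z,
  fmap (T i) (gT f Z) ∘ gT f (T j Z) ∘ bhom f (tl (tt j) Z) =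
  tl (tt i) (bch f Z) ∘ gT f Z.
Hypothesis gT_c : forall i j (f : bH i j) Z,
  fmap (T i) (gT f Z) ∘ gT f (T j Z) ∘ bhom f (tc (tt j) Z) =
  tc (tt i) (bch f Z) ∘ (fmap (T i) (gT f Z) ∘ gT f (T j Z)).

(** The cocycle condition joins that of [A] to [gT_comp]; [gT_nat] moves [gT f] past the base change
    of [tau A g]. *)
Lemma pl_wd : @pl_functor_wd C pb D T gT.
Proof.
split=> [A|A B h i j f] /=.
  split=> [i j f|i j k f g h e] /=.
    by apply: iso_comp; [apply/iso_fmap/tau_iso|exact: gT_iso].
  rewrite -compcA gT_comp !compcA -fmapM tauM fmapM bch_homM !compcA.
  by rewrite -[in RHS](compcA (fmap _ _)) -gT_nat !compcA.
by rewrite compcA -fmapM pchE fmapM -compcA gT_nat compcA.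
Qed.

Local Notation TPC := (pl_functor pl_wd).

Lemma tau_T (A : PC) i j (f : bH i j) :
  tau (TPC A) f = fmap (T i) (tau A f) ∘ gT f (A @ j).
Proof. by []. Qed.

Definition pc_p (A : PC) : hom (TPC A) A.
Proof.
exists (fun i => tp (tt i) (A @ i)) => i j f.
by rewrite tau_T compcA tp_nat -compcA gT_p.
Defined.

Definition pc_z (A : PC) : hom A (TPC A).
Proof.
exists (fun i => tz (tt i) (A @ i)) => i j f.
by rewrite tau_T -compcA gT_z tz_nat.
Defined.

Definition pc_l (A : PC) : hom (TPC A) (TPC (TPC A)).
Proof.
exists (fun i => tl (tt i) (A @ i)) => i j f.
rewrite !tau_T fmapM !compcA -tl_nat -!compcA; congr (_ ∘ _).
by rewrite !compcA gT_l.
Defined.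

Definition pc_c (A : PC) : hom (TPC (TPC A)) (TPC (TPC A)).
Proof.
exists (fun i => tc (tt i) (A @ i)) => i j f.
rewrite !tau_T fmapM !compcA -tc_nat -!compcA; congr (_ ∘ _).
by rewrite !compcA gT_c !compcA.
Defined.

Let t2_pow (A : PC) i : is_pow (pc_p A $ i) (tp (tt i) (A @ i) ∘ pb1 (t2 (tt i) (A @ i)))
  (fun b : bool => if b then pb1 (t2 (tt i) (A @ i)) else pb2 (t2 (tt i) (A @ i))).
Proof. exact: pullback_pow. Qed.

Definition pc_t2_ob (A : PC) : PC := pow_pc (t2_pow A).
Definition pc_t2_1 (A : PC) : hom (pc_t2_ob A) (TPC A) := pow_proj (t2_pow A) true.
Definition pc_t2_2 (A : PC) : hom (pc_t2_ob A) (TPC A) := pow_proj (t2_pow A) false.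

Lemma pc_t2E (A : PC) : pc_p A ∘ pc_t2_1 A = pc_p A ∘ pc_t2_2 A.
Proof. by apply: pc_hom_ext => i; exact: pbE. Qed.

Section Lift.
Variables (A W : PC) (u v : hom W (TPC A)) (e : pc_p A ∘ u = pc_p A ∘ v).

Lemma pc_t2_lift_eq i : tp (tt i) (A @ i) ∘ u $ i = tp (tt i) (A @ i) ∘ v $ i.
Proof. exact: (congr1 (fun m => m $ i) e). Qed.

Definition pc_t2_lift : hom W (pc_t2_ob A).
Proof.
exists (fun i => pblift (t2 (tt i) (A @ i)) (u $ i) (v $ i) (pc_t2_lift_eq i)).
apply: (@compat_reflect _ _ bool (fun=> TPC A) (fun b => pow_proj (t2_pow A) b)).
  by move=> i Z a b h; apply: pb_ext; [exact: (h true)|exact: (h false)].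
by move=> [] i j f; rewrite /= ?pblift1 ?pblift2; [exact: (pchE u f)|exact: (pchE v f)].
Defined.

End Lift.

Definition pc_t2 (A : PC) : pullback (pc_p A) (pc_p A).
Proof.
unshelve refine (@Pullback PC _ _ _ _ _ (pc_t2_ob A) (pc_t2_1 A) (pc_t2_2 A) (pc_t2E A)
  (fun W u v e => pc_t2_lift e) _ _ _).
- by move=> W u v e; apply: pc_hom_ext => i; exact: pblift1.
- by move=> W u v e; apply: pc_hom_ext => i; exact: pblift2.
- move=> W h k e1 e2; apply: pc_hom_ext => i; apply: pb_ext.
    exact: (congr1 (fun m => m $ i) e1).
  exact: (congr1 (fun m => m $ i) e2).
Defined.

Definition pc_add (A : PC) : hom (pc_t2 A) (TPC A).
Proof.
exists (fun i => tadd (tt i) (A @ i)) => i j f.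
set Z := A @ j.
have e : tp (tt i) (bch f Z) ∘ (gT f Z ∘ bhom f (pb1 (t2 (tt j) Z))) =
    tp (tt i) (bch f Z) ∘ (gT f Z ∘ bhom f (pb2 (t2 (tt j) Z))).
  by rewrite !compcA gT_p -!bch_homM pbE.
(* The transition of T2 A factors as [k], the comparison of T2 with base change, followed by the map
   [h] that [tau A f] induces on T2. *)
pose k := pblift (t2 (tt i) (bch f Z)) _ _ e.
rewrite tau_T -compcA (@gT_add _ _ _ _ k) ?pblift1 ?pblift2 //.
have [h [h1 h2 hE]] := tadd_nat (tt i) (tau A f).
rewrite compcA hE -compcA; congr (_ ∘ _); apply: pb_ext.
  rewrite compcA h1 -compcA pblift1 compcA.
  exact: (pow_tau_proj (t2_pow A) f true).
rewrite compcA h2 -compcA pblift2 compcA.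
exact: (pow_tau_proj (t2_pow A) f false).
Defined.

Definition comp_diag (I : Type) (d : diag PC I) i : diag (slice (bS i)) I :=
  Diag (dp d $ i) (dbase d $ i) (fun k => dproj d k $ i).

Lemma comp_diag_iter (I : Type) (d : diag PC I) i m :
  comp_diag (iter m (diag_map TPC) d) i = iter m (diag_map (T i)) (comp_diag d i).
Proof. by elim: m => //= m <-. Qed.

(** One componentwise choice of powers serves all [m]: the components of the iterated diagram are
    the iterates of its components, where [t_powers] applies. *)
Lemma pc_powers (A : PC) n :
  exists (P : PC) (base : hom P A) (proj : 'I_n -> hom P (TPC A)),
    forall m, is_power (iterhom TPC m (pc_p A)) (iterhom TPC m base)
                       (fun i => iterhom TPC m (proj i)).
Proof.
pose P1 i := cid (t_powers (tt i) (A @ i) n).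
pose P2 i := cid (svalP (P1 i)).
pose P3 i := cid (svalP (P2 i)).
pose P i := sval (P1 i); pose base i : hom (P i) (A @ i) := sval (P2 i).
pose proj i : 'I_n -> hom (P i) (T i (A @ i)) := sval (P3 i).
have powm i m : is_power (iterhom (T i) m (tp (tt i) (A @ i))) (iterhom (T i) m (base i))
    (fun k => iterhom (T i) m (proj i k)) := svalP (P3 i) m.
have pow0 i : is_pow (pc_p A $ i) (base i) (proj i) := powm i 0.
exists (pow_pc pow0), (pow_base pow0), (pow_proj pow0) => m.
pose d : diag PC 'I_n := Diag (pc_p A) (pow_base pow0) (pow_proj pow0).
suff : diag_pow (iter m (diag_map TPC) d) by rewrite diag_iter.
apply: pc_pow => i; suff : diag_pow (comp_diag (iter m (diag_map TPC) d) i) by [].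
by rewrite comp_diag_iter diag_iter; exact: powm.
Qed.

(* The projections of [T2 A] stay jointly monic under [T], as [t_powers] makes
   [T] preserve [T2 A]. *)
Lemma T_t2_compat (A X : PC) (h : forall i, hom (X @ i) (TPC (pc_t2 A) @ i))
    (u v : hom X (TPC (TPC A))) :
  (forall i, fmap (T i) (pb1 (t2 (tt i) (A @ i))) ∘ h i = u $ i) ->
  (forall i, fmap (T i) (pb2 (t2 (tt i) (A @ i))) ∘ h i = v $ i) ->
  @pc_compat C pb D (pc_pre X) (pc_pre (TPC (pc_t2 A))) h.
Proof.
move=> h1 h2.
apply: (@compat_reflect _ _ bool (fun=> TPC (TPC A))
  (fun b => fmap TPC (if b then pc_t2_1 A else pc_t2_2 A))).
  move=> i Z a b e; apply: (pow_ext (tangent_t2_pow (tt i) (A @ i))).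
    by rewrite fmapM -!compcA; congr (_ ∘ _); exact: (e true).
  by move=> []; [exact: (e true)|exact: (e false)].
move=> b i j f.
have eh l : fmap TPC (if b then pc_t2_1 A else pc_t2_2 A) $ l ∘ h l = (if b then u else v) $ l.
  by case: b; [exact: h1|exact: h2].
by rewrite !eh pchE.
Qed.

Lemma pc_tadd_nat (A B : PC) (f : hom A B) : exists h : hom (pc_t2 A) (pc_t2 B),
  [/\ pb1 (pc_t2 B) ∘ h = fmap TPC f ∘ pb1 (pc_t2 A),
      pb2 (pc_t2 B) ∘ h = fmap TPC f ∘ pb2 (pc_t2 A)
    & fmap TPC f ∘ pc_add A = pc_add B ∘ h].
Proof.
have e : pc_p B ∘ (fmap TPC f ∘ pb1 (pc_t2 A)) = pc_p B ∘ (fmap TPC f ∘ pb2 (pc_t2 A)).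
  by apply: pc_hom_ext => i; rewrite !pch_compE /= !compcA tp_nat -!compcA pbE.
exists (pblift (pc_t2 B) _ _ e); split; rewrite ?pblift1 ?pblift2 //.
apply: pc_hom_ext => i; have [h [h1 h2 hE]] := tadd_nat (tt i) (f $ i).
rewrite [LHS]hE; congr (_ ∘ _).
by apply: pb_ext; rewrite ?h1 ?h2 /= ?pblift1 ?pblift2.
Qed.

(** The target is T of a pullback, so the pairing is not a lift through [pc_t2]. It is taken in each
    component from [tl_add], and [T_t2_compat] assembles the components. *)
Lemma pc_tl_add (A : PC) : exists h : hom (pc_t2 A) (TPC (pc_t2 A)),
  [/\ fmap TPC (pb1 (pc_t2 A)) ∘ h = pc_l A ∘ pb1 (pc_t2 A),
      fmap TPC (pb2 (pc_t2 A)) ∘ h = pc_l A ∘ pb2 (pc_t2 A)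
    & pc_l A ∘ pc_add A = fmap TPC (pc_add A) ∘ h].
Proof.
pose H i := cid (tl_add (tt i) (A @ i)); pose h i := sval (H i).
have hP i := svalP (H i).
have hc : @pc_compat C pb D (pc_pre (pc_t2_ob A)) (pc_pre (TPC (pc_t2_ob A))) h.
  apply: (@T_t2_compat A (pc_t2_ob A) h (pc_l A ∘ pc_t2_1 A) (pc_l A ∘ pc_t2_2 A)) => i.
    by have [e _ _] := hP i.
  by have [_ e _] := hP i.
exists (@PcHom C pb D (pc_t2_ob A) (TPC (pc_t2_ob A)) h hc); split; apply: pc_hom_ext => i;
  by have [] := hP i.
Qed.

Lemma pc_tc_add (A : PC) : exists h : hom (TPC (pc_t2 A)) (pc_t2 (TPC A)),
  [/\ pb1 (pc_t2 (TPC A)) ∘ h = pc_c A ∘ fmap TPC (pb1 (pc_t2 A)),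
      pb2 (pc_t2 (TPC A)) ∘ h = pc_c A ∘ fmap TPC (pb2 (pc_t2 A))
    & pc_c A ∘ fmap TPC (pc_add A) = pc_add (TPC A) ∘ h].
Proof.
have e : pc_p (TPC A) ∘ (pc_c A ∘ fmap TPC (pb1 (pc_t2 A))) =
    pc_p (TPC A) ∘ (pc_c A ∘ fmap TPC (pb2 (pc_t2 A))).
  by apply: pc_hom_ext => i; rewrite !pch_compE /= !compcA tc_p -!fmapM pbE.
exists (pblift (pc_t2 (TPC A)) _ _ e); split; rewrite ?pblift1 ?pblift2 //.
apply: pc_hom_ext => i; have [h [h1 h2 hE]] := tc_add (tt i) (A @ i).
rewrite [LHS]hE; congr (_ ∘ _).
by apply: pb_ext; rewrite ?h1 ?h2 /= ?pblift1 ?pblift2.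
Qed.

Lemma pc_universal (A : PC) : exists h : hom (pc_t2 A) (TPC (pc_t2 A)),
  [/\ fmap TPC (pb1 (pc_t2 A)) ∘ h = pc_l A ∘ pb1 (pc_t2 A),
      fmap TPC (pb2 (pc_t2 A)) ∘ h = pc_z (TPC A) ∘ pb2 (pc_t2 A)
    & is_equalizer (fmap TPC (pc_p A)) (pc_z A ∘ pc_p A ∘ pc_p (TPC A))
        (fmap TPC (pc_add A) ∘ h)].
Proof.
pose H i := cid (t_universal (tt i) (A @ i)); pose h i := sval (H i).
have hP i := svalP (H i).
have hc : @pc_compat C pb D (pc_pre (pc_t2_ob A)) (pc_pre (TPC (pc_t2_ob A))) h.
  apply: (@T_t2_compat A (pc_t2_ob A) h (pc_l A ∘ pc_t2_1 A) (pc_z (TPC A) ∘ pc_t2_2 A)) => i.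
    by have [e _ _] := hP i.
  by have [_ e _] := hP i.
exists (@PcHom C pb D (pc_t2_ob A) (TPC (pc_t2_ob A)) h hc); split.
- by apply: pc_hom_ext => i; have [] := hP i.
- by apply: pc_hom_ext => i; have [] := hP i.
- by apply: pc_equalizer => i; have [] := hP i.
Qed.

Definition pc_tangent : tangent_on TPC.
Proof.
unshelve refine (@TangentOn PC TPC pc_p _ pc_z _ pc_powers pc_t2 pc_add pc_tadd_nat
  pc_l _ pc_c _ _ _ _ _ _ _ pc_tl_add _ _ pc_tc_add _ _ _ _ _ _ pc_universal).
- by move=> A B f; apply: pc_hom_ext => i; exact: tp_nat.
- by move=> A B f; apply: pc_hom_ext => i; exact: tz_nat.
- by move=> A B f; apply: pc_hom_ext => i; exact: tl_nat.
- by move=> A B f; apply: pc_hom_ext => i; exact: tc_nat.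
- by move=> A; apply: pc_hom_ext => i; exact: tp_add.
- by move=> A; apply: pc_hom_ext => i; exact: tp_z.
- by move=> A W u v w *; apply: pc_hom_ext => i; exact: taddA.
- by move=> A W u v *; apply: pc_hom_ext => i; exact: taddC.
- by move=> A W u *; apply: pc_hom_ext => i; exact: tadd0.
- by move=> A; apply: pc_hom_ext => i; exact: tl_p.
- by move=> A; apply: pc_hom_ext => i; exact: tl_z.
- by move=> A; apply: pc_hom_ext => i; exact: tc_p.
- by move=> A; apply: pc_hom_ext => i; exact: tc_z.
- by move=> A; apply: pc_hom_ext => i; exact: tcc.
- by move=> A; apply: pc_hom_ext => i; exact: tc_l.
- by move=> A; apply: pc_hom_ext => i; exact: tl_l.
- by move=> A; apply: pc_hom_ext => i; exact: tc_hex.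
- by move=> A; apply: pc_hom_ext => i; exact: tc_lc.
Defined.

Lemma pc_tangent_pl : is_pl_structure tt pc_tangent.
Proof.
move=> A i; split=> //; exists (idc _).
by split; rewrite compc1.
Qed.

End Tangent.
End PseudoconeLimits.

Import GRing.Theory.
Local Open Scope ring_scope.
Local Open Scope quotient_scope.

(** * Quotient rings *)

(** Localizations, residue rings and pushouts are all built as quotients of such data. Congruence is
    asked in the first argument only, since commutativity yields the second. *)
Record ring_setoid := RingSetoid {
  rs_car :> Type;
  rs_eq : rs_car -> rs_car -> Prop;
  rs_zero : rs_car;
  rs_one : rs_car;
  rs_add : rs_car -> rs_car -> rs_car;
  rs_opp : rs_car -> rs_car;
  rs_mul : rs_car -> rs_car -> rs_car;
  rs_refl : forall x, rs_eq x x;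
  rs_sym : forall x y, rs_eq x y -> rs_eq y x;
  rs_trans : forall y x z, rs_eq x y -> rs_eq y z -> rs_eq x z;
  rs_add_eq : forall x x' y, rs_eq x x' -> rs_eq (rs_add x y) (rs_add x' y);
  rs_opp_eq : forall x x', rs_eq x x' -> rs_eq (rs_opp x) (rs_opp x');
  rs_mul_eq : forall x x' y, rs_eq x x' -> rs_eq (rs_mul x y) (rs_mul x' y);
  rs_addA : forall x y z, rs_eq (rs_add x (rs_add y z)) (rs_add (rs_add x y) z);
  rs_addC : forall x y, rs_eq (rs_add x y) (rs_add y x);
  rs_add0 : forall x, rs_eq (rs_add rs_zero x) x;
  rs_addN : forall x, rs_eq (rs_add (rs_opp x) x) rs_zero;
  rs_mulA : forall x y z, rs_eq (rs_mul x (rs_mul y z)) (rs_mul (rs_mul x y) z);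
  rs_mulC : forall x y, rs_eq (rs_mul x y) (rs_mul y x);
  rs_mul1 : forall x, rs_eq (rs_mul rs_one x) x;
  rs_mulDl : forall x y z,
    rs_eq (rs_mul (rs_add x y) z) (rs_add (rs_mul x z) (rs_mul y z)) }.

Section QuotientRing.
Variable S : ring_setoid.

HB.instance Definition _ := gen_eqMixin (rs_car S).
HB.instance Definition _ := gen_choiceMixin (rs_car S).

Definition rs_eqb (x y : S) : bool := `[< rs_eq x y >].

Lemma rs_eqb_refl : reflexive rs_eqb.
Proof. by move=> x; apply/asboolP/rs_refl. Qed.
Lemma rs_eqb_sym : symmetric rs_eqb.
Proof. by move=> x y; apply/asboolP/asboolP => /rs_sym. Qed.
Lemma rs_eqb_trans : transitive rs_eqb.
Proof. by move=> y x z /asboolP h /asboolP h'; apply/asboolP; exact: rs_trans h h'. Qed.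

Canonical rs_equiv := EquivRel rs_eqb rs_eqb_refl rs_eqb_sym rs_eqb_trans.

Definition rquot := {eq_quot rs_equiv}.
HB.instance Definition _ := Choice.on rquot.

Definition rpi (x : S) : rquot := \pi_rquot x.

Lemma rpi_eq x y : rpi x = rpi y <-> rs_eq x y.
Proof. by split=> [/eqmodP/asboolP|h] //; apply/eqmodP/asboolP. Qed.

Lemma rpiK x : rs_eq (repr (rpi x)) x.
Proof. by apply/rpi_eq; rewrite /rpi reprK. Qed.

Lemma rpi_surj q : exists x, q = rpi x.
Proof. by exists (repr q); rewrite /rpi reprK. Qed.

Lemma rquot_ind (P : rquot -> Prop) : (forall x, P (rpi x)) -> forall q, P q.
Proof. by move=> h q; have [x ->] := rpi_surj q. Qed.

Definition rq_add (p q : rquot) : rquot := rpi (rs_add (repr p) (repr q)).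
Definition rq_opp (p : rquot) : rquot := rpi (rs_opp (repr p)).
Definition rq_mul (p q : rquot) : rquot := rpi (rs_mul (repr p) (repr q)).

Lemma rq_addE x y : rq_add (rpi x) (rpi y) = rpi (rs_add x y).
Proof.
apply/rpi_eq; apply: rs_trans (rs_add_eq _ (rpiK x)) _.
apply: rs_trans (rs_addC _ _) _; apply: rs_trans (rs_add_eq _ (rpiK y)) _.
exact: rs_addC.
Qed.
Lemma rq_oppE x : rq_opp (rpi x) = rpi (rs_opp x).
Proof. by apply/rpi_eq/rs_opp_eq/rpiK. Qed.
Lemma rq_mulE x y : rq_mul (rpi x) (rpi y) = rpi (rs_mul x y).
Proof.
apply/rpi_eq; apply: rs_trans (rs_mul_eq _ (rpiK x)) _.
apply: rs_trans (rs_mulC _ _) _; apply: rs_trans (rs_mul_eq _ (rpiK y)) _.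
exact: rs_mulC.
Qed.

Let rqE := (rq_addE, rq_oppE, rq_mulE).

Lemma rq_addA : associative rq_add.
Proof. by elim/rquot_ind=> x; elim/rquot_ind=> y; elim/rquot_ind=> z; rewrite !rqE; exact/rpi_eq/rs_addA. Qed.
Lemma rq_addC : commutative rq_add.
Proof. by elim/rquot_ind=> x; elim/rquot_ind=> y; rewrite !rqE; exact/rpi_eq/rs_addC. Qed.
Lemma rq_add0 : left_id (rpi (rs_zero S)) rq_add.
Proof. by elim/rquot_ind=> x; rewrite !rqE; exact/rpi_eq/rs_add0. Qed.
Lemma rq_addN : left_inverse (rpi (rs_zero S)) rq_opp rq_add.
Proof. by elim/rquot_ind=> x; rewrite !rqE; exact/rpi_eq/rs_addN. Qed.
HB.instance Definition _ :=
  GRing.isZmodule.Build rquot rq_addA rq_addC rq_add0 rq_addN.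

Lemma rq_mulA : associative rq_mul.
Proof. by elim/rquot_ind=> x; elim/rquot_ind=> y; elim/rquot_ind=> z; rewrite !rqE; exact/rpi_eq/rs_mulA. Qed.
Lemma rq_mulC : commutative rq_mul.
Proof. by elim/rquot_ind=> x; elim/rquot_ind=> y; rewrite !rqE; exact/rpi_eq/rs_mulC. Qed.
Lemma rq_mul1 : left_id (rpi (rs_one S)) rq_mul.
Proof. by elim/rquot_ind=> x; rewrite !rqE; exact/rpi_eq/rs_mul1. Qed.
Lemma rq_mulDl : left_distributive rq_mul +%R.
Proof.
elim/rquot_ind=> x; elim/rquot_ind=> y; elim/rquot_ind=> z; rewrite /GRing.add /= !rqE.
exact/rpi_eq/rs_mulDl.
Qed.
HB.instance Definition _ := GRing.Zmodule_isComPzRing.Build rquot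
  rq_mulA rq_mulC rq_mul1 rq_mulDl.

Lemma rpi0 : rpi (rs_zero S) = 0. Proof. by []. Qed.
Lemma rpi1 : rpi (rs_one S) = 1. Proof. by []. Qed.
Lemma rpiD x y : rpi (rs_add x y) = rpi x + rpi y.
Proof. by rewrite /GRing.add /= rqE. Qed.
Lemma rpiN x : rpi (rs_opp x) = - rpi x.
Proof. by rewrite /GRing.opp /= rqE. Qed.
Lemma rpiM x y : rpi (rs_mul x y) = rpi x * rpi y.
Proof. by rewrite /GRing.mul /= rqE. Qed.

End QuotientRing.

Lemma make_rmorphism (A B : ring) (f : A -> B) :
  f 1 = 1 -> (forall x y, f (x + y) = f x + f y) -> (forall x y, f (x * y) = f x * f y) ->
  exists g : {rmorphism A -> B}, g =1 f.
Proof.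
move=> f1 fD fM.
have fz : zmod_morphism f.
  by move=> x y; apply: (addIr (f y)); rewrite -fD !subrK.
have fm : monoid_morphism f by [].
pose hz := GRing.isZmodMorphism.Build A B f fz.
pose hm := GRing.isMonoidMorphism.Build A B f fm.
pose F : {rmorphism A -> B} := HB.pack f hz hm.
by exists F.
Qed.

(** * Localization *)

Section Localization.
Variables (R : ring) (f : R).

(** The pair [(r, n)] stands for the fraction r / f^n; the factor [f ^+ k] accounts for [f] being a
    possible zero divisor. *)
Let eqf (x y : R * nat) := exists k, f ^+ k * (x.1 * f ^+ y.2 - y.1 * f ^+ x.2) = 0.

Definition loc_setoid : ring_setoid.
Proof.
unshelve refine (@RingSetoid (R * nat) eqf (0, 0%N) (1, 0%N)
  (fun x y => (x.1 * f ^+ y.2 + y.1 * f ^+ x.2, (x.2 + y.2)%N))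
  (fun x => (- x.1, x.2)) (fun x y => (x.1 * y.1, (x.2 + y.2)%N))
  _ _ _ _ _ _ _ _ _ _ _ _ _ _); rewrite /eqf.
- by move=> x; exists 0%N; rewrite subrr mulr0.
- by move=> x y [k e]; exists k; rewrite -opprB mulrN e oppr0.
(* The extra exponent [m] clears the denominator of the middle fraction. *)
- move=> [y m] [x n] [z p] /= [k e] [l e']; exists (k + l + m)%N.
  rewrite !exprD.
  have -> : f ^+ k * f ^+ l * f ^+ m * (x * f ^+ p - z * f ^+ n) =
    f ^+ l * f ^+ p * (f ^+ k * (x * f ^+ m - y * f ^+ n)) +
    f ^+ k * f ^+ n * (f ^+ l * (y * f ^+ p - z * f ^+ m)) by ring.
  by rewrite e e' !mulr0 addr0.
- move=> [x n] [x' n'] [y m] /= [k e]; exists k; rewrite !exprD.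
  have -> : f ^+ k * ((x * f ^+ m + y * f ^+ n) * (f ^+ n' * f ^+ m) -
      (x' * f ^+ m + y * f ^+ n') * (f ^+ n * f ^+ m)) =
    f ^+ m * f ^+ m * (f ^+ k * (x * f ^+ n' - x' * f ^+ n)) by ring.
  by rewrite e mulr0.
- by move=> [x n] [x' n'] /= [k e]; exists k; rewrite !mulNr -opprD mulrN e oppr0.
- move=> [x n] [x' n'] [y m] /= [k e]; exists k; rewrite !exprD.
  have -> : f ^+ k * (x * y * (f ^+ n' * f ^+ m) - x' * y * (f ^+ n * f ^+ m)) =
    f ^+ m * y * (f ^+ k * (x * f ^+ n' - x' * f ^+ n)) by ring.
  by rewrite e mulr0.
all: move=> [x n] /=; try (move=> [y m] /=; try move=> [z p] /=); exists 0%N;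
  rewrite ?addn0 ?addnA ?exprD ?expr0; ring.
Defined.

Definition loc : ring := rquot loc_setoid.

Definition locm_fun (r : R) : loc := @rpi loc_setoid (r, 0%N).

Lemma locm_exists : exists g : {rmorphism R -> loc}, g =1 locm_fun.
Proof.
apply: make_rmorphism => // x y; rewrite /locm_fun; [rewrite -rpiD|rewrite -rpiM] => //.
by rewrite /= expr0 !mulr1.
Qed.

Definition locm : {rmorphism R -> loc} := sval (cid locm_exists).

Lemma locmE r : locm r = @rpi loc_setoid (r, 0%N).
Proof. exact: (svalP (cid locm_exists) r). Qed.

Lemma locP : is_localization locm f.
Proof.
split.
- exists (@rpi loc_setoid (1, 1%N)); rewrite locmE -rpiM -rpi1; apply/rpi_eq.
  by exists 0%N; rewrite /= ?add0n ?addn0 ?expr0 ?expr1; ring.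
- elim/rquot_ind=> -[x n]; exists x, n; rewrite -rmorphXn !locmE -rpiM.
  by apply/rpi_eq; exists 0%N; rewrite /= ?add0n ?addn0 ?expr0 ?expr1; ring.
- move=> r; rewrite locmE -rpi0 => /rpi_eq[k]; rewrite /= => e; exists k.
  by rewrite -[RHS]e; ring.
Qed.

End Localization.

Lemma localization_unit (R L S : ring) (l : {rmorphism R -> L}) f (g : {rmorphism L -> S}) :
  is_localization l f -> exists y, g (l f) * y = 1.
Proof. by move=> [[y e] _ _]; exists (g y); rewrite -rmorphM e rmorph1. Qed.

Lemma unit_exp_cancel (S : ring) (a y x z : S) n : a * y = 1 -> x * a ^+ n = z * a ^+ n -> x = z.
Proof.
move=> e h; have: x * a ^+ n * y ^+ n = z * a ^+ n * y ^+ n by rewrite h.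
by rewrite -!mulrA -exprMn e expr1n !mulr1.
Qed.

Lemma localization_ext (R L S : ring) (l : {rmorphism R -> L}) f (g h : {rmorphism L -> S}) :
  is_localization l f -> (forall r, g (l r) = h (l r)) -> g = h.
Proof.
move=> lf e; apply: rmorph_ext => x; have [_ /(_ x)[r [n en]] _] := lf.
have [y ey] := localization_unit g lf.
apply: (@unit_exp_cancel _ _ _ _ _ n ey).
by rewrite {2}e -(rmorphXn g) -(rmorphXn h) -(rmorphM g) -(rmorphM h) -en.
Qed.

Lemma localization_lift (R L S : ring) (l : {rmorphism R -> L}) f (g : {rmorphism R -> S}) y :
  is_localization l f -> g f * y = 1 ->
  exists h : {rmorphism L -> S}, rcomp h l = g.
Proof.
move=> [[z ez] surj ker] gy.
have wd r r' n n' : l r * l f ^+ n' = l r' * l f ^+ n -> g r * g f ^+ n' = g r' * g f ^+ n.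
  move=> e; have [k ek] : exists k, f ^+ k * (r * f ^+ n' - r' * f ^+ n) = 0.
    by apply: ker; rewrite rmorphB !rmorphM !rmorphXn e subrr.
  apply/eqP; rewrite -subr_eq0; apply/eqP.
  apply: (@unit_exp_cancel _ (g f) y _ 0 k) => //; rewrite mul0r mulrC -!rmorphXn -!rmorphM.
  by rewrite -rmorphB -rmorphM ek rmorph0.
(* The chosen value is correct for every presentation of [x], so sums and products can be checked on
   any convenient one. *)
have sol x : exists s, forall r n, l r = x * l f ^+ n -> g r = s * g f ^+ n.
  have [r [n e]] := surj x; exists (g r * y ^+ n) => r' n' e'.
  apply: (@unit_exp_cancel _ (g f) y _ _ n) => //.
  have e2 : g f ^+ n * y ^+ n = 1 by rewrite -exprMn gy expr1n.
  have -> : g r * y ^+ n * g f ^+ n' * g f ^+ n = g r * g f ^+ n' * (g f ^+ n * y ^+ n) by ring.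
  by rewrite e2 mulr1; apply: wd; rewrite e e' mulrAC.
have [h hP] := choice sol.
have lift x s r n : l r = x * l f ^+ n -> g r = s * g f ^+ n -> h x = s.
  by move=> /hP -> e; exact: unit_exp_cancel gy e.
have [F FE] : exists F : {rmorphism L -> S}, F =1 h.
  apply: make_rmorphism => [|a b|a b].
  - by apply: (lift _ _ 1 0%N); rewrite expr0 mulr1 rmorph1.
  - have [r [n e]] := surj a; have [s [m e']] := surj b.
    apply: (lift _ _ (r * f ^+ m + s * f ^+ n) (n + m)%N);
      rewrite rmorphD !rmorphM !rmorphXn exprD.
      by rewrite e e'; ring.
    by rewrite (hP _ _ _ e) (hP _ _ _ e'); ring.
  - have [r [n e]] := surj a; have [s [m e']] := surj b.
    apply: (lift _ _ (r * s) (n + m)%N); rewrite rmorphM exprD.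
      by rewrite e e'; ring.
    by rewrite (hP _ _ _ e) (hP _ _ _ e'); ring.
exists F; apply: rmorph_ext => r /=; rewrite FE.
by apply: (lift _ _ r 0%N); rewrite expr0 mulr1.
Qed.

(** * Generating the unit ideal *)

Section Span.
Variable R : ring.
Implicit Types P : R -> Prop.

(** [generates1 P] unfolds to [span P 1], so the lemmas on ideals apply to it directly. *)
Definition span P (r : R) : Prop :=
  exists s : seq (R * R), (forall c, c \in s -> P c.2) /\ \sum_(c <- s) c.1 * c.2 = r.

Lemma span0 P : span P 0.
Proof. by exists [::]; rewrite big_nil. Qed.

Lemma spanD P x y : span P x -> span P y -> span P (x + y).
Proof.
move=> [s [hs <-]] [t [ht <-]]; exists (s ++ t); rewrite big_cat; split=> // c.
by rewrite mem_cat => /orP[/hs|/ht].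
Qed.

Lemma spanMr P a x : span P x -> span P (a * x).
Proof.
move=> [s [hs <-]]; exists [seq (a * c.1, c.2) | c <- s]; split.
  by move=> _ /mapP[c /hs h ->].
by rewrite big_map mulr_sumr; apply: eq_bigr => c _; rewrite mulrA.
Qed.

Lemma span_gen P x : P x -> span P x.
Proof.
move=> h; exists [:: (1, x)]; rewrite big_seq1 mul1r; split=> // c.
by rewrite inE => /eqP ->.
Qed.

Lemma span_sum P (s : seq (R * R)) :
  (forall c, c \in s -> span P c.2) -> span P (\sum_(c <- s) c.1 * c.2).
Proof.
elim: s => [|c s IH] h; first by rewrite big_nil; exact: span0.
rewrite big_cons; apply: spanD; first by apply/spanMr/h; rewrite inE eqxx.
by apply: IH => d hd; apply: h; rewrite inE hd orbT.
Qed.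

Lemma span_sub P P' r : (forall x, P x -> span P' x) -> span P r -> span P' r.
Proof. by move=> h [s [hs <-]]; apply: span_sum => c /hs /h. Qed.

End Span.

Lemma generates1_unit (R : ring) (P : R -> Prop) x y :
  P x -> x * y = 1 -> generates1 P.
Proof. by move=> h e; rewrite /generates1 -e mulrC; apply/spanMr/span_gen. Qed.

(** * Residue fields of maximal ideals *)

Section MakeField.
Variables (Q : ring) (Q1 : 1 <> 0 :> Q) (QV : forall x : Q, x <> 0 -> exists y, y * x = 1).

(** The hypotheses are phantom arguments, which lets the structures declared on this alias of [Q]
    use them. *)
Definition field_car (_ : 1 <> 0 :> Q) (_ : forall x : Q, x <> 0 -> exists y, y * x = 1) : Type := Q.
Local Notation F := (field_car Q1 QV).
HB.instance Definition _ := GRing.ComPzRing.on F.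

Lemma field_car_neq0 : 1 != 0 :> F. Proof. exact/eqP. Qed.
HB.instance Definition _ := GRing.PzSemiRing_isNonZero.Build F field_car_neq0.

Definition field_car_inv (x : F) : F :=
  if pselect (x <> 0) is left h then sval (cid (QV h)) else x.

Lemma field_car_mulVf : {in predC1 0, left_inverse 1 field_car_inv (@GRing.mul F)}.
Proof.
move=> x /eqP x0; rewrite /field_car_inv; case: pselect => // h.
exact: (svalP (cid (QV h))).
Qed.

Lemma field_car_unitPl (x y : F) : y * x = 1 -> predC1 0 x.
Proof.
move=> e; apply/eqP => x0; move: e; rewrite x0 mulr0 => /esym /eqP.
by rewrite (negPf field_car_neq0).
Qed.

Lemma field_car_inv_out : {in [predC predC1 0], field_car_inv =1 id}.
Proof.
by move=> x; rewrite !inE negbK => /eqP x0; rewrite /field_car_inv; case: pselect.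
Qed.

HB.instance Definition _ := GRing.ComNzRing_hasMulInverse.Build F
  field_car_mulVf field_car_unitPl field_car_inv_out.

Lemma field_car_fieldP : GRing.field_axiom F. Proof. by move=> x x0; rewrite unfold_in. Qed.
HB.instance Definition _ := GRing.ComUnitRing_isField.Build F field_car_fieldP.

Definition made_field : fieldType := F.
Definition made_field_map : {rmorphism Q -> made_field} := idfun.
End MakeField.

Section ResidueField.
Variables (R : ring) (M : R -> Prop).
Hypotheses (MD : forall x y, M x -> M y -> M (x + y)) (MM : forall a x, M x -> M (a * x)).
Hypotheses (M0 : M 0) (M1 : ~ M 1) (MV : forall x, ~ M x -> exists y, M (y * x - 1)).

Definition ideal_setoid : ring_setoid.
Proof.
unshelve refine (@RingSetoid R (fun x y => M (x - y)) 0 1 +%R -%R *%R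
  _ _ _ _ _ _ _ _ _ _ _ _ _ _).
- by move=> x; rewrite subrr.
- by move=> x y /(MM (-1)); rewrite mulN1r opprB.
- by move=> y x z h h'; have := MD h h'; rewrite addrA subrK.
- by move=> x x' y h; rewrite opprD addrACA subrr addr0.
- by move=> x y /(MM (-1)); rewrite mulN1r opprD.
- by move=> x x' y /(MM y); rewrite mulrC mulrBl.
all: by move=> *; rewrite (_ : _ - _ = 0) //; ring.
Defined.

Lemma residue_field :
  exists (k : fieldType) (e : {rmorphism R -> k}), forall x, M x -> e x = 0.
Proof.
pose S := ideal_setoid.
have pi0 x : M x <-> @rpi S x = 0 by rewrite -rpi0 rpi_eq /= subr0.
have Q1 : 1 <> 0 :> rquot S by rewrite -rpi1 => /pi0.
have QV (q : rquot S) : q <> 0 -> exists r, r * q = 1.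
  elim/rquot_ind: q => x x0; have [|y hy] := @MV x; first by move=> /pi0.
  by exists (@rpi S y); rewrite -rpiM -rpi1; apply/rpi_eq.
have [e eE] : exists e : {rmorphism R -> rquot S}, e =1 @rpi S.
  by apply: make_rmorphism => // x y; [exact: (@rpiD S)|exact: (@rpiM S)].
exists (made_field Q1 QV), (rcomp (made_field_map Q1 QV) e) => x /pi0 /= <-.
exact: eE.
Qed.

End ResidueField.

(* Zorn's lemma on the sets that do not generate the unit ideal: a maximal one
   is a maximal ideal. *)
Lemma not_generates1 (R : ring) (P : R -> Prop) : ~ generates1 P ->
  exists (k : fieldType) (e : {rmorphism R -> k}), forall x, P x -> e x = 0.
Proof.
move=> nP.
have [|M [nM Mmax]] := @Zorn_bigcup R [set A | ~ generates1 (fun x => P x \/ A x)].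
  move=> F FP tF [s [hs s1]].
  (* A relation involves finitely many elements, so one member of the chain contains all those
     outside [P]; if there are none, as for the empty chain, [P] alone generates the unit ideal. *)
  have [[A FA hA]|hs0] : (exists2 A, F A & forall c, c \in s -> P c.2 \/ A c.2) \/
      (forall c, c \in s -> P c.2).
  - elim: s {s1} hs => [|c s IH] hs; first by right.
    have [|[A FA hA]|hA] := IH.
    + by move=> d hd; apply: hs; rewrite inE hd orbT.
    + have [|hc|[B FB hc]] := hs c; first by rewrite inE eqxx.
        by left; exists A => // d; rewrite inE => /orP[/eqP ->|/hA //]; left.
      have [AB|BA] := tF _ _ FA FB; left.
        exists B => // d; rewrite inE => /orP[/eqP ->|/hA[]]; [by right|by left|].
        by move=> /AB; right.
      by exists A => // d; rewrite inE => /orP[/eqP ->|/hA //]; right; exact: BA.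
    + have [|hc|[B FB hc]] := hs c; first by rewrite inE eqxx.
        by right => d; rewrite inE => /orP[/eqP ->|/hA].
      by left; exists B => // d; rewrite inE => /orP[/eqP ->|/hA]; [right|left].
  - by apply: (FP _ FA); exists s.
  - by apply: nP; exists s.
pose N x := P x \/ M x.
(* By maximality of [M]: adjoining an element of the ideal generated by [N] does not enlarge that
   ideal. *)
have sN x : span N x -> N x.
  move=> Nx; right; apply: contrapT => Mx.
  apply: (Mmax (fun y => M y \/ y = x)).
    by split=> [y|h]; [left|apply: Mx; apply: h; right].
  move=> h; apply: nM; apply: span_sub h => y [Py|[My| -> //]]; apply: span_gen.
    by left.
  by right.
have [|||||k [e he]] := @residue_field R N.
- by move=> x y hx hy; apply/sN/spanD; exact: span_gen.
- by move=> a x hx; apply/sN/spanMr; exact: span_gen.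
- exact/sN/span0.
- by move=> h; apply: nM; exact: span_gen.
- move=> x Nx.
  have : span (fun y => N y \/ y = x) 1.
    apply: contrapT => nx; apply: (Mmax (fun y => M y \/ y = x)).
      by split=> [y|h]; [left|apply: Nx; right; apply: h; right].
    move=> h; apply: nx; apply: span_sub h => y h; apply: span_gen; rewrite /N; tauto.
  move=> [s [hs <-]].
  (* The coefficients of [x] in the relation are collected into [y]; the remaining terms lie in the
     ideal generated by [N]. *)
  have {hs} : exists y, span N (y * x - \sum_(c <- s) c.1 * c.2); last first.
    by move=> [y /sN hy]; exists y.
  elim: s hs => [|c s IH] hs.
    by exists 0; rewrite big_nil mul0r subrr; exact: span0.
  have [|y hy] := IH; first by move=> d hd; apply: hs; rewrite inE hd orbT.
  have [|Nc|cx] := hs c; first by rewrite inE eqxx.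
    exists y; rewrite big_cons opprD addrCA -mulNr; apply: spanD => //.
    exact/spanMr/span_gen.
  exists (c.1 + y); rewrite big_cons cx (_ : _ - _ = y * x - \sum_(c <- s) c.1 * c.2) //.
  by ring.
by exists k, e => x Px; apply: he; left.
Qed.

(** This turns [is_open], stated through the unit ideal, into a condition at field-valued points. A
    maximal ideal gives the converse direction; a relation with sum 1 cannot vanish in a field. *)
Lemma generates1P (R : ring) (P : R -> Prop) :
  generates1 P <->
  forall (k : fieldType) (e : {rmorphism R -> k}), exists2 p, P p & e p <> 0.
Proof.
split=> [[s [hs s1]] k e|h].
  apply: contrapT => nP; have : e 1 = 0.
    rewrite -s1 rmorph_sum big_seq big1 // => c /hs Pc; rewrite rmorphM.
    have -> : e c.2 = 0 by apply: contrapT => h; apply: nP; exists c.2.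
    by rewrite mulr0.
  by rewrite rmorph1 => /eqP; rewrite oner_eq0.
apply: contrapT => /not_generates1[k [e he]].
by have [p /he] := h k e.
Qed.

(** * Pushouts of rings *)

Section Pushout.
Variables (A B A' : ring) (phi : {rmorphism A -> B}) (alpha : {rmorphism A -> A'}).

(** The tensor product of [B] and [A'] over [A], presented by ring terms: its universal property is
    then evaluation of terms, and the decomposition into pure tensors is an induction on terms. *)
Inductive po_term : Type :=
  | PoL of B
  | PoR of A'
  | PoAdd of po_term & po_term
  | PoOpp of po_term
  | PoMul of po_term & po_term.

Inductive po_rel : po_term -> po_term -> Prop :=
  | po_refl x : po_rel x x
  | po_sym x y : po_rel x y -> po_rel y x
  | po_trans y x z : po_rel x y -> po_rel y z -> po_rel x z
  | po_addl x x' y : po_rel x x' -> po_rel (PoAdd x y) (PoAdd x' y)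
  | po_opp x x' : po_rel x x' -> po_rel (PoOpp x) (PoOpp x')
  | po_mull x x' y : po_rel x x' -> po_rel (PoMul x y) (PoMul x' y)
  | po_addA x y z : po_rel (PoAdd x (PoAdd y z)) (PoAdd (PoAdd x y) z)
  | po_addC x y : po_rel (PoAdd x y) (PoAdd y x)
  | po_add0 x : po_rel (PoAdd (PoL 0) x) x
  | po_addN x : po_rel (PoAdd (PoOpp x) x) (PoL 0)
  | po_mulA x y z : po_rel (PoMul x (PoMul y z)) (PoMul (PoMul x y) z)
  | po_mulC x y : po_rel (PoMul x y) (PoMul y x)
  | po_mul1 x : po_rel (PoMul (PoL 1) x) x
  | po_mulDl x y z : po_rel (PoMul (PoAdd x y) z) (PoAdd (PoMul x z) (PoMul y z))
  | po_LD a b : po_rel (PoL (a + b)) (PoAdd (PoL a) (PoL b))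
  | po_LM a b : po_rel (PoL (a * b)) (PoMul (PoL a) (PoL b))
  | po_RD a b : po_rel (PoR (a + b)) (PoAdd (PoR a) (PoR b))
  | po_RM a b : po_rel (PoR (a * b)) (PoMul (PoR a) (PoR b))
  | po_LR a : po_rel (PoL (phi a)) (PoR (alpha a)).

Definition po_setoid : ring_setoid :=
  RingSetoid po_refl po_sym po_trans po_addl po_opp po_mull po_addA po_addC
    po_add0 po_addN po_mulA po_mulC po_mul1 po_mulDl.

Definition pushout : ring := rquot po_setoid.

Lemma poL_exists : exists g : {rmorphism B -> pushout}, g =1 fun b => @rpi po_setoid (PoL b).
Proof.
apply: make_rmorphism => // x y; [rewrite -rpiD|rewrite -rpiM]; apply/rpi_eq.
  exact: po_LD.
exact: po_LM.
Qed.

Lemma poR_exists : exists g : {rmorphism A' -> pushout}, g =1 fun b => @rpi po_setoid (PoR b).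
Proof.
apply: make_rmorphism => [|x y|x y]; [rewrite -rpi1|rewrite -rpiD|rewrite -rpiM];
  apply/rpi_eq; [|exact: po_RD|exact: po_RM].
rewrite -(rmorph1 alpha); apply: po_sym; apply: po_trans (po_LR _).
by rewrite rmorph1; exact: po_refl.
Qed.

Definition poL : {rmorphism B -> pushout} := sval (cid poL_exists).
Definition poR : {rmorphism A' -> pushout} := sval (cid poR_exists).
Lemma poLE b : poL b = @rpi po_setoid (PoL b). Proof. exact: (svalP (cid poL_exists)). Qed.
Lemma poRE b : poR b = @rpi po_setoid (PoR b). Proof. exact: (svalP (cid poR_exists)). Qed.

Lemma po_comm : rcomp poL phi = rcomp poR alpha.
Proof. by apply: rmorph_ext => a; rewrite /= poLE poRE; apply/rpi_eq/po_LR. Qed.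

(** Through this decomposition a derivation on the pushout is determined by its values at the
    products [poL b * poR a]. *)
Lemma po_gen (q : pushout) :
  exists s : seq (B * A'), q = \sum_(c <- s) poL c.1 * poR c.2.
Proof.
elim/rquot_ind: q; elim=> [b|a|x [s IHs] y [t IHt]|x [s IHs]|x [s IHs] y [t IHt]].
- by exists [:: (b, 1)]; rewrite big_seq1 rmorph1 mulr1 poLE.
- by exists [:: (1, a)]; rewrite big_seq1 rmorph1 mul1r poRE.
- by exists (s ++ t); rewrite big_cat /= -IHs -IHt; exact: (@rpiD po_setoid).
- exists [seq (- c.1, c.2) | c <- s]; rewrite big_map.
  rewrite [LHS](@rpiN po_setoid) IHs -sumrN; apply: eq_bigr => c _.
  by rewrite rmorphN mulNr.
- exists [seq (c.1 * d.1, c.2 * d.2) | c <- s, d <- t].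
  rewrite [LHS](@rpiM po_setoid) IHs IHt mulr_suml big_allpairs_dep.
  apply: eq_bigr => c _; rewrite mulr_sumr; apply: eq_bigr => d _ /=.
  by rewrite !rmorphM mulrACA.
Qed.

Lemma po_ext (R : ring) (h k : {rmorphism pushout -> R}) :
  (forall b, h (poL b) = k (poL b)) -> (forall a, h (poR a) = k (poR a)) -> h = k.
Proof.
move=> hL hR; apply: rmorph_ext => q; have [s ->] := po_gen q.
by rewrite !rmorph_sum; apply: eq_bigr => c _; rewrite !rmorphM hL hR.
Qed.

Lemma po_lift (R : ring) (f : {rmorphism B -> R}) (g : {rmorphism A' -> R}) :
  rcomp f phi = rcomp g alpha ->
  exists h : {rmorphism pushout -> R}, rcomp h poL = f /\ rcomp h poR = g.
Proof.
move=> efg.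
pose ev := fix ev (t : po_term) : R := match t with
  | PoL b => f b | PoR a => g a | PoAdd x y => ev x + ev y
  | PoOpp x => - ev x | PoMul x y => ev x * ev y end.
have evP x y : po_rel x y -> ev x = ev y.
  elim=> //= {x y}; try by move=> *; ring.
  - by move=> y x z _ -> _ ->.
  - by move=> x x' y _ ->.
  - by move=> x x' _ ->.
  - by move=> x x' y _ ->.
  - by move=> a; have := congr1 (fun m : {rmorphism A -> R} => m a) efg.
pose h (q : pushout) : R := ev (repr q).
have hE t : h (@rpi po_setoid t) = ev t by apply: evP; exact: (@rpiK po_setoid).
have [H HE] : exists H : {rmorphism pushout -> R}, H =1 h.
  apply: make_rmorphism.
  - by rewrite -rpi1 hE /= rmorph1.
  - by elim/rquot_ind=> x; elim/rquot_ind=> y; rewrite -rpiD !hE.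
  - by elim/rquot_ind=> x; elim/rquot_ind=> y; rewrite -rpiM !hE.
by exists H; split; apply: rmorph_ext => b; rewrite /= HE ?poLE ?poRE hE.
Qed.

End Pushout.

(** * Affine schemes and open subfunctors *)

Lemma generates1_exp (R : ring) n (f : 'I_n -> R) (N : 'I_n -> nat) :
  generates1 (fun r => exists i, r = f i) ->
  generates1 (fun r => exists i, r = f i ^+ N i).
Proof.
move=> /generates1P h; apply/generates1P => k e; have [_ [i ->] /eqP ei] := h k e.
exists (f i ^+ N i); first by exists i.
by rewrite rmorphXn; apply/eqP; rewrite expf_neq0.
Qed.

(** * The sheaf property of the structure ring *)

Section GlueElements.
Variables (R : ring) (n : nat) (f : 'I_n -> R).
Hypothesis f1 : generates1 (fun r => exists i, r = f i).
Variables (L : 'I_n -> ring) (l : forall i, {rmorphism R -> L i}).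
Hypothesis lf : forall i, is_localization (l i) (f i).

Lemma localizations_ext y y' : (forall i, l i y = l i y') -> y = y'.
Proof.
move=> e; have ker i : exists m, f i ^+ m * (y - y') = 0.
  by have [_ _] := lf i; apply; rewrite rmorphB e subrr.
have [N hN] := choice ker; have [s [hs s1]] := generates1_exp N f1.
apply/eqP; rewrite -subr_eq0 -[y - y']mul1r -s1 mulr_suml big_seq big1 // => c /hs[i ->].
by rewrite -mulrA hN mulr0.
Qed.

Variables (LL : 'I_n -> 'I_n -> ring) (ll : forall i j, {rmorphism R -> LL i j}).
Variables (a : forall i j, {rmorphism L i -> LL i j}) (b : forall i j, {rmorphism L j -> LL i j}).
Hypothesis llf : forall i j, is_localization (ll i j) (f i * f j).
Hypothesis al : forall i j, rcomp (a i j) (l i) = ll i j.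
Hypothesis bl : forall i j, rcomp (b i j) (l j) = ll i j.

Lemma localizations_glue (x : forall i, L i) :
  (forall i j, a i j (x i) = b i j (x j)) -> exists y, forall i, l i y = x i.
Proof.
move=> xx.
have num i : exists rn : R * nat, l i rn.1 = x i * l i (f i) ^+ rn.2.
  by have [_ /(_ (x i))[r [m e]] _] := lf i; exists (r, m).
have [rn rnE] := choice num.
pose N := (\max_i (rn i).2)%N.
have [r rE] : exists r : 'I_n -> R, forall i, l i (r i) = x i * l i (f i) ^+ N.
  exists (fun i => (rn i).1 * f i ^+ (N - (rn i).2)) => i.
  rewrite rmorphM rnE rmorphXn -mulrA -exprD addnC subnK //.
  exact: (leq_bigmax_cond (F := fun i => (rn i).2)).
have alE i j z : a i j (l i z) = ll i j z by rewrite -al.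
have blE i j z : b i j (l j z) = ll i j z by rewrite -bl.
have ker (ij : 'I_n * 'I_n) : exists m,
    (f ij.1 * f ij.2) ^+ m * (r ij.1 * f ij.2 ^+ N - r ij.2 * f ij.1 ^+ N) = 0.
  case: ij => i j /=; have [_ _] := llf i j; apply.
  rewrite rmorphB !rmorphM !rmorphXn -alE -[ll i j (r j)]blE !rE !rmorphM !rmorphXn xx.
  by rewrite alE blE mulrAC subrr.
have [k kE] := choice ker.
(* Enlarging the fractions to numerators [f i ^+ K * r i] over [f i ^+ (N + K)] makes the
   cross-multiplied equalities hold in [R] itself. *)
pose K := (\max_ij k ij)%N.
have {}kE i j : f i ^+ K * r i * f j ^+ (N + K) = f j ^+ K * r j * f i ^+ (N + K).
  apply/eqP; rewrite -subr_eq0; apply/eqP.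
  have kK : (k (i, j) <= K)%N by exact: (leq_bigmax_cond (F := k)).
  rewrite !exprD.
  have -> : f i ^+ K * r i * (f j ^+ N * f j ^+ K) - f j ^+ K * r j * (f i ^+ N * f i ^+ K) =
    (f i * f j) ^+ K * (r i * f j ^+ N - r j * f i ^+ N) by rewrite exprMn; ring.
  by rewrite -(subnK kK) exprD -mulrA (kE (i, j)) mulr0.
(* The glued element is the sum of the numerators weighted by a relation expressing 1 through the
   [f i ^+ (N + K)]; [good] is the invariant along its partial sums [p]. *)
pose good p y := forall j, f j ^+ (N + K) * y = f j ^+ K * r j * p.
have [s [hs s1]] := generates1_exp (fun _ => (N + K)%N) f1.
have [y yE] : exists y, good 1 y.
  rewrite -s1; elim: s {s1} hs => [|c s IH] hs.
    by exists 0 => j; rewrite big_nil !mulr0.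
  have [|y hy] := IH; first by move=> d hd; apply: hs; rewrite inE hd orbT.
  have [|i ci] := hs c; first by rewrite inE eqxx.
  exists (c.1 * (f i ^+ K * r i) + y) => j; rewrite big_cons ci mulrDr hy mulrDr.
  congr (_ + _); transitivity (c.1 * (f i ^+ K * r i * f j ^+ (N + K))); first by ring.
  by rewrite kE; ring.
exists y => j; have [[u fu] _ _] := lf j.
apply: (@unit_exp_cancel _ _ _ _ _ (N + K) fu).
rewrite mulrC -rmorphXn -rmorphM yE mulr1 rmorphM rE !rmorphXn exprD; ring.
Qed.

End GlueElements.

Lemma Spec_sheaf (A : ring) : zariski_sheaf (Spec A).
Proof.
move=> R n f f1 L l LL ll a b lf llf al bl x xx.
have glue c : exists y, forall i, l i y = x i c.
  apply: (localizations_glue f1 lf llf al bl) => i j.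
  exact: (congr1 (fun m : {rmorphism A -> _} => m c) (xx i j)).
have [y yE] := choice glue.
have [Y YE] : exists Y : {rmorphism A -> R}, Y =1 y.
  apply: make_rmorphism => [|c d|c d]; apply: (localizations_ext f1 lf) => i;
    by rewrite ?rmorphD ?rmorphM !yE ?rmorphD ?rmorphM ?rmorph1.
exists Y; split=> [i|Z ZE]; first by apply: rmorph_ext => c; rewrite /= YE yE.
apply: rmorph_ext => c; apply: (localizations_ext f1 lf) => i.
by rewrite YE yE -ZE.
Qed.

Lemma open_immersion_id (X : zfunctor) : open_immersion (mid X).
Proof.
split=> // R x; exists (fun r => r = 1) => R' f; split=> [_|_]; last by exists (zmap X f x).
by apply: (@generates1_unit _ _ 1 1); [exists 1; rewrite ?rmorph1|rewrite mulr1].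
Qed.

(** Pullbacks in [sch] are tested against schemes only. Knowing that Spec R is one makes their
    universal property available for R-valued points. *)
Lemma Spec_is_scheme (A : ring) : is_scheme (Spec A).
Proof.
split; first exact: Spec_sheaf.
exists unit, (fun _ => A), (fun _ => mid (Spec A)); split=> [_|k x].
  exact: open_immersion_id.
by exists tt, x.
Qed.

Definition SpecS (A : ring) : scheme := Scheme (Spec_is_scheme A).

Lemma zmap_comp (X : zfunctor) (R R' R'' : ring) (g : {rmorphism R' -> R''})
    (f : {rmorphism R -> R'}) (h : {rmorphism R -> R''}) (x : X R) :
  rcomp g f = h -> zmap X g (zmap X f x) = zmap X h x.
Proof. by move=> <-; rewrite zmapM. Qed.

Lemma loc_factor (R S : ring) (r : R) (e : {rmorphism R -> S}) y :
  e r * y = 1 -> exists e' : {rmorphism loc r -> S}, rcomp e' (locm r) = e.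
Proof. exact: localization_lift (locP r). Qed.

Lemma loc_factor_field (R : ring) (k : fieldType) (r : R) (e : {rmorphism R -> k}) :
  e r <> 0 -> exists e' : {rmorphism loc r -> k}, rcomp e' (locm r) = e.
Proof. by move=> /eqP er; apply: (@loc_factor _ _ _ _ (e r)^-1); rewrite divff. Qed.

Lemma locm_unit (R : ring) (r : R) : exists y, locm r r * y = 1.
Proof. by have [] := locP r. Qed.

(** Writing q = q' / r^n, inverting [r * q'] inverts both [r] and [q]. The second clause keeps a
    given field-valued point inside the smaller open. *)
Lemma loc_loc (R : ring) (r : R) (q : loc r) : exists q' : R,
  (exists m : {rmorphism loc q -> loc (r * q')},
     rcomp m (rcomp (locm q) (locm r)) = locm (r * q')) /\
  forall (k : fieldType) (e : {rmorphism loc r -> k}),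
    e q <> 0 -> e (locm r (r * q')) <> 0.
Proof.
have [_ /(_ q)[q' [n qE]] _] := locP r; exists q'; split.
  have [z zE] := locm_unit (r * q'); rewrite rmorphM in zE.
  have [|h hE] := @loc_factor R _ r (locm (r * q')) (locm (r * q') q' * z).
    by rewrite mulrA.
  have hrE x : h (locm r x) = locm (r * q') x by rewrite -hE.
  have [|m mE] := @loc_factor _ _ q h (locm (r * q') r ^+ n * (locm (r * q') r * z)).
    by rewrite mulrA -{1}hrE -rmorphXn -rmorphM -qE hrE -zE; ring.
  exists m; apply: rmorph_ext => x; rewrite /= -hrE -mE //.
move=> k e /eqP eq; have [y yE] := locm_unit r.
have er : e (locm r r) != 0.
  apply/eqP => e0; have := congr1 e yE; rewrite rmorphM e0 mul0r rmorph1 => /esym/eqP.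
  by rewrite oner_eq0.
by apply/eqP; rewrite rmorphM qE !rmorphM rmorphXn !mulf_neq0 // expf_neq0.
Qed.

(** By [generates1P] the elements over which the two sections agree generate the unit ideal; a
    finite relation among them gives a cover, and uniqueness of gluing applies. *)
Lemma sheaf_ext (X : zfunctor) (R : ring) (y1 y2 : X R) : zariski_sheaf X ->
  (forall (k : fieldType) (e : {rmorphism R -> k}), exists2 r,
     e r <> 0 & zmap X (locm r) y1 = zmap X (locm r) y2) -> y1 = y2.
Proof.
move=> shX h.
have [s [hs s1]] : generates1 (fun r => zmap X (locm r) y1 = zmap X (locm r) y2).
  by apply/generates1P => k e; have [r er rE] := h k e; exists r.
pose f (i : 'I_(size s)) := (tnth (in_tuple s) i).2.
have f1 : generates1 (fun r => exists i, r = f i).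
  exists s; split=> // c cs; have /tnthP[i ci] : c \in in_tuple s by [].
  by exists i; rewrite ci.
have fE i : zmap X (locm (f i)) y1 = zmap X (locm (f i)) y2.
  by apply: hs; rewrite /f mem_tnth.
have aP i j : exists a : {rmorphism loc (f i) -> loc (f i * f j)},
    rcomp a (locm (f i)) = locm (f i * f j).
  have [z zE] := locm_unit (f i * f j).
  by apply: (@loc_factor _ _ _ _ (locm (f i * f j) (f j) * z)); rewrite -zE rmorphM mulrA.
have bP i j : exists b : {rmorphism loc (f j) -> loc (f i * f j)},
    rcomp b (locm (f j)) = locm (f i * f j).
  have [z zE] := locm_unit (f i * f j).
  apply: (@loc_factor _ _ _ _ (locm (f i * f j) (f i) * z)); rewrite -zE rmorphM.
  by rewrite mulrA [locm _ (f j) * _]mulrC.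
have [|y [_ yU]] := @shX R _ f f1 _ (fun i => locm (f i)) _ (fun i j => locm (f i * f j))
  (fun i j => sval (cid (aP i j))) (fun i j => sval (cid (bP i j)))
  (fun i => locP _) (fun i j => locP _) (fun i j => svalP (cid (aP i j)))
  (fun i j => svalP (cid (bP i j))) (fun i => zmap X (locm (f i)) y1).
  by move=> i j; rewrite (zmap_comp _ (svalP (cid (aP i j)))) (zmap_comp _ (svalP (cid (bP i j)))).
by rewrite -(yU y1) // -(yU y2).
Qed.

(** * Openness tested at field-valued points *)

Section Opens.
Variables (X : zfunctor) (U : forall R : ring, X R -> Prop).

Lemma open_local : is_open U -> forall (R : ring) (x : X R),
  (forall (k : fieldType) (e : {rmorphism R -> k}), exists2 r,
     e r <> 0 & U (zmap X (locm r) x)) -> U x.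
Proof.
move=> oU R x h; have [P hP] := oU R x; rewrite -(zmap1 x); apply/hP/generates1P => k e.
have [r er /hP/generates1P Ur] := h k e; have [e' e'E] := loc_factor_field er.
have [_ [p Pp ->] ep] := Ur k e'; exists p; first by exists p.
by rewrite -e'E.
Qed.

Lemma open_nbhd : is_open U -> forall (R : ring) (x : X R) (k : fieldType)
  (e : {rmorphism R -> k}), U (zmap X e x) -> exists2 r, e r <> 0 & U (zmap X (locm r) x).
Proof.
move=> oU R x k e; have [P hP] := oU R x => /hP /generates1P /(_ k idfun)[_ [p Pp ->] ep].
exists p => //; apply/hP; have [y yE] := locm_unit p.
by apply: (generates1_unit _ yE); exists p.
Qed.

(** Converse to [open_local] and [open_nbhd], for subfunctors with no explicit ideal at hand: the
    elements [r] over whose localization [x] enters [U] serve as equations of the complement. *)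
Lemma openI :
  (forall (R R' : ring) (f : {rmorphism R -> R'}) x, U x -> U (zmap X f x)) ->
  (forall (R : ring) (x : X R), (forall (k : fieldType) (e : {rmorphism R -> k}),
     exists2 r, e r <> 0 & U (zmap X (locm r) x)) -> U x) ->
  (forall (R : ring) (x : X R) (k : fieldType) (e : {rmorphism R -> k}),
     U (zmap X e x) -> exists2 r, e r <> 0 & U (zmap X (locm r) x)) ->
  is_open U.
Proof.
move=> st lo nb R x; exists (fun r => U (zmap X (locm r) x)) => R' f; split.
  move=> Ux; apply/generates1P => k e.
  have [|r er Ur] := nb R x k (rcomp e f); first by rewrite zmapM; exact: st.
  by exists (f r) => //; exists r.
move=> /generates1P h; apply: lo => k e; have [_ [r Ur ->] er] := h k e.
exists (f r) => //; have [y yE] := locm_unit (f r).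
have [g gE] := @loc_factor R _ r (rcomp (locm (f r)) f) y yE.
by rewrite (zmap_comp _ (erefl (rcomp (locm (f r)) f))) -gE zmapM; exact: st.
Qed.

End Opens.

Lemma open_preimage (X Y : zfunctor) (f : mor X Y) (U : forall R : ring, Y R -> Prop) :
  is_open U -> is_open (fun R (x : X R) => U R (f R x)).
Proof.
move=> oU R x; have [P hP] := oU R (f R x); exists P => R' g; rewrite -hP.
by rewrite mnat.
Qed.

Lemma open_inter (X : zfunctor) (U V : forall R : ring, X R -> Prop) :
  is_open U -> is_open V -> is_open (fun R x => U R x /\ V R x).
Proof.
move=> oU oV R x; have [P hP] := oU R x; have [Q hQ] := oV R x.
exists (fun r => exists p q, [/\ P p, Q q & r = p * q]) => R' f.
rewrite hP hQ; split.
  move=> [/generates1P gP /generates1P gQ]; apply/generates1P => k e.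
  have [_ [p Pp ->] /eqP ep] := gP k e; have [_ [q Qq ->] /eqP eq] := gQ k e.
  exists (f (p * q)); first by exists (p * q) => //; exists p, q.
  by apply/eqP; rewrite !rmorphM mulf_neq0.
move=> /generates1P g; split; apply/generates1P => k e;
  have [_ [_ [p [q [Pp Qq ->]]] ->] epq] := g k e.
  exists (f p) => [|ep]; first by exists p.
  by apply: epq; rewrite !rmorphM ep mul0r.
exists (f q) => [|eq]; first by exists q.
by apply: epq; rewrite !rmorphM eq mulr0.
Qed.

Definition image (X Y : zfunctor) (i : mor X Y) : forall R : ring, Y R -> Prop :=
  fun R y => exists x, i R x = y.

(** Each morphism from [R] to a field sends an R-valued point to some [x], and the open at [x]
    contains the restriction of the point to a localization of [R]; [sheaf_ext] concludes. *)
Lemma mor_eq_local (X Y : zfunctor) (f g : mor X Y) : zariski_sheaf Y ->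
  (forall (k : fieldType) (x : X k), exists U : forall R : ring, X R -> Prop,
     [/\ is_open U, U k x & forall R (y : X R), U R y -> f R y = g R y]) ->
  f = g.
Proof.
move=> shY h; apply: mor_ext => R x; apply: (sheaf_ext shY) => k e.
have [U [oU Ux UE]] := h k (zmap X e x); have [r er Ur] := open_nbhd oU Ux.
by exists r => //; rewrite -!mnat UE.
Qed.

Lemma open_immersion_comp (X Y Z : zfunctor) (g : mor Y Z) (f : mor X Y) :
  open_immersion g -> open_immersion f -> open_immersion (mcomp g f).
Proof.
move=> [mg og] [mf of_]; split; first by move=> R x y /mg /mf.
apply: openI.
- by move=> R R' h z [x <-]; exists (zmap X h x); rewrite mnat.
- move=> R z h.
  have [y yE] : image g z.
    by apply: (open_local og) => k e; have [r er [x xE]] := h k e; exists r => //; exists (f _ x).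
  have [x xE] : image f y.
    apply: (open_local of_) => k e; have [r er [x xE]] := h k e; exists r => //; exists x.
    by apply: mg; rewrite mnat yE.
  by exists x; rewrite /= xE.
- move=> R z k e [x xE].
  have [r er [y yE]] : exists2 r, e r <> 0 & image g (zmap Z (locm r) z).
    by apply: (open_nbhd og); exists (f k x).
  have [e' e'E] := loc_factor_field er.
  (* The lift [y] along [g] exists only over [loc r], so the neighbourhood for [f] is found there
     and [loc_loc] brings it back to a localization of [R]. *)
  have [q eq [w wE]] : exists2 q, e' q <> 0 & image f (zmap Y (locm q) y).
    apply: (open_nbhd of_); exists x; apply: mg.
    by rewrite mnat yE (zmap_comp _ e'E).
  have [q' [[m mE] /(_ k e' eq) ne]] := loc_loc q.
  exists (r * q').
    by rewrite -e'E.
  exists (zmap X m w); rewrite /= !mnat wE mnat yE -!zmapM -mE; congr (zmap Z _ _).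
  exact: rmorph_ext.
Qed.

Lemma open_immersion_loc (R : ring) (r : R) : open_immersion (Spec_map (locm r)).
Proof.
split.
  move=> S x y e; apply: (localization_ext (locP r)) => z.
  exact: (congr1 (fun m : {rmorphism R -> S} => m z) e).
move=> S x; exists (fun s => s = x r) => S' f; split.
  move=> [y yE]; have [z zE] := locm_unit r.
  apply: (@generates1_unit _ _ (f (x r)) (y z)); first by exists (x r).
  have -> : f (x r) = y (locm r r) by have := congr1 (fun m : {rmorphism R -> S'} => m r) yE.
  by rewrite -rmorphM zE rmorph1.
move=> [s [hs s1]].
have [|y yE] := @loc_factor R S' r (rcomp f x) (\sum_(c <- s) c.1).
  rewrite -s1 mulr_sumr !big_seq; apply: eq_bigr => c /hs[_ -> ->].
  by rewrite mulrC.
by exists y.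
Qed.

(** Yoneda: equality of morphisms out of an affine scheme reduces to their values at the universal
    point [rid A]. *)
Lemma point_morE (X : zfunctor) (A : ring) (m : mor (Spec A) X) :
  m = point_mor (m A (rid A)).
Proof.
by apply: mor_ext => R x; rewrite /= -mnat; congr (m _ _); apply: rmorph_ext.
Qed.

(* Start from any affine open of [X] at [x] and invert a function at which the
   image of its universal point lies in the open [j]. *)
Lemma chart_near (X : scheme) (Y : zfunctor) (f : mor X Y) (A : ring) (j : mor (Spec A) Y)
    (k : fieldType) (x : X k) :
  open_immersion j -> image j (f k x) ->
  exists (B : ring) (i : mor (Spec B) X) (phi : {rmorphism A -> B}),
    [/\ open_immersion i, mcomp f i = mcomp j (Spec_map phi) & image i x].
Proof.
move=> oj [z zE].
have [_ [I [B [u [ou uc]]]]] := schemeP X; have [i [y yE]] := uc k x.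
pose t := f _ (u i _ (rid (B i))).
have tE : zmap Y y t = f k x.
  rewrite /t -!mnat -yE; congr (f _ (u i _ _)); exact: rmorph_ext.
have [|r yr [phi phiE]] := @open_nbhd _ _ oj.2 _ t k y; first by exists z; rewrite zE.
exists (loc r), (mcomp (u i) (Spec_map (locm r))), phi; split.
- by apply: open_immersion_comp; [exact: ou|exact: open_immersion_loc].
- rewrite [LHS]point_morE [RHS]point_morE; congr point_mor; rewrite /=.
  have -> : rcomp (rid (loc r)) phi = zmap (Spec A) (rid (loc r)) phi by [].
  rewrite zmap1 phiE /t -!mnat; congr (f _ (u i _ _)); exact: rmorph_ext.
- have [y' y'E] := loc_factor_field yr; exists y'; rewrite /= -yE; congr (u i _ _).
  exact: y'E.
Qed.

Section PullbackPoints.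
Variables (X Y Z : scheme) (f : mor X Z) (g : mor Y Z) (P : @pullback sch X Y Z f g).
Local Notation Ps := (pbo P : scheme).
Local Notation p1 := (pb1 P : mor Ps X).
Local Notation p2 := (pb2 P : mor Ps Y).

Lemma pb_pointsE R (z : Ps R) : f R (p1 R z) = g R (p2 R z).
Proof. exact: (congr1 (fun m : mor Ps Z => m R z) (pbE P)). Qed.

Lemma pb_points_ext R (z z' : Ps R) :
  p1 R z = p1 R z' -> p2 R z = p2 R z' -> z = z'.
Proof.
move=> e1 e2.
have e : (point_mor z : @hom sch (SpecS R) P) = (point_mor z' : @hom sch (SpecS R) P).
  apply: (@pb_ext sch _ _ _ _ _ P (SpecS R)); apply: mor_ext => S h /=.
    by rewrite !mnat e1.
  by rewrite !mnat e2.
by have := congr1 (fun m : mor (Spec R) Ps => m R (rid R)) e; rewrite /= !zmap1.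
Qed.

End PullbackPoints.

(** * Derivations and morphisms out of Sym Omega *)

Section SymOmegaTheory.
Variables (A B : ring) (phi : {rmorphism A -> B}).

Lemma sdD a b : sd phi (a + b) = sd phi a + sd phi b.
Proof.
rewrite [RHS]/GRing.add /= sy_addE /sd /sy_gen; apply: sy_piP.
apply: sy_trans (sy_genD _ _); rewrite [dOmega phi a + _]/GRing.add /= om_addE.
by rewrite /dOmega (om_piP (om_dD phi a b)); apply: sy_refl.
Qed.

Lemma sd0 : sd phi 0 = 0.
Proof. by apply: (addIr (sd phi 0)); rewrite -sdD !add0r. Qed.

Lemma sdN a : sd phi (- a) = - sd phi a.
Proof. by apply: (addIr (sd phi a)); rewrite -sdD !addNr sd0. Qed.

Lemma sd_sum (I : Type) (s : seq I) (F : I -> B) :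
  sd phi (\sum_(i <- s) F i) = \sum_(i <- s) sd phi (F i).
Proof. by elim: s => [|i s IH]; rewrite ?big_nil ?big_cons ?sd0 ?sdD ?IH. Qed.

Lemma sy_genDE (m n : Omega phi) : sy_gen (m + n) = sy_gen m + sy_gen n.
Proof. by rewrite [RHS]/GRing.add /= sy_addE; apply/sy_piP/sy_genD. Qed.

Lemma sy_genZE b (m : Omega phi) : sy_gen (b *: m) = sb phi b * sy_gen m.
Proof. by rewrite [RHS]/GRing.mul /= sy_mulE; apply/sy_piP/sy_genZ. Qed.

Lemma sdM a b : sd phi (a * b) = sb phi a * sd phi b + sb phi b * sd phi a.
Proof.
rewrite -!sy_genZE -sy_genDE /sd; congr sy_gen.
rewrite [RHS]/GRing.add /= /GRing.scale /= /dOmega !om_scaleE om_addE.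
exact/om_piP/om_dM.
Qed.

(** The differentials span [Omega] over [B], so [sb] and [sd] together generate the ring. *)
Lemma SymOmega_ind (P : SymOmega phi -> Prop) :
  (forall b, P (sb phi b)) -> (forall b, P (sd phi b)) ->
  (forall x y, P x -> P y -> P (x + y)) -> (forall x, P x -> P (- x)) ->
  (forall x y, P x -> P y -> P (x * y)) -> forall x, P x.
Proof.
move=> Pb Pd PD PN PM.
have Pg (m : Omega phi) : P (sy_gen m).
  elim/om_ind: m; elim=> [b||x Px y Py|x Px|b x Px].
  - exact: Pd.
  - have -> : om_pi phi (OmZero _) = 0 by [].
    have -> : sy_gen (0 : Omega phi) = sb phi 0 by rewrite -(scale0r 0) sy_genZE rmorph0 mul0r.
    exact: Pb.
  - by rewrite -om_addE [sy_gen _](sy_genDE (om_pi phi x)); exact: PD.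
  - rewrite -om_oppE.
    have -> : om_opp_q (om_pi phi x) = (-1) *: om_pi phi x by rewrite scaleN1r.
    by rewrite sy_genZE; apply: PM.
  - by rewrite -om_scaleE [sy_gen _](sy_genZE _ (om_pi phi x)); exact: PM.
elim/sy_ind; elim=> [b|m|x Px y Py|x Px|x Px y Py].
- exact: Pb.
- exact: Pg.
- by rewrite -sy_addE; exact: PD.
- by rewrite -sy_oppE; exact: PN.
- by rewrite -sy_mulE; exact: PM.
Qed.

(** The map from the tensor product of [B0] and [A] to [B] is onto. The products that occur are
    those at which [gT_chart] prescribes differentials. *)
Definition generated_over (B0 : ring) (beta : {rmorphism B0 -> B}) : Prop :=
  forall b, exists s : seq (B0 * A), b = \sum_(c <- s) beta c.1 * phi c.2.

Lemma generated_over_id : generated_over (rid B).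
Proof. by move=> b; exists [:: (b, 1)]; rewrite big_seq1 rmorph1 mulr1. Qed.

(** Stated for additive maps because [SymOmega2_ext] applies it to the composite of a ring morphism
    with the derivation [wd]. *)
Lemma generated_sd_ext (B0 M : ring) (beta : {rmorphism B0 -> B}) (w1 w2 : SymOmega phi -> M) :
  generated_over beta -> (forall x y, w1 (x + y) = w1 x + w1 y) -> w1 0 = 0 ->
  (forall x y, w2 (x + y) = w2 x + w2 y) -> w2 0 = 0 ->
  (forall b a, w1 (sd phi (beta b * phi a)) = w2 (sd phi (beta b * phi a))) ->
  forall b, w1 (sd phi b) = w2 (sd phi b).
Proof.
move=> gen w1D w10 w2D w20 e b; have [s ->] := gen b; rewrite sd_sum.
elim: s => [|c s IH]; rewrite ?big_nil ?w10 ?w20 // !big_cons w1D w2D e; congr (_ + _).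
exact: IH.
Qed.

Lemma SymOmega_ext (R B0 : ring) (beta : {rmorphism B0 -> B})
    (w1 w2 : {rmorphism SymOmega phi -> R}) : generated_over beta ->
  (forall b, w1 (sb phi b) = w2 (sb phi b)) ->
  (forall b a, w1 (sd phi (beta b * phi a)) = w2 (sd phi (beta b * phi a))) -> w1 = w2.
Proof.
move=> gen eb ed; apply: rmorph_ext; elim/SymOmega_ind => //.
- by apply: (generated_sd_ext gen) => [x y||x y||//]; rewrite ?rmorphD ?rmorph0.
- by move=> x y ex ey; rewrite !rmorphD ex ey.
- by move=> x ex; rewrite !rmorphN ex.
- by move=> x y ex ey; rewrite !rmorphM ex ey.
Qed.

(* [cphi (tchart k c)] unfolds to [phi2 (cphi c)]. *)
Definition phi2 : {rmorphism A -> SymOmega phi} := rcomp (sb phi) phi.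

End SymOmegaTheory.

Lemma SymOmega2_ext (A B R B0 : ring) (phi : {rmorphism A -> B}) (beta : {rmorphism B0 -> B})
    (w1 w2 : {rmorphism SymOmega (phi2 phi) -> R}) : generated_over phi beta ->
  let vb := sb phi in let vd := sd phi in
  let wb := sb (phi2 phi) in let wd := sd (phi2 phi) in
  (forall b, w1 (wb (vb b)) = w2 (wb (vb b))) ->
  (forall b a, w1 (wb (vd (beta b * phi a))) = w2 (wb (vd (beta b * phi a)))) ->
  (forall b a, w1 (wd (vb (beta b * phi a))) = w2 (wd (vb (beta b * phi a)))) ->
  (forall b a, w1 (wd (vd (beta b * phi a))) = w2 (wd (vd (beta b * phi a)))) ->
  w1 = w2.
Proof.
move=> gen vb vd wb wd ebb ebd edb edd.
have eb x : w1 (wb x) = w2 (wb x).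
  have := @SymOmega_ext _ _ phi R B0 beta (rcomp w1 wb) (rcomp w2 wb) gen ebb ebd.
  by move=> /(congr1 (fun m : {rmorphism SymOmega phi -> R} => m x)).
apply: (SymOmega_ext (generated_over_id _)) => // x a.
rewrite /= sdM !rmorphD !rmorphM -/wb !eb.
(* Since [wd] is a derivation and both morphisms agree on [wb], agreement on [wd x] passes from the
   generators of the inner ring to sums and products. *)
suff {x} ed x : w1 (wd x) = w2 (wd x) by rewrite !ed.
elim/SymOmega_ind: x => [b|b|x y ex ey|x ex|x y ex ey].
- have [s ->] := gen b; rewrite /wd rmorph_sum sd_sum !rmorph_sum.
  by apply: eq_bigr => c _; exact: edb.
- apply: (generated_sd_ext (w1 := fun y => w1 (wd y)) (w2 := fun y => w2 (wd y)) gen) => //.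
  + by move=> x y; rewrite /wd sdD rmorphD.
  + by rewrite /wd sd0 rmorph0.
  + by move=> x y; rewrite /wd sdD rmorphD.
  + by rewrite /wd sd0 rmorph0.
- by rewrite /wd sdD !rmorphD -/wd ex ey.
- by rewrite /wd sdN !rmorphN -/wd ex.
- by rewrite /wd sdM !rmorphD !rmorphM -/wd -/wb !eb ex ey.
Qed.

(** * Charts of a base change *)

Lemma mor_pt (X Y : zfunctor) (f g : mor X Y) : f = g -> forall R (x : X R), f R x = g R x.
Proof. by move=> ->. Qed.

Lemma open_ext (X : zfunctor) (U V : forall R : ring, X R -> Prop) :
  (forall R (x : X R), U R x <-> V R x) -> is_open U -> is_open V.
Proof.
by move=> e oU R x; have [P hP] := oU R x; exists P => R' f; rewrite -hP -e.
Qed.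

Section BaseChangeChart.
Variables (pb : cleavage sch) (V W : scheme) (g : mor V W) (Z : Sch_over W).
Local Notation gZ := (@bch sch pb V W g Z).
Local Notation gfst Y := (@bch_fst sch pb V W g Y : mor (szfun (@bch sch pb V W g Y)) (szfun Y)).

Lemma bch_points_ext R (x y : szfun gZ R) :
  gfst Z R x = gfst Z R y -> sstr gZ R x = sstr gZ R y -> x = y.
Proof. exact: (@pb_points_ext _ _ _ _ _ (pb (sl_map Z) g)). Qed.

(** The first three conditions are hypotheses of [gT_chart]; [ad_gen] makes the prescribed values
    determine a point; [ad_point] says that [c'] fills the whole part of [g^* Z] lying over [c] and
    over the base chart of [c']. *)
Record adapted (c : chart (sstr Z)) (c' : chart (sstr gZ))
    (alpha : {rmorphism cA c -> cA c'}) (beta : {rmorphism cB c -> cB c'}) : Prop := Adapted {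
  ad_phi : rcomp beta (cphi c) = rcomp (cphi c') alpha;
  ad_i : mcomp (gfst Z) (ci c') = mcomp (ci c) (Spec_map beta);
  ad_j : mcomp g (cj c') = mcomp (cj c) (Spec_map alpha);
  ad_gen : generated_over (cphi c') beta;
  ad_point : forall R (x : szfun gZ R) (y : Spec (cB c) R) (y' : Spec (cA c') R),
    gfst Z R x = ci c R y -> sstr gZ R x = cj c' R y' -> image (ci c') x }.

Variables (c : chart (sstr Z)) (A' : ring) (j' : mor (Spec A') V) (oj' : open_immersion j').
Variables (alpha : {rmorphism cA c -> A'}) (sq : mcomp g j' = mcomp (cj c) (Spec_map alpha)).

Local Notation B' := (pushout (cphi c) alpha).
Local Notation pL := (poL (cphi c) alpha).
Local Notation pR := (poR (cphi c) alpha).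

Lemma bc_proof : @compc sch (SpecS B') _ _ (sl_map Z) (mcomp (ci c) (Spec_map pL)) =
  @compc sch (SpecS B') _ _ g (mcomp j' (Spec_map pR)).
Proof.
have cEr : mcomp (sstr Z) (ci c) = mcomp (cj c) (Spec_map (cphi c)) := cE c.
apply: mor_ext => R x /=.
have := mor_pt cEr (rcomp x pL : Spec (cB c) R); rewrite /= => ->.
have := mor_pt sq (rcomp x pR : Spec A' R); rewrite /= => ->.
congr (cj c _ _); apply: rmorph_ext => a /=.
by have := congr1 (fun m : {rmorphism _ -> B'} => x (m a)) (po_comm (cphi c) alpha).
Qed.

Definition bc_i : mor (Spec B') (szfun gZ) :=
  @pblift sch _ _ _ _ _ (pb (sl_map Z) g) (SpecS B') _ _ bc_proof.

Lemma bc_fst : mcomp (gfst Z) bc_i = mcomp (ci c) (Spec_map pL).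
Proof. exact: (@pblift1 sch _ _ _ _ _ (pb (sl_map Z) g) (SpecS B') _ _ bc_proof). Qed.

Lemma bc_str : mcomp (sstr gZ) bc_i = mcomp j' (Spec_map pR).
Proof. exact: (@pblift2 sch _ _ _ _ _ (pb (sl_map Z) g) (SpecS B') _ _ bc_proof). Qed.

(** The open immersion [cj c] is monic, so [y] and [y'] agree on the base ring and define a point of
    the pushout; the projections of [g^* Z] identify it with [x]. *)
Lemma bc_point R (x : szfun gZ R) (y : Spec (cB c) R) (y' : Spec A' R) :
  gfst Z R x = ci c R y -> sstr gZ R x = j' R y' ->
  exists q : Spec B' R, [/\ bc_i R q = x, rcomp q pL = y & rcomp q pR = y'].
Proof.
move=> ey ey'.
have [|q [qL qR]] := @po_lift _ _ _ (cphi c) alpha R y y'.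
  apply: (cj_open c).1.
  have -> : cj c R (rcomp y (cphi c)) = sstr Z R (ci c R y).
    by have := mor_pt (cE c) y; rewrite /= => ->.
  have -> : cj c R (rcomp y' alpha) = g R (j' R y').
    by have := mor_pt sq y'; rewrite /= => ->.
  by rewrite -ey -ey'; exact: (@pb_pointsE _ _ _ _ _ (pb (sl_map Z) g)).
exists q; split=> //; apply: bch_points_ext.
  have := @mor_pt _ _ _ _ bc_fst R q; rewrite /= => ->; rewrite ey.
  by congr (ci c R _).
have := @mor_pt _ _ _ _ bc_str R q; rewrite /= => ->; rewrite ey'.
by congr (j' R _).
Qed.

Lemma bc_i_open : open_immersion bc_i.
Proof.
split.
  move=> R x y e; apply: po_ext => [b|a].
    have e' : rcomp x pL = rcomp y pL.
      apply: (ci_open c).1; have ex := mor_pt bc_fst.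
      by have := ex R x; have := ex R y; rewrite /= e => -> .
    exact: (congr1 (fun m : {rmorphism _ -> R} => m b) e').
  have e' : rcomp x pR = rcomp y pR.
    apply: oj'.1; have ex := mor_pt bc_str.
    by have := ex R x; have := ex R y; rewrite /= e => -> .
  exact: (congr1 (fun m : {rmorphism _ -> R} => m a) e').
(* The image is the intersection of the preimages of the two opens [ci c] and [j']. *)
apply: (@open_ext _ (fun R (x : szfun gZ R) =>
  image (ci c) (gfst Z R x) /\ image j' (sstr gZ R x))).
  move=> R x; split=> [[[y ey] [y' ey']]|[q <-]].
    by have [q [qx _ _]] := bc_point (esym ey) (esym ey'); exists q.
  split; first by exists (rcomp q pL); have := @mor_pt _ _ _ _ bc_fst R q.
  by exists (rcomp q pR); have := @mor_pt _ _ _ _ bc_str R q.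
apply: open_inter.
  exact: (open_preimage (gfst Z) (ci_open c).2).
exact: (open_preimage (sstr gZ) oj'.2).
Qed.

Definition bc_chart : chart (sstr gZ) := Chart bc_i_open oj' bc_str.

Lemma bc_adapted : @adapted c bc_chart alpha pL.
Proof.
split.
- exact: po_comm.
- exact: bc_fst.
- exact: sq.
- exact: po_gen.
- by move=> R x y y' ey ey'; have [q [qx _ _]] := bc_point ey ey'; exists q.
Qed.

End BaseChangeChart.

(** * The comparison isomorphisms on charts *)

Lemma base_near (V W : scheme) (g : mor V W) (k : fieldType) (v : V k) :
  exists (A A' : ring) (j : mor (Spec A) W) (j' : mor (Spec A') V) (alpha : {rmorphism A -> A'}),
  [/\ open_immersion j, open_immersion j', mcomp g j' = mcomp j (Spec_map alpha)
    & image j' v].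
Proof.
have [_ [I [A [u [ou uc]]]]] := schemeP W; have [i [y yE]] := uc k (g k v).
have [|A' [j' [alpha [oj' sq vj']]]] := @chart_near V W g (A i) (u i) k v (ou i).
  by exists y.
by exists (A i), A', (u i), j', alpha; split.
Qed.

Lemma chart_over (S : scheme) (Z : Sch_over S) (A : ring) (j : mor (Spec A) S)
    (oj : open_immersion j) (k : fieldType) (x : szfun Z k) : image j (sstr Z k x) ->
  exists (B : ring) (i : mor (Spec B) (szfun Z)) (phi : {rmorphism A -> B})
    (oi : open_immersion i) (E : mcomp (sstr Z) i = mcomp j (Spec_map phi)), image i x.
Proof.
by move=> xj; have [B [i [phi [oi E xi]]]] := chart_near oj xj; exists B, i, phi, oi, E.
Qed.

Lemma smor_str (S : scheme) (Z Z' : Sch_over S) (h : hom Z Z') R (x : szfun Z R) :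
  sstr Z' R (smor h R x) = sstr Z R x.
Proof. exact: (mor_pt (sl_morE h)). Qed.

Lemma smor_inj (S : scheme) (Z Z' : Sch_over S) (h k : hom Z Z') :
  smor h = smor k -> h = k.
Proof. exact: (@slice_hom_ext sch S Z Z' h k). Qed.

Section Comparison.
Variables (pb : cleavage sch) (z : forall S : scheme, zariski_tangent S).
Variable b : forall (V W : scheme) (g : mor V W) (Z : Sch_over W),
  base_change_iso pb g (z V) (z W) Z.

Local Notation T S := (zT (z S)).
Local Notation t S := (zt (z S)).
Local Notation kk S := (zk (z S)).
Local Notation bc g Z := (@bch sch pb _ _ g Z).
Local Notation bfst g Z := (@bch_fst sch pb _ _ g Z : mor (szfun (bc g Z)) (szfun Z)).
Local Notation bhom g h := (@bch_hom sch pb _ _ g _ _ h).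
Local Notation bT g Z := (gT (b g Z)).

Lemma bhom_fst (V W : scheme) (g : mor V W) (Z Z' : Sch_over W) (h : hom Z Z') R
    (x : szfun (bc g Z) R) :
  bfst g Z' R (smor (bhom g h) R x) = smor h R (bfst g Z R x).
Proof. exact: (mor_pt (@bch_homE sch pb V W g Z Z' h)). Qed.

Lemma tp_tk (S : scheme) (Z : Sch_over S) (c : chart (sstr Z)) R (u : Spec (SymOmega (cphi c)) R) :
  smor (tp (t S) Z) R (tk (kk S) c R u) = ci c R (rcomp u (sb (cphi c))).
Proof. exact: (mor_pt (tk_p (kk S) c)). Qed.

Lemma tk_inj (S : scheme) (Z : Sch_over S) (c : chart (sstr Z)) R
    (u v : Spec (SymOmega (cphi c)) R) :
  tk (kk S) c R u = tk (kk S) c R v -> u = v.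
Proof. exact: (tk_open (kk S) c).1. Qed.

Section OneMorphism.
Variables (V W : scheme) (g : mor V W) (Z : Sch_over W).

(** The affine open of [W] is fixed first, so that the charts of [Z] and of [V] lie over the same
    ring and can be tensored. *)
Lemma adapted_near (k : fieldType) (x : szfun (bc g Z) k) :
  exists (c : chart (sstr Z)) (c' : chart (sstr (bc g Z))) alpha beta,
    adapted (c := c) (c' := c') alpha beta /\ image (ci c') x.
Proof.
have [A [A' [j [j' [alpha [oj oj' sq [v' v'E]]]]]]] := base_near g (sstr (bc g Z) k x).
have ex : sstr Z k (bfst g Z k x) = g k (sstr (bc g Z) k x).
  exact: (@pb_pointsE _ _ _ _ _ (pb (sl_map Z) g)).
have [|B [i [phi [oi [E [y yE]]]]]] := @chart_over W Z A j oj k (bfst g Z k x).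
  by exists (rcomp v' alpha); rewrite ex -v'E; exact: (esym (mor_pt sq v')).
pose c := Chart oi oj E.
exists c, (@bc_chart pb V W g Z c A' j' oj' alpha sq), alpha, (poL (cphi c) alpha).
split; first exact: bc_adapted.
by have [q [qE _ _]] := @bc_point pb V W g Z c A' j' alpha sq k x y v' (esym yE) (esym v'E); exists q.
Qed.

(** The auxiliary [m] locates the points of [X] in [g^* Z]: the preimages of the adapted charts
    cover [X], and there [F] and [G] can be compared in coordinates. *)
Lemma eq_on_charts (X Y : Sch_over V) (F G : hom X Y) (m : hom X (bc g Z)) :
  (forall (c : chart (sstr Z)) (c' : chart (sstr (bc g Z))) alpha beta,
     adapted (c := c) (c' := c') alpha beta ->
     forall R (x : szfun X R) (w0 : Spec (cB c') R),
     smor m R x = ci c' R w0 -> smor F R x = smor G R x) -> F = G.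
Proof.
move=> h; apply: smor_inj; apply: mor_eq_local; first exact: (schemeP (sl_ob Y : scheme)).1.
move=> k x; have [c [c' [alpha [beta [ad xc']]]]] := adapted_near (smor m k x).
exists (fun R x => image (ci c') (smor m R x)); split=> //.
  exact: (open_preimage _ (ci_open c').2).
by move=> R y [w0 w0E]; apply: (h _ _ _ _ ad _ _ w0); rewrite w0E.
Qed.

Variables (c : chart (sstr Z)) (c' : chart (sstr (bc g Z))).
Variables (alpha : {rmorphism cA c -> cA c'}) (beta : {rmorphism cB c -> cB c'}).
Hypothesis ad : adapted (c := c) (c' := c') alpha beta.

Lemma adapted_fst R (w0 : Spec (cB c') R) :
  bfst g Z R (ci c' R w0) = ci c R (rcomp w0 beta).
Proof. exact: (mor_pt (ad_i ad)). Qed.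

Lemma chart_str R (w0 : Spec (cB c') R) :
  sstr (bc g Z) R (ci c' R w0) = cj c' R (rcomp w0 (cphi c')).
Proof. exact: (mor_pt (cE c')). Qed.

(** Here [u] holds the coordinates of the underlying point of T Z, found by [tk_cart], and [w] those
    of its image under the comparison. Each compatibility then becomes an identity of values at
    generators. *)
Lemma gT_compute R (x : szfun (bc g (T W Z)) R) (w0 : Spec (cB c') R) :
  smor (bhom g (tp (t W) Z)) R x = ci c' R w0 ->
  exists (u : Spec (SymOmega (cphi c)) R) (w : Spec (SymOmega (cphi c')) R),
  [/\ bfst g (T W Z) R x = tk (kk W) c R u /\ (forall b, u (sb (cphi c) b) = w0 (beta b)),
      smor (bT g Z) R x = tk (kk V) c' R w,
      forall b', w (sb (cphi c') b') = w0 b'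
    & forall b a', w (sd (cphi c') (beta b * cphi c' a')) = u (sd (cphi c) b) * w0 (cphi c' a')].
Proof.
move=> ex.
have ep : smor (tp (t W) Z) R (bfst g (T W Z) R x) = ci c R (rcomp w0 beta).
  by rewrite -bhom_fst ex adapted_fst.
have [u [[uE ub] _]] := tk_cart (kk W) ep.
have {}ub y : u (sb (cphi c) y) = w0 (beta y).
  exact: (congr1 (fun m : {rmorphism _ -> R} => m y) ub).
have [|w [w1 w2 w3]] := @gT_chart _ _ _ _ _ _ _ (b g Z) c c' alpha beta (ad_phi ad) (ad_i ad)
  (ad_j ad) R x u w0 (esym uE) _ (fun y => esym (ub y)).
  by rewrite -(smor_str (bhom g (tp (t W) Z))) ex chart_str.
by exists u, w.
Qed.

End OneMorphism.

(** * Compatibility with the tangent structure maps *)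

Section Compatibility.
Variables (V W : scheme) (g : mor V W) (Z : Sch_over W).

Lemma gT_p : tp (t V) (bc g Z) ∘ bT g Z = bhom g (tp (t W) Z).
Proof.
apply: (@eq_on_charts _ _ g Z _ _ _ _ (bhom g (tp (t W) Z))) => c c' alpha beta ad R x w0 ex.
have [u [w [_ wE wb _]]] := gT_compute ad ex.
transitivity (smor (tp (t V) (bc g Z)) R (smor (bT g Z) R x)); first by [].
by rewrite ex wE tp_tk; congr (ci c' R _); exact: rmorph_ext.
Qed.

Lemma gT_z : bT g Z ∘ bhom g (tz (t W) Z) = tz (t V) (bc g Z).
Proof.
apply: (@eq_on_charts _ _ g Z _ _ _ _ (idc _)) => c c' alpha beta ad R x w0 ex.
have {}ex : x = ci c' R w0 by [].
have ey : smor (bhom g (tp (t W) Z)) R (smor (bhom g (tz (t W) Z)) R x) = ci c' R w0.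
  have := congr1 (fun m => mapp (smor m) R x) (@bch_homM sch pb _ _ g _ _ _ (tp (t W) Z) (tz (t W) Z)).
  by rewrite tp_z bch_hom1 -ex => e; exact: (esym e).
have [u [w [[uE _] wE wb wd]]] := gT_compute ad ey.
have [_ ax _ _ _] := zP (z W); have [lam [lamb lamd lamE]] := ax _ c.
have [_ ax' _ _ _] := zP (z V); have [lam' [lamb' lamd' lamE']] := ax' _ c'.
have {}uE : u = rcomp (rcomp w0 beta) lam.
  apply: tk_inj; rewrite -uE bhom_fst ex (adapted_fst ad).
  exact: (mor_pt lamE).
transitivity (tk (kk V) c' R w); first exact: wE.
rewrite ex; transitivity (tk (kk V) c' R (rcomp w0 lam')); last exact: (esym (mor_pt lamE' _)).
congr (tk _ _ _ _); apply: (SymOmega_ext (ad_gen ad)) => [y|y a].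
  by rewrite wb /= lamb'.
by rewrite wd uE /= lamd lamd' !rmorph0 mul0r.
Qed.

Lemma gT_add (h : hom (bc g (t2 (t W) Z)) (t2 (t V) (bc g Z))) :
  pb1 (t2 (t V) (bc g Z)) ∘ h = bT g Z ∘ bhom g (pb1 (t2 (t W) Z)) ->
  pb2 (t2 (t V) (bc g Z)) ∘ h = bT g Z ∘ bhom g (pb2 (t2 (t W) Z)) ->
  bT g Z ∘ bhom g (tadd (t W) Z) = tadd (t V) (bc g Z) ∘ h.
Proof.
move=> h1 h2.
apply: (@eq_on_charts _ _ g Z _ _ _ _ (bhom g (tp (t W) Z ∘ pb1 (t2 (t W) Z))))
  => c c' alpha beta ad R x w0 ex.
(* Both projections and the sum have the same image under [p], so their coordinates can all be
   computed over the same [w0]. *)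
have hp (q : hom (t2 (t W) Z : Sch_over W) (T W Z)) :
    tp (t W) Z ∘ q = tp (t W) Z ∘ pb1 (t2 (t W) Z) ->
    smor (bhom g (tp (t W) Z)) R (smor (bhom g q) R x) = ci c' R w0.
  by move=> e; rewrite -ex -e bch_homM.
have [u1 [w1 [[uE1 ub1] wE1 wb1 wd1]]] := gT_compute ad (hp _ (erefl _)).
have [u2 [w2 [[uE2 ub2] wE2 wb2 wd2]]] := gT_compute ad (hp _ (esym (pbE _))).
have [u [w [[uE ub] wE wb wd]]] := gT_compute ad (hp _ (tp_add _ _)).
have [_ _ ax _ _] := zP (z W); have [_ _ ax' _ _] := zP (z V).
rewrite bhom_fst in uE1; rewrite bhom_fst in uE2.
have [v [_ vd vE]] := ax _ _ _ _ _ _ uE1 uE2.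
have {}uE : u = v by apply: tk_inj; rewrite -uE bhom_fst.
have e1 : smor (pb1 (t2 (t V) (bc g Z))) R (smor h R x) = tk (kk V) c' R w1.
  by rewrite -wE1; exact: (congr1 (fun m => mapp (smor m) R x) h1).
have e2 : smor (pb2 (t2 (t V) (bc g Z))) R (smor h R x) = tk (kk V) c' R w2.
  by rewrite -wE2; exact: (congr1 (fun m => mapp (smor m) R x) h2).
have [v' [vb' vd' vE']] := ax' _ _ _ _ _ _ e1 e2.
transitivity (tk (kk V) c' R w); first exact: wE.
transitivity (tk (kk V) c' R v'); last exact: (esym vE').
congr (tk _ _ _ _); apply: (SymOmega_ext (ad_gen ad)) => [y|y a].
  by rewrite wb (vb' y).1 wb1.
by rewrite wd vd' wd1 wd2 uE vd mulrDl.
Qed.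

Section SecondTangent.
Variables (c : chart (sstr Z)) (c' : chart (sstr (bc g Z))).
Variables (alpha : {rmorphism cA c -> cA c'}) (beta : {rmorphism cB c -> cB c'}).
Hypothesis ad : adapted (c := c) (c' := c') alpha beta.

Lemma adapted_ext (R : ring) (w1 w2 : {rmorphism cB c' -> R}) :
  (forall y, w1 (beta y) = w2 (beta y)) -> (forall a, w1 (cphi c' a) = w2 (cphi c' a)) -> w1 = w2.
Proof.
move=> eb ea; apply: rmorph_ext => y; have [s ->] := ad_gen ad y.
by rewrite !rmorph_sum; apply: eq_bigr => p _; rewrite !rmorphM eb ea.
Qed.

(* The chart of [g^* T Z] with ring [Sym Omega (x) A']. *)
Let e' : chart (sstr (bc g (T W Z))) :=
  @bc_chart pb V W g (T W Z) (tchart (kk W) c) (cA c') (cj c') (cj_open c') alpha (ad_j ad).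
Let pL : {rmorphism SymOmega (cphi c) -> cB e'} := poL (cphi (tchart (kk W) c)) alpha.
Let pR : {rmorphism cA c' -> cB e'} := poR (cphi (tchart (kk W) c)) alpha.

Let e'_fst R (q : Spec (cB e') R) :
  bfst g (T W Z) R (ci e' R q) = tk (kk W) c R (rcomp q pL).
Proof. exact: (mor_pt (@bc_fst pb V W g (T W Z) (tchart (kk W) c) _ _ alpha (ad_j ad)) q). Qed.

Let e'_str R (q : Spec (cB e') R) :
  sstr (bc g (T W Z)) R (ci e' R q) = cj c' R (rcomp q pR).
Proof. exact: (mor_pt (@bc_str pb V W g (T W Z) (tchart (kk W) c) _ _ alpha (ad_j ad)) q). Qed.

(** The universal point of [e'] is projected to [g^* Z], where [ad_point] places it in [c'];
    monicity of the charts gives its values at generators. *)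
Let bhom_p_e' : exists w0 : Spec (cB c') (cB e'),
  [/\ forall R (q : Spec (cB e') R),
        smor (bhom g (tp (t W) Z)) R (ci e' R q) = ci c' R (rcomp q w0),
      forall y, w0 (beta y) = pL (sb (cphi c) y)
    & forall a, w0 (cphi c' a) = pR a].
Proof.
pose x := ci e' _ (rid (cB e')).
have ex1 : bfst g Z _ (smor (bhom g (tp (t W) Z)) _ x) = ci c _ (rcomp pL (sb (cphi c))).
  by rewrite bhom_fst e'_fst tp_tk; congr (ci c _ _); exact: rmorph_ext.
have ex2 : sstr (bc g Z) _ (smor (bhom g (tp (t W) Z)) _ x) = cj c' _ pR.
  by rewrite smor_str e'_str; congr (cj c' _ _); exact: rmorph_ext.
have [w0 w0E] := ad_point ad ex1 ex2.
exists w0; split=> [R q|y|a].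
- have -> : q = zmap (Spec (cB e')) q (rid (cB e')) by apply: rmorph_ext.
  rewrite (mnat (ci e')) (mnat (smor (bhom g (tp (t W) Z)))) -/x -w0E -mnat.
  by congr (ci c' R _); apply: rmorph_ext.
- have : rcomp w0 beta = rcomp pL (sb (cphi c)).
    by apply: (ci_open c).1; rewrite -(adapted_fst ad) w0E.
  by move=> /(congr1 (fun m : {rmorphism _ -> cB e'} => m y)).
- have : rcomp w0 (cphi c') = pR by apply: (cj_open c').1; rewrite -chart_str w0E.
  by move=> /(congr1 (fun m : {rmorphism _ -> cB e'} => m a)).
Qed.

(** The axiom describing T on morphisms takes a ring morphism between charts; evaluating the
    comparison at the universal point of [e'] produces it. *)
Let gT_e' : exists lam : {rmorphism SymOmega (cphi c') -> cB e'},
  [/\ mcomp (smor (bT g Z)) (ci e') = mcomp (tk (kk V) c') (Spec_map lam),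
      forall y, lam (sb (cphi c') (beta y)) = pL (sb (cphi c) y),
      forall a, lam (sb (cphi c') (cphi c' a)) = pR a
    & forall y a, lam (sd (cphi c') (beta y * cphi c' a)) = pL (sd (cphi c) y) * pR a].
Proof.
have [w0 [w0E w0L w0R]] := bhom_p_e'.
have [u [lam [[uE _] lamE lamb lamd]]] := gT_compute ad (w0E _ (rid (cB e'))).
have {}uE : u = pL.
  by apply: tk_inj; rewrite -uE e'_fst; congr (tk _ _ _ _); apply: rmorph_ext.
exists lam; split=> [|y|a|y a].
- rewrite [LHS]point_morE [RHS]point_morE; congr point_mor.
  rewrite [LHS]lamE; congr (tk _ _ _ _); exact: rmorph_ext.
- by rewrite lamb /= w0L.
- by rewrite lamb /= w0R.
- by rewrite lamd uE /= w0R.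
Qed.

(** The comparison for [T W Z] is computed from [tchart c] to [e'], then T of the comparison for [Z]
    from [e'] to [tchart c']. *)
Lemma gT2_compute R (x : szfun (bc g (T W (T W Z))) R) (w0 : Spec (cB c') R) :
  let vb := sb (cphi c) in let vd := sd (cphi c) in
  let wb := sb (cphi (tchart (kk W) c)) in let wd := sd (cphi (tchart (kk W) c)) in
  let vb' := sb (cphi c') in let vd' := sd (cphi c') in
  let wb' := sb (cphi (tchart (kk V) c')) in let wd' := sd (cphi (tchart (kk V) c')) in
  smor (bhom g (tp (t W) Z ∘ tp (t W) (T W Z))) R x = ci c' R w0 ->
  exists (u : Spec (SymOmega (cphi (tchart (kk W) c))) R)
    (w : Spec (SymOmega (cphi (tchart (kk V) c'))) R),
  [/\ bfst g (T W (T W Z)) R x = tk (kk W) (tchart (kk W) c) R u,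
      smor (fmap (T V) (bT g Z) ∘ bT g (T W Z)) R x = tk (kk V) (tchart (kk V) c') R w,
      forall y, w (wb' (vb' y)) = w0 y,
      forall y a, w (wb' (vd' (beta y * cphi c' a))) = u (wb (vd y)) * w0 (cphi c' a)
    & (forall y a, w (wd' (vb' (beta y * cphi c' a))) = u (wd (vb y)) * w0 (cphi c' a)) /\
      (forall y a, w (wd' (vd' (beta y * cphi c' a))) = u (wd (vd y)) * w0 (cphi c' a))].
Proof.
move=> vb vd wb wd vb' vd' wb' wd' ex.
pose x1 := smor (bhom g (tp (t W) (T W Z))) R x.
have ex1 : smor (bhom g (tp (t W) Z)) R x1 = ci c' R w0 by rewrite -ex bch_homM.
have [u1 [w1 [[uE1 ub1] _ _ _]]] := gT_compute ad ex1.
have str1 : sstr (bc g (T W Z)) R x1 = cj c' R (rcomp w0 (cphi c')).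
  by rewrite -(smor_str (bhom g (tp (t W) Z))) ex1 chart_str.
have [q [qE qL qR]] := @bc_point pb V W g (T W Z) (tchart (kk W) c) _ _ alpha (ad_j ad) R x1
  u1 (rcomp w0 (cphi c')) uE1 str1.
have {}qL y : q (pL y) = u1 y by exact: (congr1 (fun m : {rmorphism _ -> R} => m y) qL).
have {}qR a : q (pR a) = w0 (cphi c' a).
  exact: (congr1 (fun m : {rmorphism _ -> R} => m a) qR).
have ad2 : adapted (c := tchart (kk W) c) (c' := e') alpha pL by exact: bc_adapted.
have [u [w [[uE ub] wE wb1 wd1]]] := gT_compute ad2 (esym qE).
have [lam [lamE lamL lamR lamd]] := gT_e'.
have [ax _ _ _ _] := zP (z V).
(* [Lam] is induced by [lam]; both charts lie over [cA c'], hence the identity on base rings. *)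
have [||Lam [Lamb Lamd LamE]] := @ax _ _ (bT g Z) e' (tchart (kk V) c') (rid (cA c')) lam _ lamE.
- by apply: rmorph_ext => a; exact: lamR.
- by apply: mor_ext => S y; rewrite /=; congr (cj c' S _); apply: rmorph_ext.
exists u, (rcomp w Lam); split; last split.
- exact: uE.
- transitivity (smor (fmap (T V) (bT g Z)) R (tk (kk V) e' R w)); last exact: (mor_pt LamE).
  by rewrite -wE.
- move=> y; rewrite /= Lamb wb1.
  have : rcomp q (rcomp lam vb') = w0.
    by apply: adapted_ext => [y'|a]; rewrite /= ?lamL ?lamR ?qL ?qR ?ub1.
  by move=> /(congr1 (fun m : {rmorphism _ -> R} => m y)).
- by move=> y a; rewrite /= Lamb wb1 lamd rmorphM qL qR ub qL.
- move=> y a; rewrite /= Lamd rmorphM rmorphM lamL lamR.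
  by rewrite [w _]wd1 [X in _ * X = _]qR.
- by move=> y a; rewrite /= Lamd lamd [w _]wd1 [X in _ * X = _]qR.
Qed.

End SecondTangent.

(** Both sides vanish at [db] and [delta b]; at [delta db] each gives the value of [u1] at [db],
    multiplied by the scalar from the base. *)
Lemma gT_l : fmap (T V) (bT g Z) ∘ bT g (T W Z) ∘ bhom g (tl (t W) Z) = tl (t V) (bc g Z) ∘ bT g Z.
Proof.
apply: (@eq_on_charts _ _ g Z _ _ _ _ (bhom g (tp (t W) Z))) => c c' alpha beta ad R x w0 ex.
have pp : tp (t W) Z ∘ tp (t W) (T W Z) ∘ tl (t W) Z = tp (t W) Z.
  by rewrite -tp_nat -compcA tl_p compcA tp_z comp1c.
have ey : smor (bhom g (tp (t W) Z ∘ tp (t W) (T W Z))) R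
    (smor (bhom g (tl (t W) Z)) R x) = ci c' R w0.
  rewrite -ex -[in RHS]pp.
  exact: (esym (congr1 (fun m => mapp (smor m) R x) (@bch_homM sch pb _ _ g _ _ _ _ (tl (t W) Z)))).
have [u [w [uE wE wbb wbd [wdb wdd]]]] := gT2_compute ad ey.
have [u1 [w1 [[uE1 ub1] wE1 wb1 wd1]]] := gT_compute ad ex.
have [_ _ _ ax _] := zP (z W); have [lam [[lamb lambd] lamdb lamdd lamE]] := ax _ c.
have [_ _ _ ax' _] := zP (z V); have [lam' [[lamb' lambd'] lamdb' lamdd' lamE']] := ax' _ c'.
have {}uE : u = rcomp u1 lam.
  by apply: tk_inj; rewrite -uE bhom_fst uE1; exact: (mor_pt lamE).
transitivity (tk (kk V) (tchart (kk V) c') R w); first exact: wE.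
transitivity (smor (tl (t V) (bc g Z)) R (tk (kk V) c' R w1)); last by rewrite -wE1.
transitivity (tk (kk V) (tchart (kk V) c') R (rcomp w1 lam')); last exact: (esym (mor_pt lamE' _)).
congr (tk _ _ _ _); apply: (SymOmega2_ext (ad_gen ad)) => [y|y a|y a|y a] /=.
- by rewrite [LHS]wbb lamb' wb1.
- by rewrite [LHS]wbd lambd' uE /= lambd !rmorph0 mul0r.
- by rewrite [LHS]wdb lamdb' uE /= lamdb !rmorph0 mul0r.
- by rewrite [LHS]wdd lamdd' wd1 uE /= lamdd.
Qed.

(** The formulas of [gT2_compute] are symmetric in [db] and [delta b], so exchanging these commutes
    with the comparison. *)
Lemma gT_c : fmap (T V) (bT g Z) ∘ bT g (T W Z) ∘ bhom g (tc (t W) Z) =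
  tc (t V) (bc g Z) ∘ (fmap (T V) (bT g Z) ∘ bT g (T W Z)).
Proof.
apply: (@eq_on_charts _ _ g Z _ _ _ _ (bhom g (tp (t W) Z ∘ tp (t W) (T W Z))))
  => c c' alpha beta ad R x w0 ex.
have pp : tp (t W) Z ∘ tp (t W) (T W Z) ∘ tc (t W) Z = tp (t W) Z ∘ tp (t W) (T W Z).
  by rewrite -compcA tc_p tp_nat.
have ey : smor (bhom g (tp (t W) Z ∘ tp (t W) (T W Z))) R
    (smor (bhom g (tc (t W) Z)) R x) = ci c' R w0.
  rewrite -ex -[in RHS]pp.
  exact: (esym (congr1 (fun m => mapp (smor m) R x) (@bch_homM sch pb _ _ g _ _ _ _ (tc (t W) Z)))).
have [u [w [uE wE wbb wbd [wdb wdd]]]] := gT2_compute ad ey.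
have [u1 [w1 [uE1 wE1 wbb1 wbd1 [wdb1 wdd1]]]] := gT2_compute ad ex.
have [_ _ _ _ ax] := zP (z W); have [lam [[lamb lambd] lamdb lamdd lamE]] := ax _ c.
have [_ _ _ _ ax'] := zP (z V); have [lam' [[lamb' lambd'] lamdb' lamdd' lamE']] := ax' _ c'.
have {}uE : u = rcomp u1 lam.
  by apply: tk_inj; rewrite -uE bhom_fst uE1; exact: (mor_pt lamE).
transitivity (tk (kk V) (tchart (kk V) c') R w); first exact: wE.
transitivity (smor (tc (t V) (bc g Z)) R (tk (kk V) (tchart (kk V) c') R w1)); last by rewrite -wE1.
transitivity (tk (kk V) (tchart (kk V) c') R (rcomp w1 lam')); last exact: (esym (mor_pt lamE' _)).
congr (tk _ _ _ _); apply: (SymOmega2_ext (ad_gen ad)) => [y|y a|y a|y a] /=.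
- by rewrite [LHS]wbb lamb' [RHS]wbb1.
- by rewrite [LHS]wbd lambd' [RHS]wdb1 uE /= lambd.
- by rewrite [LHS]wdb lamdb' [RHS]wbd1 uE /= lamdb.
- by rewrite [LHS]wdd lamdd' [RHS]wdd1 uE /= lamdd.
Qed.

End Compatibility.

(** * Naturality and cocycle condition of the comparison *)

Lemma Spec_map_id (A : ring) (X : zfunctor) (m : mor (Spec A) X) : m = mcomp m (Spec_map (rid A)).
Proof. by apply: mor_ext => R x; congr (m R _); apply: rmorph_ext. Qed.

(** Charts must respect [h]: a chart [d] of [Z'] is chosen at the image point, then a chart [c] of
    [Z] inside its preimage. So [h] is dual to [chi], and its base change to [beta], which is [chi]
    tensored with [A']. *)
Lemma gT_nat (V W : scheme) (g : mor V W) (Z Z' : Sch_over W) (h : hom Z Z') :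
  fmap (T V) (bhom g h) ∘ bT g Z = bT g Z' ∘ bhom g (fmap (T W) h).
Proof.
apply: smor_inj; apply: mor_eq_local; first exact: (schemeP (sl_ob (T V (bc g Z')) : scheme)).1.
move=> k x0; pose x := smor (bhom g (tp (t W) Z)) k x0.
have [A [A' [j [j' [alpha [oj oj' sq [v' v'E]]]]]]] := base_near g (sstr (bc g Z) k x).
have ex : sstr Z k (bfst g Z k x) = g k (sstr (bc g Z) k x).
  exact: (@pb_pointsE _ _ _ _ _ (pb (sl_map Z) g)).
have [|B [i [phi [oi [E yi]]]]] :=
    @chart_over W Z' A j oj k (smor h k (bfst g Z k x)).
  by exists (rcomp v' alpha); rewrite smor_str ex -v'E; exact: (esym (mor_pt sq v')).
have [B1 [i1 [chi [oi1 E1 [y1 y1E]]]]] :=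
  @chart_near (sl_ob Z : scheme) _ (smor h) B i k (bfst g Z k x) oi yi.
have E2 : mcomp (sstr Z) i1 = mcomp j (Spec_map (rcomp chi phi)).
  apply: mor_ext => R w /=.
  rewrite -(smor_str h) [smor h R _](mor_pt E1 w) [LHS](mor_pt E (rcomp w chi)) /=.
  by congr (j R _); apply: rmorph_ext.
pose c := Chart oi1 oj E2; pose d := Chart oi oj E.
pose c' := @bc_chart pb V W g Z c A' j' oj' alpha sq.
pose d' := @bc_chart pb V W g Z' d A' j' oj' alpha sq.
have adc : adapted (c := c) (c' := c') alpha (poL (cphi c) alpha) by exact: bc_adapted.
have add : adapted (c := d) (c' := d') alpha (poL (cphi d) alpha) by exact: bc_adapted.
exists (fun R y => image (ci c') (smor (bhom g (tp (t W) Z)) R y)); split.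
- exact: (open_preimage _ (ci_open c').2).
- by have [q [qE _ _]] := @bc_point pb V W g Z c A' j' alpha sq k x y1 v' (esym y1E) (esym v'E);
    exists q.
move=> R y [w0 /esym w0E].
have [|beta [betaL betaR]] :=
    @po_lift _ _ _ (cphi d) alpha (cB c') (rcomp (poL (cphi c) alpha) chi) (poR (cphi c) alpha).
  by rewrite -po_comm; apply: rmorph_ext.
have {}betaL p : beta (poL (cphi d) alpha p) = poL (cphi c) alpha (chi p).
  exact: (congr1 (fun m : {rmorphism _ -> cB c'} => m p) betaL).
have {}betaR p : beta (poR (cphi d) alpha p) = poR (cphi c) alpha p.
  exact: (congr1 (fun m : {rmorphism _ -> cB c'} => m p) betaR).
have hE : mcomp (smor (bhom g h)) (ci c') = mcomp (ci d') (Spec_map beta).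
  apply: mor_ext => S q; apply: bch_points_ext.
    rewrite [LHS]bhom_fst (adapted_fst adc) (adapted_fst add) [LHS](mor_pt E1 _).
    by congr (i S _); apply: rmorph_ext => p; rewrite /= betaL.
  rewrite [LHS]smor_str !chart_str; congr (j' S _).
  by apply: rmorph_ext => p; rewrite /= betaR.
have [ax _ _ _ _] := zP (z V); have [ax0 _ _ _ _] := zP (z W).
have [||lam [lamb lamd lamE]] := @ax _ _ (bhom g h) c' d' (rid A') beta _ hE.
- by apply: rmorph_ext => p; exact: betaR.
- exact: Spec_map_id.
have [||lam0 [lamb0 lamd0 lamE0]] := @ax0 _ _ h c d (rid A) chi _ E1.
- exact: rmorph_ext.
- exact: Spec_map_id.
have [u [w [[uE ub] wE wb wd]]] := gT_compute adc w0E.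
have w0E' : smor (bhom g (tp (t W) Z')) R (smor (bhom g (fmap (T W) h)) R y) =
    ci d' R (rcomp w0 beta).
  transitivity (smor (bhom g h) R (ci c' R w0)); last exact: (mor_pt hE).
  rewrite -w0E.
  transitivity (smor (bhom g (tp (t W) Z' ∘ fmap (T W) h)) R y); first by rewrite bch_homM.
  by rewrite tp_nat bch_homM.
have [u' [w' [[uE' ub'] wE' wb' wd']]] := gT_compute add w0E'.
have {}uE' : u' = rcomp u lam0.
  by apply: tk_inj; rewrite -uE' bhom_fst uE; exact: (mor_pt lamE0).
transitivity (smor (fmap (T V) (bhom g h)) R (tk (kk V) c' R w)); first by rewrite -wE.
transitivity (tk (kk V) d' R (rcomp w lam)); first exact: (mor_pt lamE).
transitivity (tk (kk V) d' R w'); last exact: (esym wE').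
congr (tk _ _ _ _); apply: (SymOmega_ext (ad_gen add)) => [p|p a].
  by rewrite wb' [LHS]/= lamb wb.
by rewrite [LHS]/= lamd rmorphM betaL betaR [LHS]wd [RHS]wd' uE' /= lamd0 betaR.
Qed.

(** Charts form a tower over [A], [A'] and [A'']. The canonical isomorphism is dual to [beta], from
    the one-step tensor product of [B] with [A''] to the two-step one through [A'], and both sides
    are compared at its pure tensors. *)
Lemma gT_comp (U V W : scheme) (f : mor U V) (g : mor V W) (h : mor U W)
    (e : (h : @hom sch U W) = (g : @hom sch V W) ∘ (f : @hom sch U V)) (Z : Sch_over W) :
  bT h Z ∘ @bch_comp sch pb U V W f g h e (T W Z) =
  fmap (T U) (@bch_comp sch pb U V W f g h e Z) ∘ bT f (bc g Z) ∘ bhom f (bT g Z).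
Proof.
have compfst Y R (x : szfun (bc f (bc g Y)) R) :
    bfst h Y R (smor (@bch_comp sch pb U V W f g h e Y) R x) = bfst g Y R (bfst f (bc g Y) R x).
  exact: (mor_pt (@pblift1 sch _ _ _ _ _ (pb (sl_map Y) h) _ _ _ (bch_comp_proof pb e Y))).
apply: smor_inj; apply: mor_eq_local; first exact: (schemeP (sl_ob (T U (bc h Z)) : scheme)).1.
pose m := bhom f (bhom g (tp (t W) Z)).
move=> k x0; pose x := smor m k x0; pose x1 := bfst f (bc g Z) k x.
have [A [A' [j [j' [alpha [oj oj' sq vj]]]]]] := base_near g (sstr (bc g Z) k x1).
have [v' v'E] := vj.
have ex1 : sstr (bc g Z) k x1 = f k (sstr (bc f (bc g Z)) k x).
  exact: (@pb_pointsE _ _ _ _ _ (pb (sl_map (bc g Z)) f)).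
rewrite ex1 in vj.
have [A'' [j'' [alpha' [oj'' sq' [v'' v''E]]]]] :=
  @chart_near U V f A' j' k (sstr (bc f (bc g Z)) k x) oj' vj.
have ex : sstr Z k (bfst g Z k x1) = g k (sstr (bc g Z) k x1).
  exact: (@pb_pointsE _ _ _ _ _ (pb (sl_map Z) g)).
have [|B [i [phi [oi [E [y yE]]]]]] := @chart_over W Z A j oj k (bfst g Z k x1).
  by exists (rcomp v' alpha); rewrite ex -v'E; exact: (esym (mor_pt sq v')).
have sqh : mcomp h j'' = mcomp j (Spec_map (rcomp alpha' alpha)).
  rewrite e; apply: mor_ext => R w /=.
  have := mor_pt sq' w; rewrite /= => ->; have := mor_pt sq (rcomp w alpha' : Spec A' R).
  by rewrite /= => ->; congr (j R _); apply: rmorph_ext.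
pose c := Chart oi oj E.
pose c' := @bc_chart pb V W g Z c A' j' oj' alpha sq.
pose c'' := @bc_chart pb U V f (bc g Z) c' A'' j'' oj'' alpha' sq'.
pose d := @bc_chart pb U W h Z c A'' j'' oj'' (rcomp alpha' alpha) sqh.
pose pL := poL (cphi c) alpha; pose pR := poR (cphi c) alpha.
pose qL := poL (cphi c') alpha'; pose qR := poR (cphi c') alpha'.
pose rL := poL (cphi c) (rcomp alpha' alpha); pose rR := poR (cphi c) (rcomp alpha' alpha).
have ad1 : adapted (c := c) (c' := c') alpha pL by exact: bc_adapted.
have ad2 : adapted (c := c') (c' := c'') alpha' qL by exact: bc_adapted.
have ad3 : adapted (c := c) (c' := d) (rcomp alpha' alpha) rL by exact: bc_adapted.
exists (fun R y => image (ci c'') (smor m R y)); split.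
- exact: (open_preimage _ (ci_open c'').2).
- have [q [qE _ _]] := @bc_point pb V W g Z c A' j' alpha sq k x1 y v' (esym yE) (esym v'E).
  by have [q' [qE' _ _]] :=
    @bc_point pb U V f (bc g Z) c' A'' j'' alpha' sq' k x q v'' (esym qE) (esym v''E); exists q'.
move=> R p [w0 /esym w0E].
have [|beta [betaL betaR]] := @po_lift _ _ _ (cphi c) (rcomp alpha' alpha) (cB c'') (rcomp qL pL) qR.
  have e1 := po_comm (cphi c) alpha; have e2 := po_comm (cphi c') alpha'.
  apply: rmorph_ext => a.
  have /= e1a := congr1 (fun m : {rmorphism _ -> cB c'} => m a) e1.
  have /= e2a := congr1 (fun m : {rmorphism _ -> cB c''} => m (alpha a)) e2.
  by rewrite /= /pL e1a; exact: e2a.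
have {}betaL q : beta (rL q) = qL (pL q).
  exact: (congr1 (fun m : {rmorphism _ -> cB c''} => m q) betaL).
have {}betaR q : beta (rR q) = qR q.
  exact: (congr1 (fun m : {rmorphism _ -> cB c''} => m q) betaR).
have compE : mcomp (smor (@bch_comp sch pb U V W f g h e Z)) (ci c'') =
    mcomp (ci d) (Spec_map beta).
  apply: mor_ext => S q; apply: bch_points_ext.
    rewrite [LHS]compfst (adapted_fst ad2) (adapted_fst ad1) (adapted_fst ad3).
    by congr (i S _); apply: rmorph_ext => a; rewrite /= betaL.
  rewrite [LHS]smor_str !chart_str; congr (j'' S _).
  by apply: rmorph_ext => a; rewrite /= betaR.
have [ax _ _ _ _] := zP (z U).
have [||lam [lamb lamd lamE]] :=
    @ax _ _ (@bch_comp sch pb U V W f g h e Z) c'' d (rid A'') beta _ compE.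
- by apply: rmorph_ext => a; exact: betaR.
- exact: Spec_map_id.
have w0E1 : smor (bhom f (tp (t V) (bc g Z))) R (smor (bhom f (bT g Z)) R p) = ci c'' R w0.
  by rewrite -w0E /m -(gT_p g Z) bch_homM.
have [u1 [w1 [[uE1 ub1] wE1 wb1 wd1]]] := gT_compute ad2 w0E1.
have w0E0 : smor (bhom g (tp (t W) Z)) R (bfst f (bc g (T W Z)) R p) = ci c' R (rcomp w0 qL).
  by rewrite -bhom_fst -/m w0E (adapted_fst ad2).
have [u0 [w0' [[uE0 ub0] wE0 wb0 wd0]]] := gT_compute ad1 w0E0.
have {}uE1 : u1 = w0' by apply: tk_inj; rewrite -uE1 bhom_fst.
have w0E2 : smor (bhom h (tp (t W) Z)) R (smor (@bch_comp sch pb U V W f g h e (T W Z)) R p) =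
    ci d R (rcomp w0 beta).
  transitivity (smor (@bch_comp sch pb U V W f g h e Z) R (ci c'' R w0)); last exact: (mor_pt compE).
  rewrite -w0E; apply: bch_points_ext; last by rewrite !smor_str.
  by rewrite bhom_fst !compfst !bhom_fst.
have [u2 [w2 [[uE2 ub2] wE2 wb2 wd2]]] := gT_compute ad3 w0E2.
have {}uE2 : u2 = u0 by apply: tk_inj; rewrite -uE2 compfst.
transitivity (tk (kk U) d R w2); first exact: wE2.
transitivity (smor (fmap (T U) (@bch_comp sch pb U V W f g h e Z)) R (tk (kk U) c'' R w1));
  last by rewrite -wE1.
transitivity (tk (kk U) d R (rcomp w1 lam)); last exact: (esym (mor_pt lamE _)).
congr (tk _ _ _ _); apply: (SymOmega_ext (ad_gen ad3)) => [q|q a].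
  by rewrite wb2 [RHS]/= lamb wb1.
rewrite [LHS]wd2 [RHS]/= lamd rmorphM betaL betaR [RHS]wd1 uE1 uE2 /= betaR; congr (_ * _).
(* With second factor 1, the formula for [g] gives the differential of [pL q] itself. *)
by have := wd0 q 1; rewrite !rmorph1 !mulr1.
Qed.

End Comparison.

Theorem theorem6p18 (K : fieldType) (G : algGroup K) (G_smooth : smooth (gstr G))
  (X : gvariety G)
  (Q : quotient_system X) (pb : cleavage sch)
  (z : forall S : scheme, zariski_tangent S)
  (b : forall (V W : scheme) (g : mor V W) (Z : Sch_over W),
         base_change_iso pb g (z V) (z W) Z) :
  let T (Gam : sf_ob G) : functor (Sch_over (qs_sch Q Gam)) (Sch_over (qs_sch Q Gam)) :=
    zT (z (qs_sch Q Gam)) in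
  let tt (Gam : sf_ob G) : tangent_on (T Gam) := zt (z (qs_sch Q Gam)) in
  let bc (Gam Gam' : sf_ob G) (f : sf_hom Gam Gam') (Z : Sch_over (qs_sch Q Gam')) :=
    gT (b _ _ (qs_bar Q f) Z) in
  exists (wd : @pl_functor_wd sch pb (sf_system Q) T bc)
         (TT : tangent_on (pl_functor wd)),
    @is_pl_structure sch pb (sf_system Q) T tt bc wd TT.
Proof.
move=> T tt bc.
have bc_iso i j (f : bH (b := sf_system Q) i j) Z : is_iso (bc i j f Z) by exact: gT_iso.
have bc_nat i j (f : bH (b := sf_system Q) i j) := @gT_nat pb z b _ _ (qs_bar Q f).
(* Here [bsM e] is [qs_barM], the functoriality of the induced maps between quotients. *)
have bc_comp i j k f g h (e : bcomp (b := sf_system Q) (i := i) (j := j) (k := k) f g h) :=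
  gT_comp b (bsM e).
have bc_p i j (f : bH (b := sf_system Q) i j) := @gT_p pb z b _ _ (qs_bar Q f).
have bc_z i j (f : bH (b := sf_system Q) i j) := @gT_z pb z b _ _ (qs_bar Q f).
have bc_add i j (f : bH (b := sf_system Q) i j) := @gT_add pb z b _ _ (qs_bar Q f).
have bc_l i j (f : bH (b := sf_system Q) i j) := @gT_l pb z b _ _ (qs_bar Q f).
have bc_c i j (f : bH (b := sf_system Q) i j) := @gT_c pb z b _ _ (qs_bar Q f).
exists (@pl_wd sch pb (sf_system Q) T bc bc_iso bc_nat bc_comp).
exists (@pc_tangent sch pb (sf_system Q) T tt bc bc_iso bc_nat bc_comp bc_p bc_z bc_add bc_l bc_c).
exact: pc_tangent_pl.
Qed.
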